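(* Let $m\ge 1$, $0\le s\le m$ and $k\in\mathbb N_0$. Then: (i) Under the $H$-action, $\operatorname{Ker}^s_k\tilde\Delta$ decomposes into inequivalent irreducible pieces as $$\operatorname{Ker}_k^s\tilde\Delta=\mathcal H^s_k\oplus\mathbf x\wedge \mathcal H^{s-1}_{k-1}\oplus\mathbf x\bullet \mathcal H^{s+1}_{k-1}\oplus \tilde{\mathcal W}^s_k,$$ where, for $1\le s\le m-1$ and $k\ge 2$, $$\tilde{\mathcal W}^s_k=\big((c_1+1)c_2\,\mathbf x\wedge\mathbf x\bullet+(c_2+1)c_1\,\mathbf x\bullet\mathbf x\wedge\big)\mathcal H^s_{k-2}$$ with $c_1=k-2+s$ and $c_2=k-2+m-s$, and $\tilde{\mathcal W}^s_k=\{0\}$ otherwise; here $\mathcal H^{s'}_{k'}=\{0\}$ unless $0\le s'\le m$ and $k'\in\mathbb N_0$. (ii) Moreover, $$\operatorname{Ker}^s_k\Delta\cap\operatorname{Ker}_k^s\tilde\Delta=\mathcal H^s_k\oplus\mathbf x\wedge \mathcal H^{s-1}_{k-1}\oplus\mathbf x\bullet \mathcal H^{s+1}_{k-1}.$$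
   Context: $\mathbb R_{0,m}$ is the real Clifford algebra generated by the standard basis $e_1,\ldots,e_m$ of $\mathbb R^m$ with relations $e_ie_j+e_je_i=-2\delta_{ij}$; $\mathbb R_{0,m}=\bigoplus_{s=0}^m\mathbb R^s_{0,m}$ where $\mathbb R^s_{0,m}$ is the space of $s$-vectors, and $\mathbb R^1_{0,m}$ is identified with $\mathbb R^m$. For a 1-vector $u$ and an $s$-vector $v$, $u\bullet v=\frac12(uv-(-1)^svu)$ and $u\wedge v=\frac12(uv+(-1)^svu)$, extended linearly in $v$. $\mathcal P^s_k$ denotes the space of $k$-homogeneous polynomials in $\mathbf x=(x_1,\ldots,x_m)\in\mathbb R^m$ with values in $\mathbb R^s_{0,m}$. $\mathbf x=\sum_j e_jx_j$; $\mathbf x\wedge$ and $\mathbf x\bullet$ denote the operators $P\mapsto\mathbf x\wedge P$, $P\mapsto \mathbf x\bullet P$, and products such as $\mathbf x\wedge\mathbf x\bullet$ denote compositions of these operators. $\partial^+P=\sum_j e_j\wedge(\partial_{x_j}P)$, $\partial^-P=\sum_j e_j\bullet(\partial_{x_j}P)$ (so the Dirac operator is $\partial=\sum_je_j\partial_{x_j}=\partial^++\partial^-$). $\Delta=\sum_j\partial_{x_j}^2$ is the Laplace operator and $\tilde\Delta=-(\partial^+\partial^--\partial^-\partial^+)$ the modified Laplace operator (for $P\in\mathcal P^s_k$ one has $\partial P\partial=(-1)^s\tilde\Delta P$, so $\tilde\Delta P=0$ means $P$ is inframonogenic). $\operatorname{Ker}^s_k\Delta=\{P\in\mathcal P^s_k:\Delta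 P=0\}$, $\operatorname{Ker}^s_k\tilde\Delta=\{P\in\mathcal P^s_k:\tilde\Delta P=0\}$. $\mathcal H^s_k=\{P\in\mathcal P^s_k:\partial^+P=0,\ \partial^-P=0\}$ (homogeneous solutions of the Hodge–de Rham system). The $H$-action of $Pin(m)$ on polynomials is $[H(r)P](\mathbf x)=r\,P(r^{-1}\mathbf x\,r)\,r^{-1}$. *)

(* Defs.v *)
From HB Require Import structures.
From mathcomp Require Import all_boot all_order all_algebra.
From mathcomp Require Import reals.
From mathcomp Require Import mpoly.



Unset Printing Implicit Defensive.

Import Order.TTheory GRing.Theory Num.Theory.
Local Open Scope ring_scope.

Section Clifford.
Variables (R : realType) (m : nat).

(* Basis blades e_A of R_{0,m}, A a subset of {1..m} (here 'I_m). *)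
Definition blade := {set 'I_m}.

(* Clifford-algebra-valued polynomials in x = (x_1,...,x_m):
   P = sum_A P_A e_A, with P_A in R[x_1..x_m]. *)
Definition CP := {ffun blade -> {mpoly R[m]}}.

(* e_A e_B = (-1)^(#{(a,b) : a in A, b in B, b < a} + |A cap B|) e_(A symdiff B),
   from e_i e_j = - e_j e_i (i<>j) and e_i^2 = -1. *)
Definition bsign (A B : blade) : nat :=
  (#|[set p : 'I_m * 'I_m | (p.1 \in A) && (p.2 \in B) && (p.2 < p.1)%N]|
   + #|A :&: B|)%N.

Definition symdiff (A B : blade) : blade := (A :\: B) :|: (B :\: A).

Definition cmul (P Q : CP) : CP :=
  [ffun C : blade => \sum_(A : blade) \sum_(B : blade | symdiff A B == C)
      ((-1) ^+ bsign A B) *: (P A * Q B)].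

Definition cone : CP := [ffun A : blade => (A == set0)%:R%:MP].

Definition cvec (j : 'I_m) : CP := [ffun A : blade => (A == [set j])%:R%:MP].

Definition xvar : CP := [ffun A : blade => \sum_(j < m) (A == [set j])%:R *: 'X_j].

Definition gproj (s : nat) (P : CP) : CP :=
  [ffun A : blade => if #|A| == s then P A else 0].

(* u /\ v and u . v for a 1-vector u, extended linearly in v over grades *)
Definition cwedge (u P : CP) : CP :=
  \sum_(s < m.+1) (2%:R : R)^-1 *:
     (cmul u (gproj s P) + (-1) ^+ s *: cmul (gproj s P) u).
Definition cdot (u P : CP) : CP :=
  \sum_(s < m.+1) (2%:R : R)^-1 *:
     (cmul u (gproj s P) - (-1) ^+ s *: cmul (gproj s P) u).

Definition pderiv (j : 'I_m) (P : CP) : CP := [ffun A : blade => mderiv j (P A)].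

Definition dplus (P : CP) : CP := \sum_(j < m) cwedge (cvec j) (pderiv j P).
Definition dminus (P : CP) : CP := \sum_(j < m) cdot (cvec j) (pderiv j P).

Definition lap (P : CP) : CP := \sum_(j < m) pderiv j (pderiv j P).
Definition mlap (P : CP) : CP := - (dplus (dminus P) - dminus (dplus P)).

Definition space := CP -> Prop.

Definition Psk (s k : nat) : space := fun P =>
  (forall A : blade, #|A| != s -> P A = 0) /\
  (forall A : blade, P A \is k.-homog).

Definition KerMLap (s k : nat) : space := fun P => Psk s k P /\ mlap P = 0.
Definition KerLap (s k : nat) : space := fun P => Psk s k P /\ lap P = 0.

(* H^s_k : homogeneous solutions of the Hodge-de Rham system;
   indexed by integers, with H^s_k = {0} unless 0 <= s and 0 <= k
   (for s > m, P^s_k is {0} automatically). *)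
Definition Hsk (s k : nat) : space := fun P =>
  Psk s k P /\ dplus P = 0 /\ dminus P = 0.
Definition HskZ (s k : int) : space := fun P =>
  if (0 <= s) && (0 <= k) then Hsk `|s|%N `|k|%N P else P = 0.

Definition zero_space : space := fun P => P = 0.
Definition img (f : CP -> CP) (S : space) : space :=
  fun Q => exists P, S P /\ Q = f P.

Definition piece1 (s k : nat) : space := HskZ s%:Z k%:Z.
Definition piece2 (s k : nat) : space :=
  img (cwedge xvar) (HskZ (s%:Z - 1) (k%:Z - 1)).
Definition piece3 (s k : nat) : space :=
  img (cdot xvar) (HskZ (s%:Z + 1) (k%:Z - 1)).
Definition Wtilde (s k : nat) : space :=
  if [&& 1 <= s, s <= m.-1 & 2 <= k]%N then
    let c1 := (k - 2 + s)%N in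
    let c2 := (k - 2 + m - s)%N in
    img (fun P => ((c1 + 1) * c2)%:R *: cwedge xvar (cdot xvar P)
                + ((c2 + 1) * c1)%:R *: cdot xvar (cwedge xvar P))
        (Hsk s (k - 2))
  else zero_space.

Definition dsum (V : space) (Ss : seq space) : Prop :=
  (forall P, V P <-> exists Ps : seq CP, size Ps = size Ss /\
       (forall i, (i < size Ss)%N -> nth zero_space Ss i (nth 0 Ps i)) /\
       P = \sum_(Q <- Ps) Q) /\
  (forall Ps Qs : seq CP, size Ps = size Ss -> size Qs = size Ss ->
       (forall i, (i < size Ss)%N -> nth zero_space Ss i (nth 0 Ps i)) ->
       (forall i, (i < size Ss)%N -> nth zero_space Ss i (nth 0 Qs i)) ->
       \sum_(Q <- Ps) Q = \sum_(Q <- Qs) Q -> Ps = Qs).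

Definition vecCP (u : 'I_m -> R) : CP :=
  [ffun A : blade => \sum_(j < m) ((A == [set j])%:R * u j)%:MP].
Definition unit_vec (u : 'I_m -> R) : Prop := \sum_(j < m) u j ^+ 2 = 1.

(* r = u_1 ... u_l in Pin(m), given by a list of unit vectors;
   r^{-1} = (-u_l) ... (-u_1). *)
Definition pin_val (us : seq ('I_m -> R)) : CP :=
  foldr (fun u r => cmul (vecCP u) r) cone us.
Definition pin_inv (us : seq ('I_m -> R)) : CP :=
  foldr (fun u r => cmul (vecCP (fun j => - u j)) r) cone (rev us).
Definition pin_elt (us : seq ('I_m -> R)) : Prop := forall i, (i < size us)%N -> unit_vec (nth (fun _ => 0) us i).

Definition pin_subst (us : seq ('I_m -> R)) : m.-tuple {mpoly R[m]} :=
  [tuple (cmul (pin_inv us) (cmul xvar (pin_val us))) [set i] | i < m].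

Definition Hact (us : seq ('I_m -> R)) (P : CP) : CP :=
  cmul (pin_val us)
       (cmul [ffun A : blade => P A \mPo pin_subst us] (pin_inv us)).

Definition subspace (S : space) : Prop :=
  S 0 /\ (forall P Q, S P -> S Q -> S (P + Q)) /\
  (forall (a : R) P, S P -> S (a *: P)).
Definition H_invariant (S : space) : Prop :=
  forall us P, pin_elt us -> S P -> S (Hact us P).
Definition nonzero_space (S : space) : Prop := exists P, S P /\ P <> 0.

Definition H_irreducible (S : space) : Prop :=
  subspace S /\ H_invariant S /\ nonzero_space S /\
  forall T : space, subspace T -> H_invariant T -> (forall P, T P -> S P) ->
    (forall P, T P -> P = 0) \/ (forall P, S P -> T P).

Definition H_equivalent (S T : space) : Prop :=
  exists f : CP -> CP,
    (forall P Q, S P -> S Q -> f (P + Q) = f P + f Q) /\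
    (forall (a : R) P, S P -> f (a *: P) = a *: f P) /\
    (forall P, S P -> T (f P)) /\
    (forall P Q, S P -> S Q -> f P = f Q -> P = Q) /\
    (forall Q, T Q -> exists P, S P /\ f P = Q) /\
    (forall us P, pin_elt us -> S P -> f (Hact us P) = Hact us (f P)).

End Clifford.

(* Main.v *)
(** Write a_j and b_j for exterior and interior multiplication by e_j, and
    d = sum_j a_j D_j, d' = sum_j b_j D_j, X = sum_j x_j a_j, X' = sum_j x_j b_j.
    On s-vectors of degree k the canonical anticommutation relations give
    d X' + X' d = s + k, d' X + X d' = m - s + k, d X + X d = d' X' + X' d' = 0, and
    the modified Laplacian is d d' - d' d. If it kills P, then d d' P = d' d P lies in
    H^s_(k-2) and determines the last component of P; the components in x /\ H and
    x . H are then read off from d' P and d P. The Laplacian d d' + d' d kills P as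
    well exactly when the last component vanishes.

    For 0 < s < m, irreducibility of H^s_k rests on the highest weight vectors
    w_A = (x_a + i x_b)^k (e_a + i e_b) e_A with #|A| = s - 1, on which the generator of
    the rotations in the (a, b)-plane has the largest possible weight k + 1. The
    H-action of reflections is symmetric for the Fischer inner product, so a submodule
    T and its orthogonal complement are both submodules. A nonzero submodule is not
    orthogonal to all the w_A, otherwise a harmonic polynomial built from it would
    vanish on the null cone; hence it contains some w_A, and by rotations all of them.
    Thus T and its complement cannot both be nonzero. For s = 0 or s = m the space is
    zero unless k = 0, and then it is a line.

    The weight k + 1 and the signs with which the coordinate reflections act on w_A
    recover (s, k) up to the parity of s + k, which is the same for the four pieces.
    Each piece is the image of some H^s'_k' under an injective intertwiner. *)
Require Import Defs.
From mathcomp Require Import complex lra boolp.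
From HB Require Import structures.
From mathcomp Require Import all_boot all_order all_algebra.
From mathcomp Require Import reals.
From mathcomp Require Import mpoly ssrcomplements.
From mathcomp Require Import ring zify.
Import Order.TTheory GRing.Theory Num.Theory.
Local Open Scope ring_scope.

Set Implicit Arguments.
Unset Strict Implicit.
Unset Printing Implicit Defensive.

(** * Exterior algebra operators on blades *)

(** The ground field is real, so a complex highest weight vector is carried as a pair of real
    vectors that a rotation generator turns into each other; a real submodule containing one member
    of the pair contains the other. The group is given only by words in unit vectors. Infinitesimal
    rotations are therefore recovered as finite linear combinations of group elements, which is
    possible because the action is polynomial once the vectors are left unnormalised; this is why
    reflections are first defined for arbitrary vectors. Submodules are bare predicates without a
    dimension, and orthogonal projections onto them come from an induction on coordinates. A single
    plane (a, b) takes the place of a maximal torus: the vectors of extremal weight for that plane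
    still depend on a blade A, and the coordinate reflections are what tells these blades apart.
    Exterior and interior multiplication carry the computations because both are linear and
    independent of the grade, unlike the definitions of the wedge and dot products. *)

Section Fock.
Variable m : nat.
Implicit Types (i j : 'I_m) (A B C : {set 'I_m}).

(* The sign of moving e_j past the basis vectors of e_A with smaller index. *)
Definition lowpar j A : bool := odd #|[set i in A | (i < j)%N]|.

Lemma lowparD1 j i A :
  lowpar j (A :\ i) = lowpar j A (+) ((i \in A) && (i < j)%N).
Proof.
rewrite /lowpar.
have -> : [set x in A :\ i | (x < j)%N] = [set x in A | (x < j)%N] :\ i.
  by apply/setP=> x; rewrite !inE andbA.
rewrite [in RHS](cardsD1 i) inE oddD.
by case: (_ && _); case: odd.
Qed.

Lemma lowparU1 j i A :
  lowpar j (i |: A) = lowpar j A (+) ((i \notin A) && (i < j)%N).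
Proof.
case: (boolP (i \in A)) => iA /=.
  by rewrite addbF; congr lowpar; apply/setUidPr; rewrite sub1set.
by rewrite -{2}(setU1K iA) lowparD1 setU11 /=; case: lowpar; case: (_ < _)%N.
Qed.

Section Ops.
Variable V : zmodType.
Local Notation F := {ffun {set 'I_m} -> V}.
Implicit Types P Q : F.

(** A sign stored as a boolean: signs compose by [addb], so sign identities are settled by case
    analysis in any abelian group. *)
Definition bneg (b : bool) (v : V) := if b then - v else v.

Lemma bnegD b u v : bneg b (u + v) = bneg b u + bneg b v.
Proof. by case: b => //=; rewrite opprD. Qed.
Lemma bnegN b u : bneg b (- u) = - bneg b u.
Proof. by case: b. Qed.
Lemma bneg0 b : bneg b 0 = 0.
Proof. by case: b => //=; rewrite oppr0. Qed.
Lemma bneg_bneg b c u : bneg b (bneg c u) = bneg (b (+) c) u.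
Proof. by case: b; case: c => //=; rewrite opprK. Qed.

(* Exterior and interior multiplication by e_j; left Clifford multiplication by
   e_j is [ext j - ctr j], so that e_j . P is [- ctr j P]. *)
Definition ext j P : F :=
  [ffun A : {set 'I_m} => if j \in A then bneg (lowpar j A) (P (A :\ j)) else 0].
Definition ctr j P : F :=
  [ffun A : {set 'I_m} => if j \in A then 0 else bneg (lowpar j A) (P (j |: A))].

Lemma ext_is_additive j : zmod_morphism (ext j).
Proof.
move=> P Q; apply/ffunP=> A; rewrite !ffunE; case: ifP; rewrite ?subr0 //.
by rewrite bnegD bnegN.
Qed.
Lemma ctr_is_additive j : zmod_morphism (ctr j).
Proof.
move=> P Q; apply/ffunP=> A; rewrite !ffunE; case: ifP; rewrite ?subr0 //.
by rewrite bnegD bnegN.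
Qed.
HB.instance Definition _ j := GRing.isZmodMorphism.Build F F (ext j) (ext_is_additive j).
HB.instance Definition _ j := GRing.isZmodMorphism.Build F F (ctr j) (ctr_is_additive j).

Lemma extE j P A : ext j P A = if j \in A then bneg (lowpar j A) (P (A :\ j)) else 0.
Proof. by rewrite ffunE. Qed.
Lemma ctrE j P A : ctr j P A = if j \in A then 0 else bneg (lowpar j A) (P (j |: A)).
Proof. by rewrite ffunE. Qed.

Lemma extext i j P : ext i (ext j P) = - ext j (ext i P).
Proof.
apply/ffunP=> A; rewrite !ffunE !inE.
case: (eqVneq i j) => [->|ij].
  by rewrite ?eqxx /= ?bneg0 ?if_same ?oppr0.
case: (boolP (i \in A)) => iA; case: (boolP (j \in A)) => jA;
  rewrite ?(eq_sym j i) ?ij /= ?bneg0 ?oppr0 //.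
rewrite !bneg_bneg !lowparD1 iA jA /= !setDDl (setUC [set i]).
have : (i < j)%N = ~~ (j < i)%N by rewrite -leqNgt ltn_neqAle ij.
by move=> ->; case: (j < i)%N; case: (lowpar i A); case: (lowpar j A);
  rewrite /= ?opprK.
Qed.

Lemma ctrctr i j P : ctr i (ctr j P) = - ctr j (ctr i P).
Proof.
apply/ffunP=> A; rewrite !ffunE !inE.
case: (eqVneq i j) => [->|ij].
  by rewrite ?eqxx /= ?bneg0 ?if_same ?oppr0.
case: (boolP (i \in A)) => iA; case: (boolP (j \in A)) => jA;
  rewrite ?(eq_sym j i) ?(negbTE ij) ?iA ?jA /= ?bneg0 ?oppr0 ?orbT //.
rewrite ?(negbTE iA) ?(negbTE jA) !bneg_bneg !lowparU1 iA jA /= !setUA (setUC [set i]).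
have : (i < j)%N = ~~ (j < i)%N by rewrite -leqNgt ltn_neqAle ij.
by move=> ->; case: (j < i)%N; case: (lowpar i A); case: (lowpar j A);
  rewrite /= ?opprK.
Qed.

Lemma extctr i j P : i != j -> ext i (ctr j P) = - ctr j (ext i P).
Proof.
move=> ij; apply/ffunP=> A; rewrite !ffunE !inE (negbTE ij) (eq_sym j i) ij /=.
case: (boolP (i \in A)) => iA; case: (boolP (j \in A)) => jA;
  rewrite /= ?bneg0 ?oppr0 ?bneg_bneg //.
have -> : (j |: A) :\ i = j |: (A :\ i).
  by rewrite setDUl; congr (_ :|: _); apply/setP=> x; rewrite !inE;
     have [->|] := eqVneq x j; rewrite ?andbF // eq_sym ij.
rewrite lowparD1 lowparU1 iA jA /=.
have : (i < j)%N = ~~ (j < i)%N by rewrite -leqNgt ltn_neqAle ij.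
by move=> ->; case: (j < i)%N; case: (lowpar i A); case: (lowpar j A);
  rewrite /= ?opprK.
Qed.

Lemma ext_ctrE j P A : ext j (ctr j P) A = if j \in A then P A else 0.
Proof.
rewrite !ffunE; case: ifP => // jA.
by rewrite !inE eqxx /= bneg_bneg lowparD1 ltnn andbF addbF addbb /= setD1K.
Qed.

Lemma ctr_extE j P A : ctr j (ext j P) A = if j \in A then 0 else P A.
Proof.
rewrite !ffunE; case: ifP => // /negbT jA.
by rewrite !inE eqxx /= bneg_bneg lowparU1 ltnn andbF addbF addbb /= setU1K.
Qed.

Lemma extctr_id j P : ext j (ctr j P) + ctr j (ext j P) = P.
Proof.
apply/ffunP=> A; rewrite ffunE ext_ctrE ctr_extE.
by case: ifP; rewrite ?addr0 ?add0r.
Qed.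

Lemma ext_ctr_comm i j P : ext i (ctr j P) = P *+ (i == j) - ctr j (ext i P).
Proof.
have [->|ij] := eqVneq i j; first by rewrite -{2}(extctr_id j P) mulr1n addrK.
by rewrite extctr // sub0r.
Qed.
Lemma ctr_ext_comm i j P : ctr i (ext j P) = P *+ (i == j) - ext j (ctr i P).
Proof. by rewrite ext_ctr_comm eq_sym opprB addrC subrK. Qed.

Lemma ext_sq j P : ext j (ext j P) = 0.
Proof. by apply/ffunP=> A; rewrite !ffunE !inE eqxx bneg0 if_same. Qed.

Lemma ctr_sq j P : ctr j (ctr j P) = 0.
Proof. by apply/ffunP=> A; rewrite !ffunE !inE eqxx /= bneg0 if_same. Qed.

Lemma sum_ext_ctrE P A : (\sum_j ext j (ctr j P)) A = P A *+ #|A|.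
Proof.
rewrite sum_ffunE (eq_bigr (fun j => if j \in A then P A else 0)).
  by rewrite -big_mkcond sumr_const.
by move=> j _; rewrite ext_ctrE.
Qed.

Lemma sum_ctr_extE P A : (\sum_j ctr j (ext j P)) A = P A *+ (m - #|A|).
Proof.
rewrite sum_ffunE (eq_bigr (fun j => if j \in ~: A then P A else 0)).
  rewrite -big_mkcond sumr_const; congr (_ *+ _).
  by apply/eqP; rewrite -(eqn_add2l #|A|) cardsC card_ord subnKC // -[leqRHS]card_ord max_card.
by move=> j _; rewrite ctr_extE inE; case: (_ \in _).
Qed.

End Ops.

Section Cmap.
Variables V W : zmodType.
Definition cmap (f : V -> W) (P : {ffun {set 'I_m} -> V}) : {ffun {set 'I_m} -> W} :=
  [ffun A : {set 'I_m} => f (P A)].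

Lemma ext_cmap (f : V -> W) j P : f 0 = 0 -> {morph f : x / - x} ->
  ext j (cmap f P) = cmap f (ext j P).
Proof.
move=> f0 fN; apply/ffunP=> A; rewrite !ffunE; case: ifP; rewrite ?f0 //.
by rewrite /bneg; case: lowpar; rewrite ?fN ?ffunE.
Qed.
Lemma ctr_cmap (f : V -> W) j P : f 0 = 0 -> {morph f : x / - x} ->
  ctr j (cmap f P) = cmap f (ctr j P).
Proof.
move=> f0 fN; apply/ffunP=> A; rewrite !ffunE; case: ifP; rewrite ?f0 //.
by rewrite /bneg; case: lowpar; rewrite ?fN ?ffunE.
Qed.
End Cmap.

Section Lin.
Variables (R : pzRingType) (V : lmodType R).
Lemma ext_is_scalable j : scalable (@ext V j).
Proof.
move=> a P; apply/ffunP=> A; rewrite !ffunE; case: ifP; rewrite ?scaler0 // /bneg.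
by case: lowpar; rewrite ?scalerN.
Qed.
Lemma ctr_is_scalable j : scalable (@ctr V j).
Proof.
move=> a P; apply/ffunP=> A; rewrite !ffunE; case: ifP; rewrite ?scaler0 // /bneg.
by case: lowpar; rewrite ?scalerN.
Qed.
HB.instance Definition _ j :=
  GRing.isScalable.Build R _ _ *:%R (@ext V j) (ext_is_scalable j).
HB.instance Definition _ j :=
  GRing.isScalable.Build R _ _ *:%R (@ctr V j) (ctr_is_scalable j).
End Lin.
End Fock.

(** * Clifford multiplication *)

Lemma odd_card_big (T : finType) (P : pred T) :
  odd #|[set x | P x]| = \big[addb/false]_x P x.
Proof.
rewrite -sum1_card (big_morph odd oddD (erefl _)) big_mkcond /=.
by apply: eq_bigr => x _; rewrite inE; case: (P x).
Qed.

Section Clifford.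
Variables (R : realType) (m : nat).
Local Notation CP := (Defs.CP R m).
Local Notation cmul := (Defs.cmul R m).
Local Notation symdiff := (Defs.symdiff m).
Local Notation bsign := (Defs.bsign m).
Local Notation MP := {mpoly R[m]}.
Implicit Types (i j : 'I_m) (A B C : {set 'I_m}) (P Q : CP).

Lemma in_symdiff x A B : (x \in symdiff A B) = (x \in A) (+) (x \in B).
Proof. by rewrite !inE; case: (_ \in A); case: (_ \in B). Qed.

Lemma symdiffC A B : symdiff A B = symdiff B A.
Proof. by apply/setP=> x; rewrite !in_symdiff addbC. Qed.

Lemma symdiffA A B C : symdiff A (symdiff B C) = symdiff (symdiff A B) C.
Proof. by apply/setP=> x; rewrite !in_symdiff addbA. Qed.

Lemma symdiffK A B : symdiff A (symdiff A B) = B.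
Proof. by apply/setP=> x; rewrite !in_symdiff addbA addbb addFb. Qed.

Lemma symdiff_eq A B C : (symdiff A B == C) = (B == symdiff A C).
Proof.
by apply/eqP/eqP=> [<-|->]; rewrite symdiffK.
Qed.

(* [bsign] modulo 2, in a form that is visibly biadditive for the symmetric
   difference; biadditivity of the sign is what makes [cmul] associative. *)
Definition bform A B : bool :=
  \big[addb/false]_(a : 'I_m) \big[addb/false]_(b : 'I_m)
     [&& a \in A, b \in B & (b <= a)%N].

(** The pairs with b < a come from reordering and those with b = a from the squares equal to -1;
    together they are the pairs with b <= a. *)
Lemma odd_bsign A B : odd (bsign A B) = bform A B.
Proof.
rewrite oddD odd_card_big odd_card_big.
rewrite -(pair_bigA _ (fun a b : 'I_m => [&& a \in A & b \in B] && (b < a)%N)) /=.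
rewrite -big_split; apply: eq_bigr => a _ /=.
have -> : (a \in A) && (a \in B)
     = \big[addb/false]_(b : 'I_m) [&& a \in A, b \in B & b == a].
  rewrite (bigD1 a) //= big1 ?addbF ?eqxx ?andbT // => b /negbTE ->.
  by rewrite !andbF.
rewrite -big_split; apply: eq_bigr => b _ /=.
rewrite (leq_eqVlt b a) -val_eqE /=; case: (a \in A); case: (b \in B) => //=.
by case: (ltngtP b a).
Qed.

Lemma bformDl A A' B : bform (symdiff A A') B = bform A B (+) bform A' B.
Proof.
rewrite -big_split; apply: eq_bigr => a _; rewrite -big_split.
by apply: eq_bigr => b _; rewrite in_symdiff /=; do 3!case: (_ \in _); case: leq.
Qed.

Lemma bformDr A B B' : bform A (symdiff B B') = bform A B (+) bform A B'.
Proof.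
rewrite -big_split; apply: eq_bigr => a _; rewrite -big_split.
by apply: eq_bigr => b _; rewrite in_symdiff /=; do 3!case: (_ \in _); case: leq.
Qed.

Lemma bform1l j B : bform [set j] B = lowpar j B (+) (j \in B).
Proof.
rewrite /bform (bigD1 j) //= [X in _ (+) X]big1 ?addbF; last first.
  by move=> a aj; rewrite big1 // => b _; rewrite inE (negbTE aj).
rewrite /lowpar odd_card_big.
have -> : (j \in B) = \big[addb/false]_(b : 'I_m) ((b \in B) && (b == j)).
  rewrite (bigD1 j) //= big1 ?addbF ?eqxx ?andbT // => b /negbTE ->.
  by rewrite !andbF.
rewrite -big_split; apply: eq_bigr => b _ /=.
rewrite inE eqxx (leq_eqVlt b j) -val_eqE /=; case: (b \in B) => //=.
by case: (ltngtP b j).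
Qed.

Lemma bform1r j A : bform A [set j] = lowpar j A (+) odd #|A|.
Proof.
have -> : odd #|A| = odd #|[set x | x \in A]| by rewrite cardsE.
rewrite /lowpar !odd_card_big -big_split; apply: eq_bigr => a _ /=.
rewrite (bigD1 j) //= big1 ?addbF; last first.
  by move=> b bj; rewrite inE (negbTE bj) andbF.
by rewrite inE eqxx leqNgt; case: (a \in A); case: (_ < _)%N.
Qed.

Lemma cmulE P Q C : cmul P Q C =
  \sum_A bneg (bform A (symdiff A C)) (P A * Q (symdiff A C)).
Proof.
rewrite ffunE; apply: eq_bigr => A _.
under eq_bigl => B do rewrite symdiff_eq.
by rewrite big_pred1_eq -signr_odd odd_bsign scaler_sign.
Qed.

Lemma cmulEr P Q C : cmul P Q C =
  \sum_B bneg (bform (symdiff B C) B) (P (symdiff B C) * Q B).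
Proof.
rewrite ffunE (exchange_big_dep xpredT) //=; apply: eq_bigr => B _.
under eq_bigl => A do rewrite symdiffC symdiff_eq.
by rewrite big_pred1_eq -signr_odd odd_bsign scaler_sign.
Qed.

Lemma bneg_sum (V : zmodType) b I (r : seq I) (p : pred I) (E : I -> V) :
  bneg b (\sum_(x <- r | p x) E x) = \sum_(x <- r | p x) bneg b (E x).
Proof. by case: b; rewrite /= ?sumrN. Qed.

Lemma bnegMl b (p q : MP) : bneg b p * q = bneg b (p * q).
Proof. by case: b; rewrite //= mulNr. Qed.

Lemma bnegMr b (p q : MP) : p * bneg b q = bneg b (p * q).
Proof. by case: b; rewrite //= mulrN. Qed.

Lemma cmulA P Q S : cmul P (cmul Q S) = cmul (cmul P Q) S.
Proof.
(* Both sides become sums over the blades of the outer factors P and S; the blade of Q is then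
   determined. *)
apply/ffunP=> C; rewrite cmulE cmulEr.
under eq_bigr => A _ do rewrite cmulEr mulr_sumr bneg_sum.
under [RHS]eq_bigr => B _ do rewrite cmulE mulr_suml bneg_sum.
rewrite exchange_big; apply: eq_bigr => B _; apply: eq_bigr => A _ /=.
rewrite bnegMl bnegMr !bneg_bneg mulrA.
have -> : symdiff A (symdiff B C) = symdiff B (symdiff A C).
  by rewrite symdiffA (symdiffC A) -symdiffA.
congr (bneg _ _); rewrite !bformDr !bformDl.
by do 6!case: (bform _ _).
Qed.

Lemma cmulDl P Q S : cmul (P + Q) S = cmul P S + cmul Q S.
Proof.
apply/ffunP=> C; rewrite cmulE [RHS]ffunE !cmulE -big_split; apply: eq_bigr => A _ /=.
by rewrite ffunE mulrDl bnegD.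
Qed.
Lemma cmulDr P Q S : cmul P (Q + S) = cmul P Q + cmul P S.
Proof.
apply/ffunP=> C; rewrite cmulE [RHS]ffunE !cmulE -big_split; apply: eq_bigr => A _ /=.
by rewrite ffunE mulrDr bnegD.
Qed.
Lemma cmul0l P : cmul 0 P = 0.
Proof. by apply: (addrI (cmul 0 P)); rewrite -cmulDl !addr0. Qed.
Lemma cmul0r P : cmul P 0 = 0.
Proof. by apply: (addrI (cmul P 0)); rewrite -cmulDr !addr0. Qed.

Lemma cmul1l P : cmul (Defs.cone R m) P = P.
Proof.
apply/ffunP=> C; rewrite cmulE (bigD1 set0) //= big1 ?addr0.
  have -> : symdiff set0 C = C by apply/setP=> x; rewrite in_symdiff inE.
  rewrite ffunE eqxx mul1r; have -> // : bform set0 C = false.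
  by rewrite /bform big1 // => a _; rewrite big1 // => b _; rewrite inE.
by move=> A /negbTE A0; rewrite ffunE A0 mpolyC0 mul0r bneg0.
Qed.

Lemma cmul1r P : cmul P (Defs.cone R m) = P.
Proof.
apply/ffunP=> C; rewrite cmulEr (bigD1 set0) //= big1 ?addr0.
  have -> : symdiff set0 C = C by apply/setP=> x; rewrite in_symdiff inE.
  rewrite ffunE eqxx mulr1; have -> // : bform C set0 = false.
  by rewrite /bform big1 // => a _; rewrite big1 // => b _; rewrite inE andbF.
by move=> A /negbTE A0; rewrite ffunE A0 mpolyC0 mulr0 bneg0.
Qed.

(** The grade involution, which absorbs the sign of moving a vector across a blade. *)
Definition ginv P : CP := [ffun A : {set 'I_m} => bneg (odd #|A|) (P A)].
Definition pmul (f : MP) P : CP := cmap ( *%R f) P.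
(** 1-vectors with polynomial coefficients, the common form of [xvar], [cvec] and [vecCP]. *)
Definition pvec (u : 'I_m -> MP) : CP :=
  [ffun A : {set 'I_m} => \sum_j (A == [set j])%:R *: u j].

Lemma ginv_is_additive : zmod_morphism ginv.
Proof. by move=> P Q; apply/ffunP=> A; rewrite !ffunE bnegD bnegN. Qed.
Lemma ginv_is_scalable : scalable ginv.
Proof. by move=> a P; apply/ffunP=> A; rewrite !ffunE /bneg; case: odd; rewrite ?scalerN. Qed.
HB.instance Definition _ := GRing.isZmodMorphism.Build CP CP ginv ginv_is_additive.
HB.instance Definition _ := GRing.isScalable.Build R CP CP *:%R ginv ginv_is_scalable.

Lemma ginvK : involutive ginv.
Proof. by move=> P; apply/ffunP=> A; rewrite !ffunE bneg_bneg addbb. Qed.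

Lemma symdiff1 j C : symdiff [set j] C = if j \in C then C :\ j else j |: C.
Proof.
by apply/setP=> x; rewrite in_symdiff inE; case: ifP => jC; rewrite !inE;
   have [->|] := eqVneq x j; rewrite ?jC.
Qed.

Lemma cmul_pvecl u P : cmul (pvec u) P = \sum_j pmul (u j) (ext j P - ctr j P).
Proof.
apply/ffunP=> C; rewrite sum_ffunE.
rewrite /Defs.cmul ffunE.
under eq_bigr => A _.
  rewrite (big_pred1 (symdiff A C)); last by move=> B; rewrite symdiff_eq.
  rewrite ffunE mulr_suml scaler_sumr.
  over.
rewrite exchange_big; apply: eq_bigr => j _ /=.
rewrite (bigD1 [set j]) //= big1 ?addr0; last first.
  by move=> A /negbTE Aj; rewrite Aj scale0r mul0r scaler0.
rewrite eqxx scale1r -signr_odd odd_bsign scaler_sign -/(bneg _ _) !ffunE bform1l.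
rewrite symdiff1; case: (boolP (j \in C)) => jC.
  by rewrite subr0 !inE eqxx addbF lowparD1 ltnn andbF addbF bnegMr.
by rewrite sub0r !inE eqxx lowparU1 ltnn andbF addbF addbT; case: lowpar;
  rewrite /= ?opprK ?mulrN.
Qed.

(** Moving e_j to the left of e_A costs (-1)^#|A|, and one more sign when j lies in A; hence [ginv],
    and a plus sign before [ctr] where left multiplication has a minus sign. *)
Lemma cmul_pvecr u P : cmul P (pvec u) = \sum_j pmul (u j) (ext j (ginv P) + ctr j (ginv P)).
Proof.
apply/ffunP=> C; rewrite sum_ffunE.
rewrite /Defs.cmul ffunE (exchange_big_dep xpredT) //=.
under eq_bigr => A _.
  rewrite (big_pred1 (symdiff A C)); last by move=> B; rewrite symdiffC symdiff_eq.
  rewrite ffunE mulr_sumr scaler_sumr.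
  over.
rewrite exchange_big; apply: eq_bigr => j _ /=.
rewrite (bigD1 [set j]) //= big1 ?addr0; last first.
  by move=> A /negbTE Aj; rewrite Aj scale0r mulr0 scaler0.
rewrite eqxx scale1r -signr_odd odd_bsign scaler_sign -/(bneg _ _) !ffunE bform1r.
rewrite symdiff1; case: (boolP (j \in C)) => jC.
  by rewrite addr0 lowparD1 ltnn andbF addbF -!bnegMr bneg_bneg mulrC bnegMl bnegMr.
by rewrite add0r lowparU1 ltnn andbF addbF -!bnegMr bneg_bneg mulrC bnegMl bnegMr.
Qed.

End Clifford.

(** * Hodge-de Rham operators *)

Section MPoly.
Variables (R : comNzRingType) (m : nat).
Implicit Types (p q : {mpoly R[m]}).

(** Substitutions, evaluations and derivations are determined by constants, sums and products with a
    variable, so this induction fits them better than one on monomials. *)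
Lemma mpoly_ind_mulX (Pr : {mpoly R[m]} -> Prop) :
  (forall c, Pr c%:MP) -> (forall p q, Pr p -> Pr q -> Pr (p + q)) ->
  (forall j p, Pr p -> Pr ('X_j * p)) -> forall p, Pr p.
Proof.
move=> PC PD PX.
have PM (mm : 'X_{1..m}) c : Pr (c *: 'X_[mm]).
  elim: {mm}(mdeg mm) {-2}mm (erefl (mdeg mm)) => [|n IH] mm dm.
    by move/eqP: dm; rewrite mdeg_eq0 => /eqP->; rewrite mpolyX0 -mul_mpolyC mulr1.
  have [j mj] : exists j, (0 < mm j)%N.
    apply/existsP; apply: contraTT isT => /existsPn mm0.
    move: dm; rewrite mdegE big1 // => j _; apply/eqP.
    by move: (mm0 j); rewrite -eqn0Ngt.
  have mmE : mm = (U_(j) + (mm - U_(j)))%MM.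
    by rewrite addmC submK //; apply/mnm_lepP=> i; rewrite mnm1E; case: eqP => [<-|].
  rewrite mmE mpolyXD scalerAr; apply: PX; apply: IH.
  by move: dm; rewrite {1}mmE mdegD mdeg1 => -[].
elim/mpolyind => [|c mm p _ _ Pp]; first by rewrite -mpolyC0.
exact: PD.
Qed.

Lemma mcoeff_mulX j p (mm : 'X_{1..m}) :
  ('X_j * p)@_mm = if (0 < mm j)%N then p@_(mm - U_(j)) else 0.
Proof.
rewrite mulrC; case: ifP => mj.
  have mmE : mm = (U_(j) + (mm - U_(j)))%MM.
    by rewrite addmC submK //; apply/mnm_lepP=> i; rewrite mnm1E; case: eqP => [<-|].
  by rewrite {1}mmE mcoeffMX.
rewrite (mpolyE p) mulr_suml raddf_sum /= big1 // => a _.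
rewrite -scalerAl -mpolyXD mcoeffZ mcoeffX; case: eqP => [E|]; last by rewrite mulr0.
by move: mj; rewrite -E mnmDE mnm1E eqxx addn1.
Qed.

Lemma euler_homog k p : p \is k.-homog -> \sum_j 'X_j * p^`M(j) = p *+ k.
Proof.
move=> pk; apply/mpolyP=> mm; rewrite raddf_sum mcoeffMn /=.
rewrite (eq_bigr (fun j => p@_mm *+ mm j)); last first.
  move=> j _; rewrite mcoeff_mulX mcoeff_deriv; case: ifP => mj.
    rewrite mnmBE mnm1E eqxx subn1 prednK //; congr (_@__ *+ _).
    by rewrite submK //; apply/mnm_lepP=> i; rewrite mnm1E; case: eqP => [<-|].
  by move/negbT: mj; rewrite -eqn0Ngt => /eqP->.
rewrite sumrMnr -mdegE.
have [/eqP->//|dk] := boolP (mdeg mm == k).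
by rewrite (dhomog_nemf_coeff pk dk) !mul0rn.
Qed.

Lemma mderiv_homog k p j : p \is k.-homog -> p^`M(j) \is k.-1.-homog.
Proof.
move=> pk; apply/dhomogP => mm; rewrite mcoeff_msupp mcoeff_deriv => nz.
suff: mdeg (mm + U_(j)) == k by rewrite mdegD mdeg1 addn1 => /eqP <-.
by apply: contraNT nz => dk; rewrite (dhomog_nemf_coeff pk dk) mul0rn.
Qed.

Lemma mulX_homog k p j : p \is k.-homog -> 'X_j * p \is k.+1.-homog.
Proof. by move=> pk; rewrite -add1n; apply: dhomogM; rewrite // dhomogX /= mdeg1. Qed.

Lemma mderivX1 i j p : ('X_j * p)^`M(i) = p *+ (i == j) + 'X_j * p^`M(i).
Proof.
rewrite mderivM mderivX mnm1E eq_sym; case: eqP => [->|_]; last by rewrite scale0r mul0r.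
have -> : (U_(j) - U_(j))%MM = 0%MM :> 'X_{1..m}.
  by apply/mnmP=> x; rewrite mnmBE subnn mnm0E.
by rewrite scale1r mpolyX0 mul1r.
Qed.
End MPoly.

Section Ops.
Variables (R : realType) (m : nat).
Local Notation CP := (Defs.CP R m).
Local Notation pderiv := (Defs.pderiv R m).
Local Notation MP := {mpoly R[m]}.
Implicit Types (i j : 'I_m) (A B C : {set 'I_m}) (P Q : CP) (s k : nat).

Lemma pmul_is_additive (f : MP) : zmod_morphism (pmul f : CP -> CP).
Proof. by move=> P Q; apply/ffunP=> A; rewrite !ffunE mulrBr. Qed.
Lemma pmul_is_scalable (f : MP) : scalable (pmul f : CP -> CP).
Proof. by move=> a P; apply/ffunP=> A; rewrite !ffunE scalerAr. Qed.
HB.instance Definition _ f :=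
  GRing.isZmodMorphism.Build CP CP (pmul f) (pmul_is_additive f).
HB.instance Definition _ f :=
  GRing.isScalable.Build R CP CP *:%R (pmul f) (pmul_is_scalable f).

Lemma pderiv_is_additive j : zmod_morphism (pderiv j).
Proof. by move=> P Q; apply/ffunP=> A; rewrite !ffunE mderivB. Qed.
Lemma pderiv_is_scalable j : scalable (pderiv j).
Proof. by move=> a P; apply/ffunP=> A; rewrite !ffunE mderivZ. Qed.
HB.instance Definition _ j :=
  GRing.isZmodMorphism.Build CP CP (pderiv j) (pderiv_is_additive j).
HB.instance Definition _ j :=
  GRing.isScalable.Build R CP CP *:%R (pderiv j) (pderiv_is_scalable j).

Definition mulx j : CP -> CP := pmul 'X_j.
HB.instance Definition _ j := GRing.Linear.on (mulx j).

Lemma ext_pmul j (f : MP) P : ext j (pmul f P) = pmul f (ext j P).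
Proof. by apply: ext_cmap => [|p]; rewrite ?mulr0 ?mulrN. Qed.
Lemma ctr_pmul j (f : MP) P : ctr j (pmul f P) = pmul f (ctr j P).
Proof. by apply: ctr_cmap => [|p]; rewrite ?mulr0 ?mulrN. Qed.
Lemma ext_mulx j i P : ext j (mulx i P) = mulx i (ext j P).
Proof. exact: ext_pmul. Qed.
Lemma ctr_mulx j i P : ctr j (mulx i P) = mulx i (ctr j P).
Proof. exact: ctr_pmul. Qed.
Lemma ext_pderiv j i P : ext j (pderiv i P) = pderiv i (ext j P).
Proof. by apply: ext_cmap => [|p]; rewrite ?mderiv0 ?mderivN. Qed.
Lemma ctr_pderiv j i P : ctr j (pderiv i P) = pderiv i (ctr j P).
Proof. by apply: ctr_cmap => [|p]; rewrite ?mderiv0 ?mderivN. Qed.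

Lemma pderivC i j P : pderiv i (pderiv j P) = pderiv j (pderiv i P).
Proof. by apply/ffunP=> A; rewrite !ffunE mderiv_comm. Qed.
Lemma mulxC i j P : mulx i (mulx j P) = mulx j (mulx i P).
Proof. by apply/ffunP=> A; rewrite !ffunE mulrCA. Qed.
Lemma pderiv_mulx i j P : pderiv i (mulx j P) = P *+ (i == j) + mulx j (pderiv i P).
Proof. by apply/ffunP=> A; rewrite !ffunE mderivX1; case: eqP; rewrite ?ffunE. Qed.

Definition extx P := \sum_j mulx j (ext j P).
Definition ctrx P := \sum_j mulx j (ctr j P).
Definition extd P := \sum_j pderiv j (ext j P).
Definition ctrd P := \sum_j pderiv j (ctr j P).
Definition euler P := \sum_j mulx j (pderiv j P).

Let sum_add (f : 'I_m -> CP -> CP) : (forall j, zmod_morphism (f j)) ->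
  zmod_morphism (fun P => \sum_j f j P).
Proof. by move=> fB P Q; rewrite -sumrB; apply: eq_bigr => j _; rewrite fB. Qed.
Let sum_scal (f : 'I_m -> CP -> CP) : (forall j, scalable (f j)) ->
  scalable (fun P => \sum_j f j P).
Proof. by move=> fZ a P; rewrite scaler_sumr; apply: eq_bigr => j _; rewrite fZ. Qed.

Fact extx_add : zmod_morphism extx. Proof. by apply: sum_add => j P Q; rewrite !raddfB. Qed.
Fact ctrx_add : zmod_morphism ctrx. Proof. by apply: sum_add => j P Q; rewrite !raddfB. Qed.
Fact extd_add : zmod_morphism extd. Proof. by apply: sum_add => j P Q; rewrite !raddfB. Qed.
Fact ctrd_add : zmod_morphism ctrd. Proof. by apply: sum_add => j P Q; rewrite !raddfB. Qed.
Fact extx_scal : scalable extx. Proof. by apply: sum_scal => j a P; rewrite !linearZ. Qed.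
Fact ctrx_scal : scalable ctrx. Proof. by apply: sum_scal => j a P; rewrite !linearZ. Qed.
Fact extd_scal : scalable extd. Proof. by apply: sum_scal => j a P; rewrite !linearZ. Qed.
Fact ctrd_scal : scalable ctrd. Proof. by apply: sum_scal => j a P; rewrite !linearZ. Qed.
HB.instance Definition _ := GRing.isZmodMorphism.Build CP CP extx extx_add.
HB.instance Definition _ := GRing.isZmodMorphism.Build CP CP ctrx ctrx_add.
HB.instance Definition _ := GRing.isZmodMorphism.Build CP CP extd extd_add.
HB.instance Definition _ := GRing.isZmodMorphism.Build CP CP ctrd ctrd_add.
HB.instance Definition _ := GRing.isScalable.Build R CP CP *:%R extx extx_scal.
HB.instance Definition _ := GRing.isScalable.Build R CP CP *:%R ctrx ctrx_scal.
HB.instance Definition _ := GRing.isScalable.Build R CP CP *:%R extd extd_scal.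
HB.instance Definition _ := GRing.isScalable.Build R CP CP *:%R ctrd ctrd_scal.

Lemma antisym_sum (G : 'I_m -> 'I_m -> CP) : (forall i j, G i j = - G j i) ->
  \sum_i \sum_j G i j = 0.
Proof.
move=> GN; have E : \sum_i \sum_j G i j = - \sum_i \sum_j G i j.
  rewrite {1}exchange_big -sumrN; apply: eq_bigr => i _; rewrite -sumrN.
  by apply: eq_bigr => j _; rewrite GN.
apply/eqP; rewrite -(inj_eq (scalerI (a := 2) _)) ?pnatr_eq0 //.
by rewrite scaler0 scaler_nat mulr2n {2}E subrr.
Qed.

Lemma extd_sq P : extd (extd P) = 0.
Proof.
rewrite /extd (eq_bigr (fun i => \sum_j pderiv i (pderiv j (ext i (ext j P))))).
  by apply: antisym_sum => i j; rewrite extext pderivC !raddfN.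
by move=> i _; rewrite !raddf_sum /=; apply: eq_bigr => j _; rewrite ext_pderiv.
Qed.
Lemma ctrd_sq P : ctrd (ctrd P) = 0.
Proof.
rewrite /ctrd (eq_bigr (fun i => \sum_j pderiv i (pderiv j (ctr i (ctr j P))))).
  by apply: antisym_sum => i j; rewrite ctrctr pderivC !raddfN.
by move=> i _; rewrite !raddf_sum /=; apply: eq_bigr => j _; rewrite ctr_pderiv.
Qed.

(** The Leibniz rule for D_i x_j splits each double sum below into a diagonal part and a part in
    which the two operators have been exchanged. *)
Lemma sum_diag (F : 'I_m -> 'I_m -> CP) (H : 'I_m -> CP) :
  \sum_i \sum_j (H i *+ (i == j) + F i j) = \sum_i H i + \sum_i \sum_j F i j.
Proof.
rewrite -big_split; apply: eq_bigr => i _; rewrite big_split; congr (_ + _).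
rewrite (bigD1 i) //= eqxx big1 ?addr0 // => j ji.
by rewrite eq_sym (negbTE ji).
Qed.

Lemma extd_extx P : extd (extx P) = - extx (extd P).
Proof.
rewrite /extd /extx.
rewrite (eq_bigr (fun i => \sum_j
   (ext i (ext i P) *+ (i == j) + mulx j (pderiv i (ext i (ext j P)))))).
  rewrite sum_diag big1 ?add0r; last by move=> i _; rewrite ext_sq.
  rewrite exchange_big -sumrN; apply: eq_bigr => j _; rewrite !raddf_sum /=.
  apply: eq_bigr => i _.
  by rewrite ext_pderiv extext !raddfN.
move=> i _; rewrite !raddf_sum /=; apply: eq_bigr => j _.
by rewrite ext_mulx pderiv_mulx; case: eqP => [->|].
Qed.
Lemma ctrd_ctrx P : ctrd (ctrx P) = - ctrx (ctrd P).
Proof.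
rewrite /ctrd /ctrx.
rewrite (eq_bigr (fun i => \sum_j
   (ctr i (ctr i P) *+ (i == j) + mulx j (pderiv i (ctr i (ctr j P)))))).
  rewrite sum_diag big1 ?add0r; last by move=> i _; rewrite ctr_sq.
  rewrite exchange_big -sumrN; apply: eq_bigr => j _; rewrite !raddf_sum /=.
  apply: eq_bigr => i _.
  by rewrite ctr_pderiv ctrctr !raddfN.
move=> i _; rewrite !raddf_sum /=; apply: eq_bigr => j _.
by rewrite ctr_mulx pderiv_mulx; case: eqP => [->|].
Qed.

(** Kronecker symbols arise twice: from commuting D_i past x_j, which leaves the grade-counting sum,
    and from anticommuting a_i past b_j, which leaves the Euler operator. *)
Lemma extd_ctrx P :
  extd (ctrx P) = \sum_j ext j (ctr j P) + euler P - ctrx (extd P).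
Proof.
rewrite /extd /ctrx.
rewrite (eq_bigr (fun i => \sum_j
   (ext i (ctr i P) *+ (i == j) + mulx j (pderiv i (ext i (ctr j P)))))).
  rewrite sum_diag -addrA; congr (_ + _).
  rewrite /euler exchange_big -sumrB; apply: eq_bigr => j _.
  transitivity (mulx j (\sum_i pderiv i (ext i (ctr j P)))); first by rewrite raddf_sum.
  rewrite -raddfB; congr (mulx j _).
  transitivity (\sum_i (pderiv i P *+ (i == j) - pderiv i (ctr j (ext i P)))).
    by apply: eq_bigr => i _; rewrite ext_ctr_comm raddfB raddfMn.
  rewrite big_split sumrN /=; congr (_ - _).
    rewrite (bigD1 j) //= eqxx big1 ?addr0 // => i ij.
    by rewrite (negbTE ij).
  by rewrite raddf_sum; apply: eq_bigr => i _; rewrite /= ctr_pderiv.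
move=> i _; rewrite !raddf_sum /=; apply: eq_bigr => j _.
by rewrite ext_mulx pderiv_mulx; case: eqP => [->|].
Qed.
Lemma ctrd_extx P :
  ctrd (extx P) = \sum_j ctr j (ext j P) + euler P - extx (ctrd P).
Proof.
rewrite /ctrd /extx.
rewrite (eq_bigr (fun i => \sum_j
   (ctr i (ext i P) *+ (i == j) + mulx j (pderiv i (ctr i (ext j P)))))).
  rewrite sum_diag -addrA; congr (_ + _).
  rewrite /euler exchange_big -sumrB; apply: eq_bigr => j _.
  transitivity (mulx j (\sum_i pderiv i (ctr i (ext j P)))); first by rewrite raddf_sum.
  rewrite -raddfB; congr (mulx j _).
  transitivity (\sum_i (pderiv i P *+ (i == j) - pderiv i (ext j (ctr i P)))).
    by apply: eq_bigr => i _; rewrite ctr_ext_comm raddfB raddfMn.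
  rewrite big_split sumrN /=; congr (_ - _).
    rewrite (bigD1 j) //= eqxx big1 ?addr0 // => i ij.
    by rewrite (negbTE ij).
  by rewrite raddf_sum; apply: eq_bigr => i _; rewrite /= ext_pderiv.
move=> i _; rewrite !raddf_sum /=; apply: eq_bigr => j _.
by rewrite ctr_mulx pderiv_mulx; case: eqP => [->|].
Qed.

(** Since D_i D_j is symmetric, only a_i b_j + b_j a_i matters, and this is the Kronecker symbol. *)
Lemma lap_extd_ctrd P : lap R m P = extd (ctrd P) + ctrd (extd P).
Proof.
rewrite /extd /ctrd.
under [X in _ = X + _]eq_bigr => i _.
  rewrite !raddf_sum /=; under eq_bigr => j _ do rewrite ext_pderiv ext_ctr_comm.
  over.
under [X in _ = _ + X]eq_bigr => i _.
  rewrite !raddf_sum /=; under eq_bigr => j _ do rewrite ctr_pderiv.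
  over.
rewrite [X in _ = _ + X]exchange_big -big_split; apply: eq_bigr => i _.
rewrite -big_split (bigD1 i) //= big1 ?addr0.
  by rewrite eqxx !raddfB /= mulr1n subrK.
by move=> j ji; rewrite eq_sym (negbTE ji) sub0r !raddfN /= pderivC addrC subrr.
Qed.
End Ops.

(** With a and b the exterior and interior parts, left multiplication by a vector gives a - b and
    right multiplication, up to the grade sign, a + b. The wedge and dot products are half the sum
    and half the difference. *)
Lemma half_sum (R : realType) (V : lmodType R) (a b : V) :
  2^-1 *: ((a - b) + (a + b)) = a.
Proof.
rewrite addrACA addNr addr0 -mulr2n -scaler_nat scalerA mulVf ?scale1r //.
by rewrite pnatr_eq0.
Qed.
Lemma half_diff (R : realType) (V : lmodType R) (a b : V) :
  2^-1 *: ((a - b) - (a + b)) = - b.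
Proof.
rewrite opprD addrACA subrr add0r -mulr2n -scaler_nat scalerA mulVf ?scale1r //.
by rewrite pnatr_eq0.
Qed.

(** * Wedge and dot products through exterior and interior multiplication; grade and degree *)

Section Wedge.
Variables (R : realType) (m : nat).
Local Notation CP := (Defs.CP R m).
Local Notation pderiv := (Defs.pderiv R m).
Local Notation Psk := (Defs.Psk R m).
Local Notation MP := {mpoly R[m]}.
Implicit Types (i j : 'I_m) (A B C : {set 'I_m}) (P Q : CP) (s k : nat).

Lemma ginv_gproj s P : ginv (Defs.gproj R m s P) = (-1) ^+ s *: Defs.gproj R m s P.
Proof.
apply/ffunP=> A; rewrite !ffunE; case: eqP => [->|]; last by rewrite bneg0 scaler0.
by rewrite -signr_odd scaler_sign.
Qed.

Lemma sum_gproj P : \sum_(s < m.+1) Defs.gproj R m s P = P.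
Proof.
apply/ffunP=> A; rewrite sum_ffunE.
have cA : (#|A| < m.+1)%N by rewrite ltnS -[leqRHS]card_ord max_card.
rewrite (bigD1 (Ordinal cA)) //= ffunE eqxx big1 ?addr0 // => s sA.
by rewrite ffunE; case: eqP => // E; case/eqP: sA; apply: val_inj.
Qed.

Lemma cwedge_pvec u P : cwedge R m (pvec u) P = \sum_j pmul (u j) (ext j P).
Proof.
rewrite -{2}(sum_gproj P) /cwedge.
under [RHS]eq_bigr => j _ do rewrite !raddf_sum /=.
rewrite exchange_big; apply: eq_bigr => s _ /=.
rewrite cmul_pvecl cmul_pvecr ginv_gproj scaler_sumr -big_split scaler_sumr.
apply: eq_bigr => j _ /=; rewrite !linearZ -linearD !linearZ /= scalerA.
rewrite -signr_odd -signr_addb addbb scale1r.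
rewrite -raddfD /= -{3}(half_sum (ext j (Defs.gproj R m s P)) (ctr j (Defs.gproj R m s P))).
by rewrite linearZ.
Qed.

Lemma cdot_pvec u P : cdot R m (pvec u) P = - \sum_j pmul (u j) (ctr j P).
Proof.
rewrite -{2}(sum_gproj P) /cdot -sumrN.
under [RHS]eq_bigr => j _ do rewrite !raddf_sum /=.
rewrite exchange_big; apply: eq_bigr => s _ /=.
rewrite cmul_pvecl cmul_pvecr ginv_gproj scaler_sumr -sumrB scaler_sumr.
apply: eq_bigr => j _ /=; rewrite !linearZ -linearD !linearZ /= scalerA.
rewrite -signr_odd -signr_addb addbb scale1r.
rewrite -raddfB /=; set a := ext j _; set b := ctr j _.
transitivity (pmul (u j) (2^-1 *: (a - b - (a + b)))); first by rewrite linearZ.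
by rewrite half_diff raddfN.
Qed.

Lemma xvarE : Defs.xvar R m = pvec (fun j => 'X_j).
Proof. by []. Qed.

Lemma cvecE j : Defs.cvec R m j = pvec (fun i => ((i == j)%:R)%:MP).
Proof.
apply/ffunP=> A; rewrite !ffunE (bigD1 j) //= eqxx big1 ?addr0.
  by case: (_ == _); rewrite ?scale1r ?scale0r ?mpolyC0.
by move=> i /negbTE ->; rewrite mpolyC0 scaler0.
Qed.

Lemma pmulC c P : pmul c%:MP P = c *: P.
Proof. by apply/ffunP=> A; rewrite !ffunE mul_mpolyC. Qed.

Lemma wedge_xE P : cwedge R m (xvar R m) P = extx P.
Proof. by rewrite xvarE cwedge_pvec. Qed.
Lemma dot_xE P : cdot R m (xvar R m) P = - ctrx P.
Proof. by rewrite xvarE cdot_pvec. Qed.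

Lemma dplusE P : dplus R m P = extd P.
Proof.
apply: eq_bigr => j _; rewrite cvecE cwedge_pvec (bigD1 j) //= big1 ?addr0.
  by rewrite eqxx pmulC scale1r ext_pderiv.
by move=> i /negbTE ->; rewrite pmulC scale0r.
Qed.
Lemma dminusE P : dminus R m P = - ctrd P.
Proof.
rewrite -sumrN; apply: eq_bigr => j _.
rewrite cvecE cdot_pvec (bigD1 j) //= big1 ?addr0.
  by rewrite eqxx pmulC scale1r ctr_pderiv.
by move=> i /negbTE ->; rewrite pmulC scale0r.
Qed.
Lemma mlapE P : mlap R m P = extd (ctrd P) - ctrd (extd P).
Proof. by rewrite /mlap !dplusE !dminusE !raddfN /= opprK opprD opprK. Qed.

Lemma PskP s k P : Psk s k P <->
  (forall A, #|A| != s -> P A = 0) /\ (forall A, P A \is k.-homog).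
Proof. by []. Qed.

Lemma Psk0 s k : Psk s k 0.
Proof. by split=> A; rewrite ffunE // dhomog0. Qed.
Lemma PskD s k P Q : Psk s k P -> Psk s k Q -> Psk s k (P + Q).
Proof.
move=> [P1 P2] [Q1 Q2]; split=> A; rewrite ffunE; last exact: dhomogD.
by move=> As; rewrite P1 ?Q1 ?addr0.
Qed.
Lemma PskZ s k a P : Psk s k P -> Psk s k (a *: P).
Proof.
move=> [P1 P2]; split=> A; rewrite ffunE; last exact: dhomogZ.
by move=> As; rewrite P1 ?scaler0.
Qed.
Lemma PskN s k P : Psk s k P -> Psk s k (- P).
Proof. by rewrite -scaleN1r; apply: PskZ. Qed.
Lemma PskB s k P Q : Psk s k P -> Psk s k Q -> Psk s k (P - Q).
Proof. by move=> HP HQ; apply/PskD/PskN. Qed.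
Lemma Psk_sum s k I (r : seq I) (p : pred I) (F : I -> CP) :
  (forall x, Psk s k (F x)) -> Psk s k (\sum_(x <- r | p x) F x).
Proof. by move=> HF; apply: (big_ind (Psk s k)); [exact: Psk0|exact: PskD|]. Qed.

Lemma bneg_homog k b (p : MP) : p \is k.-homog -> bneg b p \is k.-homog.
Proof. by case: b => // pk; rewrite /bneg -scaleN1r dhomogZ. Qed.

Lemma Psk_ext s k j P : Psk s k P -> Psk s.+1 k (ext j P).
Proof.
move=> [P1 P2]; split=> A; rewrite ffunE; case: ifP => jA //; last 2 first.
- by apply: bneg_homog.
- by rewrite dhomog0.
move=> As; rewrite P1 ?bneg0 //; apply: contraNneq As.
by rewrite (cardsD1 j A) jA add1n => ->.
Qed.

Lemma Psk_ctr s k j P : Psk s k P -> Psk s.-1 k (ctr j P).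
Proof.
move=> [P1 P2]; split=> A; rewrite ffunE; case: ifP => jA //; last 2 first.
- by rewrite dhomog0.
- by apply: bneg_homog.
move=> As; rewrite P1 ?bneg0 //; apply: contraNneq As.
by rewrite cardsU1 jA add1n => <-.
Qed.

(** For s = 0 the truncated predecessor in [Psk_ctr] yields only grade 0; this supplies the
    vanishing that it loses. *)
Lemma Psk_ctr0 k j P : Psk 0 k P -> ctr j P = 0.
Proof.
move=> [P1 P2]; apply/ffunP=> A; rewrite !ffunE; case: ifP => jA //.
by rewrite P1 ?bneg0 // cardsU1 jA.
Qed.

Lemma Psk_gt s k P : (m < s)%N -> Psk s k P -> P = 0.
Proof.
move=> ms [P1 _]; apply/ffunP=> A; rewrite P1 ?ffunE // neq_ltn.
by rewrite (leq_ltn_trans _ ms) // -[leqRHS]card_ord max_card.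
Qed.

Lemma Psk_pderiv s k j P : Psk s k P -> Psk s k.-1 (pderiv j P).
Proof.
move=> [P1 P2]; split=> A; rewrite ffunE; last exact: mderiv_homog.
by move=> As; rewrite P1 ?mderiv0.
Qed.

Lemma Psk_pderiv0 s j P : Psk s 0 P -> pderiv j P = 0.
Proof.
move=> [P1 P2]; apply/ffunP=> A; rewrite !ffunE.
apply/mpolyP=> mm; rewrite mcoeff_deriv mcoeff0.
by rewrite (dhomog_nemf_coeff (P2 A)) ?mul0rn //= mdegD mdeg1 addn1.
Qed.

Lemma Psk_mulx s k j P : Psk s k P -> Psk s k.+1 (mulx j P).
Proof.
move=> [P1 P2]; split=> A; rewrite ffunE; last exact: mulX_homog.
by move=> As; rewrite P1 ?mulr0.
Qed.

Lemma Psk_extx s k P : Psk s k P -> Psk s.+1 k.+1 (extx P).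
Proof. by move=> HP; apply: Psk_sum => j; apply/Psk_mulx/Psk_ext. Qed.
Lemma Psk_ctrx s k P : Psk s k P -> Psk s.-1 k.+1 (ctrx P).
Proof. by move=> HP; apply: Psk_sum => j; apply/Psk_mulx/Psk_ctr. Qed.
Lemma Psk_extd s k P : Psk s k P -> Psk s.+1 k.-1 (extd P).
Proof. by move=> HP; apply: Psk_sum => j; apply/Psk_pderiv/Psk_ext. Qed.
Lemma Psk_ctrd s k P : Psk s k P -> Psk s.-1 k.-1 (ctrd P).
Proof. by move=> HP; apply: Psk_sum => j; apply/Psk_pderiv/Psk_ctr. Qed.
Lemma Psk_extd0 s P : Psk s 0 P -> extd P = 0.
Proof. by move=> HP; apply: big1 => j _; apply/Psk_pderiv0/Psk_ext/HP. Qed.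
Lemma Psk_ctrd0 s P : Psk s 0 P -> ctrd P = 0.
Proof. by move=> HP; apply: big1 => j _; apply/Psk_pderiv0/Psk_ctr/HP. Qed.
Lemma Psk0_ctrd k P : Psk 0 k P -> ctrd P = 0.
Proof. by move=> HP; apply: big1 => j _; rewrite (Psk_ctr0 j HP) raddf0. Qed.
Lemma Psk0_ctrx k P : Psk 0 k P -> ctrx P = 0.
Proof. by move=> HP; apply: big1 => j _; rewrite (Psk_ctr0 j HP) raddf0. Qed.

Lemma euler_Psk s k P : Psk s k P -> euler P = P *+ k.
Proof.
move=> [_ P2]; apply/ffunP=> A; rewrite sum_ffunE -[RHS]/((P *+ k) A) ffunMnE.
rewrite -(euler_homog (P2 A)).
by apply: eq_bigr => j _; rewrite !ffunE.
Qed.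
Lemma sum_ext_ctr_Psk s k P : Psk s k P -> \sum_j ext j (ctr j P) = P *+ s.
Proof.
move=> [P1 _]; apply/ffunP=> A; rewrite sum_ext_ctrE ffunMnE.
by have [->//|As] := eqVneq #|A| s; rewrite P1 ?mul0rn.
Qed.
Lemma sum_ctr_ext_Psk s k P : Psk s k P -> \sum_j ctr j (ext j P) = P *+ (m - s).
Proof.
move=> [P1 _]; apply/ffunP=> A; rewrite sum_ctr_extE ffunMnE.
by have [->//|As] := eqVneq #|A| s; rewrite P1 ?mul0rn.
Qed.

Lemma extd_ctrx_Psk s k P : Psk s k P ->
  extd (ctrx P) = P *+ (s + k) - ctrx (extd P).
Proof.
by move=> HP; rewrite extd_ctrx (sum_ext_ctr_Psk HP) (euler_Psk HP) mulrnDr.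
Qed.
Lemma ctrd_extx_Psk s k P : Psk s k P ->
  ctrd (extx P) = P *+ (m - s + k) - extx (ctrd P).
Proof.
by move=> HP; rewrite ctrd_extx (sum_ctr_ext_Psk HP) (euler_Psk HP) mulrnDr.
Qed.

End Wedge.

(** * The pieces in terms of natural indices, and the operators on solutions of the Hodge-de Rham
    system *)

Section Decomp.
Variables (R : realType) (m : nat).
Local Notation CP := (Defs.CP R m).
Local Notation Psk := (Defs.Psk R m).
Local Notation Hsk := (Defs.Hsk R m).
Local Notation HskZ := (Defs.HskZ R m).
Local Notation subspace := (Defs.subspace R m).
Local Notation piece1 := (Defs.piece1 R m).
Local Notation piece2 := (Defs.piece2 R m).
Local Notation piece3 := (Defs.piece3 R m).
Local Notation Wtilde := (Defs.Wtilde R m).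
Implicit Types (P Q h : CP) (s k : nat).

Lemma HskP s k P : Hsk s k P <-> [/\ Psk s k P, extd P = 0 & ctrd P = 0].
Proof.
rewrite /Defs.Hsk dplusE dminusE; split=> [[HP [-> /eqP]]|[HP -> ->]].
  by rewrite oppr_eq0 => /eqP ->.
by rewrite oppr0.
Qed.

Lemma subspace_Hsk s k : subspace (Hsk s k).
Proof.
split; first by apply/HskP; rewrite !raddf0; split=> //; apply: Psk0.
split=> [P Q /HskP[HP P1 P2] /HskP[HQ Q1 Q2]|a P /HskP[HP P1 P2]]; apply/HskP.
  by rewrite !raddfD /= P1 P2 Q1 Q2 addr0; split=> //; apply: PskD.
by rewrite !linearZ /= P1 P2 scaler0; split=> //; apply: PskZ.
Qed.

Lemma subspace_zero : subspace (Defs.zero_space R m).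
Proof.
rewrite /Defs.zero_space; split=> //; split=> [P Q -> ->|a P ->].
  by rewrite addr0.
by rewrite scaler0.
Qed.

(** Truncated predecessors replace the integer indices; the guard records when these are
    nonnegative. *)
Lemma HskZ_pred s k P : HskZ (s%:Z - 1) (k%:Z - 1) P <->
  if (0 < s)%N && (0 < k)%N then Hsk s.-1 k.-1 P else P = 0.
Proof.
rewrite /Defs.HskZ; case: s => [|s] //; case: k => [|k] //=.
by rewrite !subn1.
Qed.

Lemma HskZ_succ s k P : HskZ (s%:Z + 1) (k%:Z - 1) P <->
  if (0 < k)%N then Hsk s.+1 k.-1 P else P = 0.
Proof.
rewrite /Defs.HskZ; case: k => [|k] //=.
by rewrite subn1 addn1.
Qed.

Lemma piece1P s k P : piece1 s k P <-> Hsk s k P.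
Proof. by []. Qed.

Lemma piece2P s k P : piece2 s k P <->
  exists2 h, (if (0 < s)%N && (0 < k)%N then Hsk s.-1 k.-1 h else h = 0) & P = extx h.
Proof.
split=> [[h [/HskZ_pred Hh ->]]|[h Hh ->]]; exists h; rewrite ?wedge_xE //.
by split; first exact/HskZ_pred.
Qed.

Lemma piece3P s k P : piece3 s k P <->
  exists2 h, (if (0 < k)%N then Hsk s.+1 k.-1 h else h = 0) & P = - ctrx h.
Proof.
split=> [[h [/HskZ_succ Hh ->]]|[h Hh ->]]; exists h; rewrite ?dot_xE //.
by split; first exact/HskZ_succ.
Qed.

(** Because [ctrx] is minus the dot product with x, this is minus the operator that defines
    [Wtilde]. *)
Definition wop c1 c2 (h : CP) : CP :=
  ((c1 + 1) * c2)%:R *: extx (ctrx h) + ((c2 + 1) * c1)%:R *: ctrx (extx h).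

Fact wop_add c1 c2 : zmod_morphism (wop c1 c2).
Proof. by move=> P Q; rewrite /wop !raddfB /= opprD addrACA. Qed.
Fact wop_scal c1 c2 : scalable (wop c1 c2).
Proof.
by move=> a P; rewrite /wop !linearZ /= scalerDr !scalerA [a * _]mulrC [a * _]mulrC.
Qed.
HB.instance Definition _ c1 c2 := GRing.isZmodMorphism.Build CP CP (wop c1 c2) (wop_add c1 c2).
HB.instance Definition _ c1 c2 := GRing.isScalable.Build R CP CP *:%R (wop c1 c2) (wop_scal c1 c2).

Lemma WtildeP s k P : Wtilde s k P <->
  if [&& 1 <= s, s <= m.-1 & 2 <= k]%N
  then exists2 h, Hsk s (k - 2) h & P = - wop (k - 2 + s) (k - 2 + m - s) h
  else P = 0.
Proof.
rewrite /Defs.Wtilde; case: ifP => // _.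
have E h : - wop (k - 2 + s) (k - 2 + m - s) h =
   ((k - 2 + s + 1) * (k - 2 + m - s))%:R *: cwedge R m (xvar R m) (cdot R m (xvar R m) h)
 + ((k - 2 + m - s + 1) * (k - 2 + s))%:R *: cdot R m (xvar R m) (cwedge R m (xvar R m) h).
  by rewrite !wedge_xE !dot_xE raddfN /= !scalerN -opprD.
by split=> [[h [Hh ->]]|[h Hh ->]]; exists h; rewrite -?E.
Qed.

Section Harmonic.
Variables (s k : nat) (h : CP).
Hypothesis Hh : Hsk s k h.

Lemma Hsk_Psk : Psk s k h. Proof. by case/HskP: Hh. Qed.
Lemma Hsk_extd : extd h = 0. Proof. by case/HskP: Hh. Qed.
Lemma Hsk_ctrd : ctrd h = 0. Proof. by case/HskP: Hh. Qed.
Lemma extd_extx_H : extd (extx h) = 0.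
Proof. by rewrite extd_extx Hsk_extd raddf0 oppr0. Qed.
Lemma ctrd_ctrx_H : ctrd (ctrx h) = 0.
Proof. by rewrite ctrd_ctrx Hsk_ctrd raddf0 oppr0. Qed.
Lemma extd_ctrx_H : extd (ctrx h) = (s + k)%:R *: h.
Proof. by rewrite (extd_ctrx_Psk Hsk_Psk) Hsk_extd raddf0 subr0 scaler_nat. Qed.
Lemma ctrd_extx_H : ctrd (extx h) = (m - s + k)%:R *: h.
Proof. by rewrite (ctrd_extx_Psk Hsk_Psk) Hsk_ctrd raddf0 subr0 scaler_nat. Qed.

Hypothesis s_gt0 : (0 < s)%N.
Hypothesis s_le : (s <= m)%N.
Let c1 := (k + s)%N.
Let c2 := (k + m - s)%N.

Lemma extd_extx_ctrx_H : extd (extx (ctrx h)) = (- c1%:R) *: extx h.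
Proof. by rewrite scaleNr extd_extx extd_ctrx_H linearZ addnC. Qed.
Lemma ctrd_ctrx_extx_H : ctrd (ctrx (extx h)) = (- c2%:R) *: ctrx h.
Proof. by rewrite scaleNr ctrd_ctrx ctrd_extx_H linearZ /c2 addnC addnBA. Qed.
(** [extx h] has grade s + 1 and degree k + 1 and is killed by [extd], so the anticommutator
    contributes (s + 1) + (k + 1). *)
Lemma extd_ctrx_extx_H : extd (ctrx (extx h)) = (c1 + 2)%:R *: extx h.
Proof.
rewrite (extd_ctrx_Psk (Psk_extx Hsk_Psk)) extd_extx_H raddf0 subr0 -scaler_nat.
by congr (_%:R *: _); rewrite /c1; lia.
Qed.
Lemma ctrd_extx_ctrx_H : ctrd (extx (ctrx h)) = (c2 + 2)%:R *: ctrx h.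
Proof.
rewrite (ctrd_extx_Psk (Psk_ctrx Hsk_Psk)) ctrd_ctrx_H raddf0 subr0 -scaler_nat.
by congr (_%:R *: _); rewrite /c2; lia.
Qed.

(** The coefficients of [wop] are balanced so that [ctrd] after [extd] and [extd] after [ctrd] give
    the same multiple of h; this is what makes [mlap] kill the result. *)
Lemma ctrd_extd_wop : ctrd (extd (wop c1 c2 h)) = (c1 * c2 * (c1 + c2 + 2))%:R *: h.
Proof.
rewrite /wop !linearD !linearZ /= extd_extx_ctrx_H extd_ctrx_extx_H.
rewrite !linearZ /= !ctrd_extx_H.
have -> : (m - s + k)%N = c2 by rewrite /c2; lia.
rewrite !scalerA -scalerDl; congr (_ *: _); ring.
Qed.
Lemma extd_ctrd_wop : extd (ctrd (wop c1 c2 h)) = (c1 * c2 * (c1 + c2 + 2))%:R *: h.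
Proof.
rewrite /wop !linearD !linearZ /= ctrd_extx_ctrx_H ctrd_ctrx_extx_H.
rewrite !linearZ /= !extd_ctrx_H [(s + k)%N]addnC -/c1.
rewrite !scalerA -scalerDl; congr (_ *: _); ring.
Qed.
Lemma Psk_wop : Psk s k.+2 (wop c1 c2 h).
Proof.
apply/PskD/PskZ/(Psk_ctrx (Psk_extx Hsk_Psk))/PskZ.
by have := Psk_extx (Psk_ctrx Hsk_Psk); rewrite prednK.
Qed.
End Harmonic.
End Decomp.

(** * Decomposition of the kernels *)

Local Opaque Defs.Hsk Defs.Psk.

Section Dsum.
Variables (R : realType) (m : nat).
Local Notation CP := (Defs.CP R m).
Local Notation Psk := (Defs.Psk R m).
Local Notation Hsk := (Defs.Hsk R m).
Local Notation space := (Defs.space R m).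
Local Notation subspace := (Defs.subspace R m).
Local Notation img := (Defs.img R m).
Local Notation dsum := (Defs.dsum R m).
Local Notation piece1 := (Defs.piece1 R m).
Local Notation piece2 := (Defs.piece2 R m).
Local Notation piece3 := (Defs.piece3 R m).
Local Notation Wtilde := (Defs.Wtilde R m).
Implicit Types (P Q h : CP) (s k : nat) (S T V : space).

Lemma subspaceB S P Q : subspace S -> S P -> S Q -> S (P - Q).
Proof.
by move=> [_ [SD SZ]] SP SQ; apply: SD => //; rewrite -scaleN1r; apply: SZ.
Qed.

Lemma subspaceN S P : subspace S -> S P -> S (- P).
Proof. by move=> [_ [_ SZ]] SP; rewrite -scaleN1r; apply: SZ. Qed.

Lemma subspace_img (f : {linear CP -> CP}) S : subspace S -> subspace (img f S).
Proof.
move=> [S0 [SD SZ]]; split; first by exists 0; rewrite raddf0.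
split=> [_ _ [P [SP ->]] [Q [SQ ->]]|a _ [P [SP ->]]].
  by exists (P + Q); rewrite raddfD; split=> //; apply: SD.
by exists (a *: P); rewrite linearZ; split=> //; apply: SZ.
Qed.

Lemma eq_subspace S T : (forall P, S P <-> T P) -> subspace S -> subspace T.
Proof.
move=> ST [S0 [SD SZ]]; split; first exact/ST.
split=> [P Q /ST SP /ST SQ|a P /ST SP]; apply/ST; [exact: SD|exact: SZ].
Qed.

Lemma subspace_if (b : bool) S : subspace S ->
  subspace (fun P => if b then S P else P = 0).
Proof. by case: b => // _; exact: subspace_zero. Qed.

Lemma subspace_piece1 s k : subspace (piece1 s k).
Proof. exact: subspace_Hsk. Qed.

Lemma subspace_piece2 s k : subspace (piece2 s k).
Proof.
apply: (eq_subspace _ (subspace_img (@extx R m) (subspace_if ((0 < s) && (0 < k))%N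
  (subspace_Hsk R m s.-1 k.-1)))) => P.
by split=> [[h [Hh E]]|/piece2P[h Hh E]]; [apply/piece2P|]; exists h.
Qed.

Lemma subspace_piece3 s k : subspace (piece3 s k).
Proof.
apply: (eq_subspace _ (subspace_img (@ctrx R m) (subspace_if (0 < k)%N
  (subspace_Hsk R m s.+1 k.-1)))) => P.
have opp h : (if (0 < k)%N then Hsk s.+1 k.-1 h else h = 0) ->
    if (0 < k)%N then Hsk s.+1 k.-1 (- h) else - h = 0.
  case: ifP => _ => [|->]; last by rewrite oppr0.
  exact: subspaceN (subspace_Hsk R m s.+1 k.-1).
split=> [[h [/opp Hh E]]|/piece3P[h /opp Hh E]]; last first.
  by exists (- h); rewrite raddfN.
by apply/piece3P; exists (- h); rewrite // raddfN opprK.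
Qed.

Lemma subspace_Wtilde s k : subspace (Wtilde s k).
Proof.
set b := [&& 1 <= s, s <= m.-1 & 2 <= k]%N.
apply: (eq_subspace _ (subspace_img (@wop R m (k - 2 + s) (k - 2 + m - s))
  (subspace_if b (subspace_Hsk R m s (k - 2))))) => P.
have opp h : Hsk s (k - 2) h -> Hsk s (k - 2) (- h).
  exact: subspaceN (subspace_Hsk R m s (k - 2)).
split=> [[h]|/WtildeP]; rewrite -/b.
  move=> [Hh E]; apply/WtildeP; rewrite -/b; case: ifP Hh => _ Hh.
    by exists (- h); [exact: opp|rewrite raddfN opprK].
  by rewrite E Hh raddf0.
case: ifP => _ => [[h Hh E]|->]; last by exists 0; rewrite raddf0.
by exists (- h); split; [exact: opp|rewrite raddfN].
Qed.

(** Over subspaces, uniqueness of a decomposition reduces to that of the decomposition of 0 by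
    taking differences. *)
Lemma dsum_criterion V S1 S2 S3 S4 :
  subspace S1 -> subspace S2 -> subspace S3 -> subspace S4 ->
  (forall P, V P <-> exists P1 P2 P3 P4,
     [/\ S1 P1, S2 P2, S3 P3, S4 P4 & P = P1 + P2 + P3 + P4]) ->
  (forall P1 P2 P3 P4, S1 P1 -> S2 P2 -> S3 P3 -> S4 P4 ->
     P1 + P2 + P3 + P4 = 0 -> [/\ P1 = 0, P2 = 0, P3 = 0 & P4 = 0]) ->
  dsum V [:: S1; S2; S3; S4].
Proof.
move=> V1 V2 V3 V4 VE VU; split=> [P|].
  rewrite VE; split.
    move=> [P1 [P2 [P3 [P4 [H1 H2 H3 H4 ->]]]]]; exists [:: P1; P2; P3; P4].
    split=> //; split; first by case=> [|[|[|[|]]]].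
    by rewrite !big_cons big_nil addr0 !addrA.
  case=> [[|P1 [|P2 [|P3 [|P4 [|? ?]]]]] [//= _ [H ->]]].
  exists P1, P2, P3, P4; rewrite !big_cons big_nil addr0 !addrA; split=> //.
  - exact: (H 0%N).
  - exact: (H 1%N).
  - exact: (H 2%N).
  - exact: (H 3%N).
case=> [|P1 [|P2 [|P3 [|P4 [|? ?]]]]] //.
case=> [|Q1 [|Q2 [|Q3 [|Q4 [|? ?]]]]] //= _ _ HP HQ.
rewrite !big_cons !big_nil !addr0 !addrA => E.
have [] := VU (P1 - Q1) (P2 - Q2) (P3 - Q3) (P4 - Q4).
- exact: subspaceB V1 (HP 0%N isT) (HQ 0%N isT).
- exact: subspaceB V2 (HP 1%N isT) (HQ 1%N isT).
- exact: subspaceB V3 (HP 2%N isT) (HQ 2%N isT).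
- exact: subspaceB V4 (HP 3%N isT) (HQ 3%N isT).
- rewrite [P1 - Q1 + _]addrACA -opprD [X in X + _]addrACA -opprD addrACA -opprD.
  by rewrite E subrr.
by do 4![move/eqP; rewrite subr_eq0 => /eqP ->].
Qed.

(** Padding with the zero space lets the criterion for four summands serve the sum of three
    pieces. *)
Lemma dsum_criterion3 V S1 S2 S3 :
  dsum V [:: S1; S2; S3; Defs.zero_space R m] -> dsum V [:: S1; S2; S3].
Proof.
move=> [VE VU].
have ext4 (Ps : seq CP) : size Ps = 3%N ->
    (forall i, (i < 3)%N -> nth (Defs.zero_space R m) [:: S1; S2; S3] i (nth 0 Ps i)) ->
    (forall i, (i < 4)%N ->
      nth (Defs.zero_space R m) [:: S1; S2; S3; Defs.zero_space R m] i (nth 0 (rcons Ps 0) i)).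
  case: Ps => [|P1 [|P2 [|P3 [|? ?]]]] // _ H i i4; have := H i.
  by case: i i4 => [|[|[|[|i]]]] //= _; apply.
split=> [P|Ps Qs sP sQ HP HQ E]; last first.
  have sum0 (Us : seq CP) : \sum_(U <- rcons Us 0) U = \sum_(U <- Us) U.
    by rewrite -cats1 big_cat big_seq1 /= addr0.
  have := VU (rcons Ps 0) (rcons Qs 0); rewrite !size_rcons sP sQ !sum0.
  by move=> /(_ erefl erefl (ext4 _ sP HP) (ext4 _ sQ HQ) E) /rcons_inj[].
rewrite VE; split=> [[Ps [sP [HP ->]]]|[Ps [sP [HP ->]]]].
  case: Ps sP HP => [|P1 [|P2 [|P3 [|P4 [|? ?]]]]] // _ HP.
  exists [:: P1; P2; P3]; split=> //; split.
    by move=> i i3; move: (HP i (ltnW i3)); case: i i3 => [|[|[|]]].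
  by have /= P40 := HP 3%N isT; rewrite !big_cons P40 !big_nil !addr0.
exists (rcons Ps 0); rewrite size_rcons sP; split=> //; split; first exact: ext4.
by rewrite -cats1 big_cat big_seq1 /= addr0.
Qed.

(** [ctrd] detects this piece: on [extx h] it gives h times m - (s - 1) + (k - 1), which is positive
    since s <= m. *)
Lemma piece2_facts s k P : (s <= m)%N -> piece2 s k P ->
  [/\ Psk s k P, extd P = 0, extd (ctrd P) = 0 & ctrd P = 0 -> P = 0].
Proof.
move=> sm /piece2P[h]; case: ifP => [/andP[s0 k0] Hh ->|_ -> ->]; last first.
  by rewrite !raddf0; split=> //; apply: Psk0.
rewrite (ctrd_extx_H Hh) (extd_extx_H Hh) linearZ /= (Hsk_extd Hh) scaler0.
split=> //; first by have := Psk_extx (Hsk_Psk Hh); rewrite !prednK.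
move/eqP; rewrite scaler_eq0 pnatr_eq0 => /orP[|/eqP->]; last by rewrite raddf0.
by move=> /eqP; lia.
Qed.

(** Here [extd] is the detector, with factor (s + 1) + (k - 1). *)
Lemma piece3_facts s k P : piece3 s k P ->
  [/\ Psk s k P, ctrd P = 0, ctrd (extd P) = 0 & extd P = 0 -> P = 0].
Proof.
move=> /piece3P[h]; case: ifP => [k0 Hh ->|_ -> ->]; last first.
  by rewrite !(raddf0, oppr0); split=> //; apply: Psk0.
rewrite !raddfN /= (extd_ctrx_H Hh) (ctrd_ctrx_H Hh) linearZ /= (Hsk_ctrd Hh) scaler0 oppr0.
split=> //; first by have := PskN (Psk_ctrx (Hsk_Psk Hh)); rewrite !prednK.
move/eqP; rewrite oppr_eq0 scaler_eq0 pnatr_eq0 => /orP[|/eqP->]; last by rewrite raddf0 oppr0.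
by move=> /eqP; lia.
Qed.

(** The bounds 1 <= s <= m - 1 make c1 and c2 positive, even for k = 2. *)
Lemma wop_coef_neq0 s k : [&& 1 <= s, s <= m.-1 & 2 <= k]%N ->
  ((k - 2 + s) * (k - 2 + m - s) * (k - 2 + s + (k - 2 + m - s) + 2))%:R != 0 :> R.
Proof.
move=> /and3P[s1 sm k2]; rewrite pnatr_eq0 !muln_eq0 !negb_or -!lt0n.
by apply/andP; split; [apply/andP; split|]; lia.
Qed.

Lemma Wtilde_facts s k P : (s <= m)%N -> Wtilde s k P ->
  [/\ Psk s k P, ctrd (extd P) = extd (ctrd P) & ctrd (extd P) = 0 -> P = 0].
Proof.
move=> sm /WtildeP; case: ifP => [b [h Hh ->]|_ ->]; last first.
  by rewrite !raddf0; split=> //; apply: Psk0.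
case/and3P: (b) => s0 _ k2.
rewrite !raddfN /= (ctrd_extd_wop Hh s0 sm) (extd_ctrd_wop Hh s0 sm).
split=> //.
  by apply: PskN; have := Psk_wop Hh s0; rewrite -addn2 subnK.
move/eqP; rewrite oppr_eq0 scaler_eq0 (negbTE (wop_coef_neq0 b)) /= => /eqP ->.
by rewrite raddf0 oppr0.
Qed.

Lemma pieces_independent s k P1 P2 P3 P4 : (s <= m)%N ->
  piece1 s k P1 -> piece2 s k P2 -> piece3 s k P3 -> Wtilde s k P4 ->
  P1 + P2 + P3 + P4 = 0 -> [/\ P1 = 0, P2 = 0, P3 = 0 & P4 = 0].
Proof.
move=> sm /HskP[_ d1 c1] /(piece2_facts sm)[_ d2 dc2 c2] /piece3_facts[_ c3 cd3 d3].
move=> /(Wtilde_facts sm)[_ _ cd4] E.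
have E4 : P4 = 0.
  apply: cd4; have := congr1 (fun P => ctrd (extd P)) E.
  by rewrite !raddfD /= d1 d2 cd3 !raddf0 !add0r.
have E3 : P3 = 0.
  apply: d3; have := congr1 (@extd R m) E.
  by rewrite E4 addr0 !raddfD /= d1 d2 !raddf0 !add0r.
have E2 : P2 = 0.
  apply: c2; have := congr1 (@ctrd R m) E.
  by rewrite E4 E3 !addr0 !raddfD /= c1 !raddf0 !add0r.
by move: E; rewrite E2 E3 E4 !addr0.
Qed.

(** Shared by both kernels: it applies to P minus its last component for the modified Laplacian, and
    to P itself for the intersection with the harmonic polynomials. *)
Lemma split_both_closed s k P : (s <= m)%N -> Psk s k P ->
  extd (ctrd P) = 0 -> ctrd (extd P) = 0 ->
  exists P1 P2 P3, [/\ piece1 s k P1, piece2 s k P2, piece3 s k P3 & P = P1 + P2 + P3].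
Proof.
move=> sm HP dc cd.
have [k0|k0] := posnP k.
  rewrite {}k0 in HP *; exists P, 0, 0; split; rewrite ?addr0 //.
  - by apply/HskP; rewrite (Psk_extd0 HP) (Psk_ctrd0 HP).
  - by case: (subspace_piece2 s 0).
  - by case: (subspace_piece3 s 0).
have Hd : Hsk s.+1 k.-1 (extd P).
  by apply/HskP; rewrite extd_sq cd; split=> //; apply: Psk_extd.
(* [extd P] has grade s + 1 and degree k - 1, where [extd] after [ctrx] is multiplication by (s + 1)
   + (k - 1) = s + k. *)
pose P3 := ctrx ((s + k)%:R^-1 *: extd P).
have d3 : extd P3 = extd P.
  rewrite /P3 !linearZ /= (extd_ctrx_H Hd) scalerA addSnnS prednK // mulVf ?scale1r //.
  by rewrite pnatr_eq0 -lt0n addn_gt0 k0 orbT.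
have c3 : ctrd P3 = 0 by rewrite /P3 !linearZ /= (ctrd_ctrx_H Hd) scaler0.
have S3 : piece3 s k P3.
  apply/piece3P; rewrite k0; exists (- (s + k)%:R^-1 *: extd P); last first.
    by rewrite scaleNr raddfN opprK.
  by case: (subspace_Hsk R m s.+1 k.-1) => _ [_]; apply.
have [P2 S2 c2] : exists2 P2, piece2 s k P2 & ctrd P2 = ctrd P.
  have [s0|s0] := posnP s.
    exists 0; first by case: (subspace_piece2 s k).
    by rewrite raddf0 (@Psk0_ctrd R m k) // -s0.
  have Hc : Hsk s.-1 k.-1 (ctrd P).
    by apply/HskP; rewrite ctrd_sq dc; split=> //; apply: Psk_ctrd.
  exists (extx ((m - s + k)%:R^-1 *: ctrd P)).
    apply/piece2P; rewrite s0 k0; exists ((m - s + k)%:R^-1 *: ctrd P); last by [].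
    by case: (subspace_Hsk R m s.-1 k.-1) => _ [_]; apply.
  rewrite !linearZ /= (ctrd_extx_H Hc) scalerA.
  have -> : (m - s.-1 + k.-1)%N = (m - s + k)%N by lia.
  by rewrite mulVf ?scale1r // pnatr_eq0; lia.
have [HP2 d2 _ _] := piece2_facts sm S2.
have [HP3 _ _ _] := piece3_facts S3.
exists (P - P2 - P3), P2, P3; split; [|exact: S2|exact: S3|by rewrite addrAC subrK subrK].
apply/HskP; split; first by apply/PskB/HP3/PskB.
  by rewrite !raddfB /= d2 d3 subr0 subrr.
by rewrite !raddfB /= c2 c3 subr0 subrr.
Qed.

Lemma pieces_span s k P : (1 <= m)%N -> (s <= m)%N ->
  KerMLap R m s k P <-> exists P1 P2 P3 P4,
    [/\ piece1 s k P1, piece2 s k P2, piece3 s k P3, Wtilde s k P4 &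
        P = P1 + P2 + P3 + P4].
Proof.
move=> m1 sm; rewrite /KerMLap mlapE; split; last first.
  move=> [P1 [P2 [P3 [P4 [/HskP[H1 d1 c1] S2 S3 S4 ->]]]]].
  have [H2 d2 dc2 _] := piece2_facts sm S2.
  have [H3 c3 cd3 _] := piece3_facts S3.
  have [H4 E4 _] := Wtilde_facts sm S4.
  split; first by do !apply: PskD.
  by rewrite !raddfD /= c1 c3 d1 d2 dc2 cd3 E4 !raddf0 !add0r subrr.
move=> [HP /eqP]; rewrite subr_eq0 => /eqP dc.
suff [P4 S4 E4] : exists2 P4, Wtilde s k P4 & ctrd (extd P4) = ctrd (extd P).
  have [H4 E4' _] := Wtilde_facts sm S4.
  have [||P1 [P2 [P3 [S1 S2 S3 E]]]] := @split_both_closed s k (P - P4) sm (PskB HP H4).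
  - by rewrite !raddfB /= dc -E4' E4 subrr.
  - by rewrite !raddfB /= E4 subrr.
  exists P1, P2, P3, P4; split; [exact: S1|exact: S2|exact: S3|exact: S4|].
  by rewrite -E subrK.
(* Outside this range [ctrd (extd P)] is already 0: by the grade when s is 0 or m, by the degree
   when k < 2. *)
case b: [&& 1 <= s, s <= m.-1 & 2 <= k]%N; last first.
  exists 0; first by case: (subspace_Wtilde s k).
  rewrite !raddf0; move/negbT: b; rewrite !negb_and -!ltnNge => /or3P[s0|ms|k2].
  - have s0' : s = 0%N by lia.
    by rewrite -dc (@Psk0_ctrd R m k) ?raddf0 // -s0'.
  - by rewrite (@Psk_gt R m s.+1 k.-1 (extd P)) ?raddf0 //; [lia|exact: Psk_extd].
  - by rewrite (@Psk_ctrd0 R m s.+1) //; have := Psk_extd HP; have -> : k.-1 = 0%N by lia.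
case/and3P: (b) => s0 _ k2.
set c1 := (k - 2 + s)%N; set c2 := (k - 2 + m - s)%N.
set c : R := (c1 * c2 * (c1 + c2 + 2))%:R.
have HQ : Hsk s (k - 2) (ctrd (extd P)).
  apply/HskP; split; last by rewrite ctrd_sq.
    by have := Psk_ctrd (Psk_extd HP); rewrite -subn2.
  by rewrite -dc extd_sq.
have HQ' : Hsk s (k - 2) (- c^-1 *: ctrd (extd P)).
  by case: (subspace_Hsk R m s (k - 2)) => _ [_]; apply.
exists (- wop c1 c2 (- c^-1 *: ctrd (extd P))).
  by apply/WtildeP; rewrite b; exists (- c^-1 *: ctrd (extd P)).
rewrite !raddfN /= (ctrd_extd_wop HQ' s0 sm) -/c scalerA mulrN mulfV ?(wop_coef_neq0 b) //.
by rewrite scaleN1r opprK.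
Qed.

Lemma dsum_KerMLap s k : (1 <= m)%N -> (s <= m)%N ->
  dsum (KerMLap R m s k) [:: piece1 s k; piece2 s k; piece3 s k; Wtilde s k].
Proof.
move=> m1 sm; apply: dsum_criterion.
- exact: subspace_piece1.
- exact: subspace_piece2.
- exact: subspace_piece3.
- exact: subspace_Wtilde.
- by move=> P; apply: pieces_span.
- by move=> P1 P2 P3 P4; apply: pieces_independent.
Qed.

Lemma dsum_KerLap_KerMLap s k : (s <= m)%N ->
  dsum (fun P => KerLap R m s k P /\ KerMLap R m s k P)
    [:: piece1 s k; piece2 s k; piece3 s k].
Proof.
move=> sm; apply: dsum_criterion3; apply: dsum_criterion.
- exact: subspace_piece1.
- exact: subspace_piece2.
- exact: subspace_piece3.
- exact: subspace_zero.
- move=> P; rewrite /KerLap /KerMLap mlapE lap_extd_ctrd; split.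
    move=> [[HP E1] [_ E2]].
    have dc : extd (ctrd P) = 0.
      by rewrite -(half_sum (extd (ctrd P)) (ctrd (extd P))) E1 E2 addr0 scaler0.
    have cd : ctrd (extd P) = 0 by move: E1; rewrite dc add0r.
    have [P1 [P2 [P3 [S1 S2 S3 ->]]]] := split_both_closed sm HP dc cd.
    exists P1, P2, P3, 0; split; [exact: S1|exact: S2|exact: S3|by []|].
    by rewrite addr0.
  move=> [P1 [P2 [P3 [P4 [/HskP[H1 d1 c1] S2 S3 -> ->]]]]]; rewrite addr0.
  have [H2 d2 dc2 _] := piece2_facts sm S2.
  have [H3 c3 cd3 _] := piece3_facts S3.
  rewrite !raddfD /= c1 c3 d1 d2 dc2 cd3 !raddf0 !add0r ?addr0 ?subrr.
  by do 2!split=> //; do !apply: PskD.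
- move=> P1 P2 P3 P4 S1 S2 S3 S4; apply: (pieces_independent sm S1 S2 S3).
  by rewrite S4; case: (subspace_Wtilde s k).
Qed.
End Dsum.

(** * Reflections and the H-action *)

Section MPolyComp.
Variables (R : comNzRingType) (m : nat).
Implicit Types (p q : {mpoly R[m]}) (M : 'I_m -> 'I_m -> R).

Lemma comp_mpolyM p q (t : m.-tuple {mpoly R[m]}) :
  (p * q) \mPo t = (p \mPo t) * (q \mPo t).
Proof. exact: rmorphM. Qed.

Lemma comp_mpolyXi j (t : m.-tuple {mpoly R[m]}) : 'X_j \mPo t = tnth t j.
Proof. by rewrite comp_mpolyXU -tnth_nth. Qed.

Lemma comp_mpolyA p (t r : m.-tuple {mpoly R[m]}) :
  (p \mPo t) \mPo r = p \mPo [tuple tnth t i \mPo r | i < m].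
Proof.
elim/mpoly_ind_mulX: p => [c|p q Hp Hq|j p Hp].
- by rewrite !comp_mpolyC.
- by rewrite !comp_mpolyD Hp Hq.
- by rewrite !comp_mpolyM Hp !comp_mpolyXi tnth_mktuple.
Qed.

Definition lintup M : m.-tuple {mpoly R[m]} := [tuple \sum_j M i j *: 'X_j | i < m].

Lemma mderiv_lin M i j : mderiv j (tnth (lintup M) i) = (M i j)%:MP.
Proof.
rewrite tnth_mktuple raddf_sum (bigD1 j) //= big1 ?addr0.
  rewrite mderivZ mderivX mnm1E eqxx scale1r.
  have -> : (U_(j) - U_(j))%MM = 0%MM :> 'X_{1..m}.
    by apply/mnmP=> x; rewrite mnmBE subnn mnm0E.
  by rewrite mpolyX0 -mul_mpolyC mulr1.
by move=> l /negbTE lj; rewrite mderivZ mderivX mnm1E lj scale0r scaler0.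
Qed.

Lemma mderiv_comp_lin M j p :
  mderiv j (p \mPo lintup M) = \sum_i M i j *: (mderiv i p \mPo lintup M).
Proof.
elim/mpoly_ind_mulX: p => [c|p q Hp Hq|l p Hp].
- rewrite comp_mpolyC mderivC big1 // => i _.
  by rewrite mderivC comp_mpoly0 scaler0.
- rewrite comp_mpolyD mderivD Hp Hq -big_split; apply: eq_bigr => i _ /=.
  by rewrite mderivD comp_mpolyD scalerDr.
rewrite comp_mpolyM comp_mpolyXi mderivM mderiv_lin Hp mul_mpolyC mulr_sumr.
rewrite [RHS](eq_bigr (fun i => M i j *: (p *+ (i == l) \mPo lintup M)
   + tnth (lintup M) l * (M i j *: (mderiv i p \mPo lintup M)))).
  rewrite big_split /=; congr (_ + _).
  rewrite (bigD1 l) //= eqxx big1 ?addr0 // => i /negbTE ->.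
  by rewrite comp_mpoly0 scaler0.
by move=> i _; rewrite mderivX1 comp_mpolyD comp_mpolyM comp_mpolyXi scalerDr -scalerAr.
Qed.
End MPolyComp.

Section Reflect.
Variables (R : realType) (m : nat).
Local Notation CP := (Defs.CP R m).
Local Notation cmul := (Defs.cmul R m).
Local Notation vecCP := (Defs.vecCP R m).
Local Notation MP := {mpoly R[m]}.
Implicit Types (i j l : 'I_m) (A B C : {set 'I_m}) (P Q : CP) (s k : nat) (u v : 'I_m -> R).

Definition csub (t : m.-tuple MP) : CP -> CP := cmap (comp_mpoly t).

Fact csub_add t : zmod_morphism (csub t).
Proof. by move=> P Q; apply/ffunP=> A; rewrite !ffunE comp_mpolyB. Qed.
Fact csub_scal t : scalable (csub t).
Proof. by move=> a P; apply/ffunP=> A; rewrite !ffunE comp_mpolyZ. Qed.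
HB.instance Definition _ t := GRing.isZmodMorphism.Build CP CP (csub t) (csub_add t).
HB.instance Definition _ t := GRing.isScalable.Build R CP CP *:%R (csub t) (csub_scal t).

Lemma csub_cmul t P Q : csub t (cmul P Q) = cmul (csub t P) (csub t Q).
Proof.
apply/ffunP=> C; rewrite ffunE !cmulE raddf_sum; apply: eq_bigr => A _ /=.
by rewrite /bneg; case: bform; rewrite /= ?comp_mpolyN comp_mpolyM !ffunE.
Qed.
Lemma csub_vecCP t u : csub t (vecCP u) = vecCP u.
Proof.
apply/ffunP=> A; rewrite !ffunE raddf_sum /=.
by apply: eq_bigr => j _; rewrite comp_mpolyC.
Qed.
Lemma csub_cone t : csub t (cone R m) = cone R m.
Proof. by apply/ffunP=> A; rewrite !ffunE comp_mpolyC. Qed.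
Lemma csub_xvar t : csub t (xvar R m) = pvec (tnth t).
Proof.
apply/ffunP=> A; rewrite !ffunE raddf_sum /=.
by apply: eq_bigr => j _; rewrite comp_mpolyZ comp_mpolyXi.
Qed.
Lemma pvec1 (f : 'I_m -> MP) i : pvec f [set i] = f i.
Proof.
rewrite ffunE (bigD1 i) //= eqxx scale1r big1 ?addr0 // => j ji.
case: eqP => [/setP/(_ i)|]; last by rewrite scale0r.
by rewrite !inE eqxx eq_sym (negbTE ji).
Qed.

Lemma vecCPE u : vecCP u = pvec (fun j => (u j)%:MP).
Proof.
apply/ffunP=> A; rewrite !ffunE; apply: eq_bigr => j _.
by case: (_ == _); rewrite ?mul1r ?mul0r ?scale1r ?scale0r.
Qed.
Lemma vecCPN u : vecCP (fun j => - u j) = - vecCP u.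
Proof.
apply/ffunP=> A; rewrite !ffunE -sumrN; apply: eq_bigr => j _.
by rewrite mulrN mpolyCN.
Qed.

Lemma pin_val_cons u us : pin_val R m (u :: us) = cmul (vecCP u) (pin_val R m us).
Proof. by []. Qed.

Lemma pin_inv_cons u us :
  pin_inv R m (u :: us) = cmul (pin_inv R m us) (vecCP (fun j => - u j)).
Proof.
rewrite /pin_inv rev_cons foldr_rcons cmul1r.
elim: (rev us) => [|w ws IH] /=; first by rewrite cmul1l.
by rewrite IH cmulA.
Qed.

Lemma csub_pin_val t us : csub t (pin_val R m us) = pin_val R m us.
Proof.
elim: us => [|u us IH]; first exact: csub_cone.
by rewrite pin_val_cons csub_cmul IH csub_vecCP.
Qed.
Lemma csub_pin_inv t us : csub t (pin_inv R m us) = pin_inv R m us.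
Proof.
elim: us => [|u us IH]; first exact: csub_cone.
by rewrite pin_inv_cons csub_cmul IH csub_vecCP.
Qed.

Lemma gamma_anticomm i j P :
  (ext i (ext j P - ctr j P) - ctr i (ext j P - ctr j P)) +
  (ext j (ext i P - ctr i P) - ctr j (ext i P - ctr i P)) = - (2 *: P *+ (i == j)).
Proof.
rewrite !raddfB /= (extext i j) (ctrctr i j) (ext_ctr_comm i j) (ctr_ext_comm i j) eq_sym.
set a := ext j (ext i P); set b := ctr j (ctr i P); set c := ctr j (ext i P).
set d := ext j (ctr i P); set e := P *+ _.
have -> : 2 *: P *+ (j == i) = e + e by rewrite scaler_nat mulrnAC mulr2n.
by move: a b c d e => a b c d e; apply/ffunP=> A; rewrite !ffunE; ring.
Qed.

Lemma pvec_anticomm (f g : 'I_m -> MP) P :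
  cmul (pvec f) (cmul (pvec g) P) + cmul (pvec g) (cmul (pvec f) P)
  = - (2 *: pmul (\sum_j f j * g j) P).
Proof.
have E (f' g' : 'I_m -> MP) : cmul (pvec f') (cmul (pvec g') P) =
    \sum_i \sum_j pmul (f' i * g' j) (ext i (ext j P - ctr j P) - ctr i (ext j P - ctr j P)).
  rewrite !cmul_pvecl; apply: eq_bigr => i _.
  rewrite !(raddf_sum (@ext m _ i)) !(raddf_sum (@ctr m _ i)) -sumrB raddf_sum /=.
  apply: eq_bigr => j _; rewrite /= ext_pmul ctr_pmul -raddfB.
  by apply/ffunP=> A; rewrite !ffunE mulrA.
rewrite !E [X in _ + X]exchange_big -big_split /=.
under eq_bigr => i _.
  rewrite -big_split /=.
  under eq_bigr => j _ do rewrite [g j * f i]mulrC -raddfD gamma_anticomm.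
  rewrite (bigD1 i) //= eqxx big1 ?addr0; last first.
    by move=> j ji; rewrite eq_sym (negbTE ji) oppr0 raddf0.
  over.
apply/ffunP=> A; rewrite sum_ffunE !ffunE mulr_suml scaler_sumr -sumrN.
by apply: eq_bigr => i _; rewrite mulr1n !ffunE mulrN -scalerAr scalerAr.
Qed.
End Reflect.

Section Reflect.
Variables (R : realType) (m : nat).
Local Notation CP := (Defs.CP R m).
Local Notation cmul := (Defs.cmul R m).
Local Notation pderiv := (Defs.pderiv R m).
Local Notation Hact := (Defs.Hact R m).
Local Notation vecCP := (Defs.vecCP R m).
Local Notation unit_vec := (Defs.unit_vec R m).
Local Notation MP := {mpoly R[m]}.
Implicit Types (i j l : 'I_m) (A B C : {set 'I_m}) (P Q : CP) (s k : nat) (u v : 'I_m -> R).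

Definition nsq u : R := \sum_j u j ^+ 2.
(** The matrix of x -> - u x u, which is conjugation of x by a unit vector u. For such u it is minus
    the reflection in the hyperplane orthogonal to u. *)
Definition reflmx u i j : R := 2 * (u i * u j) - nsq u * (i == j)%:R.

Section Vectors.
Variable V : lmodType R.
Implicit Types Y : {ffun {set 'I_m} -> V}.
Definition extv u Y := \sum_j u j *: ext j Y.
Definition ctrv u Y := \sum_j u j *: ctr j Y.
(** For a unit vector u, the extension to the exterior algebra of the reflection in the hyperplane
    orthogonal to u. *)
Definition reflv u Y := nsq u *: Y - 2 *: extv u (ctrv u Y).

Fact extv_add u : zmod_morphism (extv u).
Proof. by move=> P Q; rewrite -sumrB; apply: eq_bigr => j _; rewrite !raddfB. Qed.
Fact extv_scal u : scalable (extv u).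
Proof.
move=> a P; rewrite scaler_sumr; apply: eq_bigr => j _.
by rewrite ext_is_scalable !scalerA mulrC.
Qed.
Fact ctrv_add u : zmod_morphism (ctrv u).
Proof. by move=> P Q; rewrite -sumrB; apply: eq_bigr => j _; rewrite !raddfB. Qed.
Fact ctrv_scal u : scalable (ctrv u).
Proof.
move=> a P; rewrite scaler_sumr; apply: eq_bigr => j _.
by rewrite ctr_is_scalable !scalerA mulrC.
Qed.
HB.instance Definition _ u := GRing.isZmodMorphism.Build _ _ (extv u) (extv_add u).
HB.instance Definition _ u := GRing.isScalable.Build R _ _ *:%R (extv u) (extv_scal u).
HB.instance Definition _ u := GRing.isZmodMorphism.Build _ _ (ctrv u) (ctrv_add u).
HB.instance Definition _ u := GRing.isScalable.Build R _ _ *:%R (ctrv u) (ctrv_scal u).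
Fact reflv_add u : zmod_morphism (reflv u).
Proof. 
move=> P Q; rewrite /reflv ctrv_add extv_add !scalerBr !opprB addrACA [RHS]addrACA.
by congr (_ + _); exact: addrC. Qed.
Fact reflv_scal u : scalable (reflv u).
Proof. by move=> a P; rewrite /reflv ctrv_scal extv_scal scalerBr !scalerA ![a * _]mulrC. Qed.
HB.instance Definition _ u := GRing.isZmodMorphism.Build _ _ (reflv u) (reflv_add u).
HB.instance Definition _ u := GRing.isScalable.Build R _ _ *:%R (reflv u) (reflv_scal u).

Lemma ext_extv j u Y : ext j (extv u Y) = - extv u (ext j Y).
Proof.
rewrite /extv raddf_sum -sumrN; apply: eq_bigr => i _ /=.
by rewrite ext_is_scalable extext scalerN.
Qed.
Lemma ctr_ctrv j u Y : ctr j (ctrv u Y) = - ctrv u (ctr j Y).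
Proof.
rewrite /ctrv raddf_sum -sumrN; apply: eq_bigr => i _ /=.
by rewrite ctr_is_scalable ctrctr scalerN.
Qed.
Lemma ext_ctrv j u Y : ext j (ctrv u Y) = u j *: Y - ctrv u (ext j Y).
Proof.
rewrite /ctrv raddf_sum (eq_bigr (fun i => u i *: (Y *+ (j == i)) - u i *: ctr i (ext j Y))).
  rewrite big_split sumrN /=; congr (_ - _).
  by rewrite (bigD1 j) //= eqxx big1 ?addr0 // => i /negbTE ij; rewrite eq_sym ij scaler0.
by move=> i _ /=; rewrite ext_is_scalable ext_ctr_comm scalerBr.
Qed.
Lemma ctr_extv j u Y : ctr j (extv u Y) = u j *: Y - extv u (ctr j Y).
Proof.
rewrite /extv raddf_sum (eq_bigr (fun i => u i *: (Y *+ (j == i)) - u i *: ext i (ctr j Y))).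
  rewrite big_split sumrN /=; congr (_ - _).
  by rewrite (bigD1 j) //= eqxx big1 ?addr0 // => i /negbTE ij; rewrite eq_sym ij scaler0.
by move=> i _ /=; rewrite ctr_is_scalable ctr_ext_comm scalerBr.
Qed.

Lemma double_eq0 (Z : {ffun {set 'I_m} -> V}) : Z = - Z -> Z = 0.
Proof.
move=> E; have : 2 *: Z = 0 by rewrite scaler_nat mulr2n {2}E subrr.
by move/eqP; rewrite scaler_eq0 pnatr_eq0 /= => /eqP.
Qed.

Lemma extv_sq u Y : extv u (extv u Y) = 0.
Proof.
apply: double_eq0; have H Z : extv u Z = \sum_j u j *: ext j Z by [].
rewrite [LHS]H (eq_bigr (fun j => - (u j *: extv u (ext j Y)))); last first.
  by move=> j _; rewrite ext_extv scalerN.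
rewrite sumrN; congr (- _); rewrite [in RHS](H Y) raddf_sum.
by apply: eq_bigr => j _; rewrite /= extv_scal.
Qed.
Lemma ctrv_sq u Y : ctrv u (ctrv u Y) = 0.
Proof.
apply: double_eq0; have H Z : ctrv u Z = \sum_j u j *: ctr j Z by [].
rewrite [LHS]H (eq_bigr (fun j => - (u j *: ctrv u (ctr j Y)))); last first.
  by move=> j _; rewrite ctr_ctrv scalerN.
rewrite sumrN; congr (- _); rewrite [in RHS](H Y) raddf_sum.
by apply: eq_bigr => j _; rewrite /= ctrv_scal.
Qed.
Lemma ctrv_extv u Y : ctrv u (extv u Y) = nsq u *: Y - extv u (ctrv u Y).
Proof.
rewrite {1}/ctrv (eq_bigr (fun j => u j ^+ 2 *: Y - u j *: extv u (ctr j Y))).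
  rewrite big_split sumrN -scaler_suml /=; congr (_ - _).
  by rewrite [in RHS]/ctrv raddf_sum; apply: eq_bigr => j _; rewrite /= extv_scal.
by move=> j _; rewrite ctr_extv scalerBr scalerA.
Qed.

Lemma ext_reflv j u Y : ext j (reflv u Y) = reflv u (ext j Y) + (2 * u j) *: extv u Y.
Proof.
have -> : ext j (reflv u Y) = nsq u *: ext j Y - 2 *: ext j (extv u (ctrv u Y)).
  by rewrite /reflv raddfB /= !ext_is_scalable.
rewrite ext_extv ext_ctrv raddfB /= extv_scal /reflv -scalerA.
by rewrite !opprB scalerBr opprB addrA addrAC.
Qed.
Lemma ctr_reflv j u Y : ctr j (reflv u Y) = reflv u (ctr j Y) - (2 * u j) *: ctrv u Y.
Proof.
have -> : ctr j (reflv u Y) = nsq u *: ctr j Y - 2 *: ctr j (extv u (ctrv u Y)).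
  by rewrite /reflv raddfB /= !ctr_is_scalable.
rewrite ctr_extv ctr_ctrv raddfN /= /reflv -scalerA opprK scalerDr opprD addrA.
by rewrite addrAC.
Qed.
Lemma reflv_extv u Y : reflv u (extv u Y) = - (nsq u *: extv u Y).
Proof.
rewrite /reflv ctrv_extv raddfB /= extv_scal extv_sq subr0 scaler_nat mulr2n.
by rewrite opprD addrA subrr sub0r.
Qed.
Lemma reflv_ctrv u Y : reflv u (ctrv u Y) = nsq u *: ctrv u Y.
Proof. by rewrite /reflv ctrv_sq raddf0 scaler0 subr0. Qed.

(** Conjugating a_j by the reflection gives exterior multiplication by the reflected e_j; the sign
    is there because [reflmx] is minus the reflection. *)
Lemma ext_reflv1 j u Y : nsq u = 1 ->
  ext j (reflv u Y) = - \sum_l reflmx u j l *: reflv u (ext l Y).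
Proof.
move=> u1; rewrite ext_reflv.
rewrite (eq_bigr (fun l => (2 * u j) *: (u l *: reflv u (ext l Y))
    - reflv u (ext l Y) *+ (j == l))); last first.
  move=> l _; rewrite /reflmx u1 mul1r scalerBl scalerA mulrA.
  by congr (_ - _); case: eqP; rewrite ?scale1r ?scale0r.
rewrite big_split sumrN -scaler_sumr /= opprB; congr (_ + _).
  by rewrite (bigD1 j) //= eqxx big1 ?addr0 // => l /negbTE lj; rewrite eq_sym lj.
rewrite -scalerN; congr (_ *: _).
rewrite -(opprK (extv u Y)) -[extv u Y]scale1r -u1 -reflv_extv; congr (- _).
by rewrite /extv raddf_sum; apply: eq_bigr => l _; exact: reflv_scal.
Qed.
Lemma ctr_reflv1 j u Y : nsq u = 1 ->
  ctr j (reflv u Y) = - \sum_l reflmx u j l *: reflv u (ctr l Y).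
Proof.
move=> u1; rewrite ctr_reflv.
rewrite (eq_bigr (fun l => (2 * u j) *: (u l *: reflv u (ctr l Y))
    - reflv u (ctr l Y) *+ (j == l))); last first.
  move=> l _; rewrite /reflmx u1 mul1r scalerBl scalerA mulrA.
  by congr (_ - _); case: eqP; rewrite ?scale1r ?scale0r.
rewrite big_split sumrN -scaler_sumr /= opprB; congr (_ + _).
  by rewrite (bigD1 j) //= eqxx big1 ?addr0 // => l /negbTE lj; rewrite eq_sym lj.
congr (- (_ *: _)).
rewrite -[ctrv u Y]scale1r -u1 -reflv_ctrv.
by rewrite /ctrv raddf_sum; apply: eq_bigr => l _; exact: reflv_scal.
Qed.
Lemma reflvK u Y : nsq u = 1 -> reflv u (reflv u Y) = Y.
Proof.
move=> u1; rewrite {2}/reflv u1 scale1r raddfB /= reflv_scal reflv_extv u1 scale1r.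
by rewrite scalerN opprK /reflv u1 scale1r subrK.
Qed.
End Vectors.

Lemma nsqE u : (nsq u = 1) = unit_vec u. Proof. by []. Qed.

(* For a unit vector u this is the H-action of u; keeping the factors [nsq u]
   makes it polynomial in u, which is used to differentiate it in u. *)
Definition reft u P : CP := reflv u (ginv (csub (lintup (reflmx u)) P)).
Fact reft_add u : zmod_morphism (reft u).
Proof. by move=> P Q; rewrite /reft !raddfB. Qed.
Fact reft_scal u : scalable (reft u).
Proof. by move=> a P; rewrite /reft csub_scal ginv_is_scalable reflv_scal. Qed.
HB.instance Definition _ u := GRing.isZmodMorphism.Build CP CP (reft u) (reft_add u).
HB.instance Definition _ u := GRing.isScalable.Build R CP CP *:%R (reft u) (reft_scal u).

Lemma cmulNr P Q : cmul P (- Q) = - cmul P Q.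
Proof. by apply: (addrI (cmul P Q)); rewrite -cmulDr !subrr cmul0r. Qed.
Lemma cmulNl P Q : cmul (- P) Q = - cmul P Q.
Proof. by apply: (addrI (cmul P Q)); rewrite -cmulDl !subrr cmul0l. Qed.

Lemma cmul_vecl u P : cmul (vecCP u) P = extv u P - ctrv u P.
Proof.
rewrite vecCPE cmul_pvecl -sumrB; apply: eq_bigr => j _.
by rewrite pmulC scalerBr.
Qed.
Lemma cmul_vecr u P : cmul P (vecCP u) = extv u (ginv P) + ctrv u (ginv P).
Proof.
rewrite vecCPE cmul_pvecr -big_split; apply: eq_bigr => j _ /=.
by rewrite pmulC scalerDr.
Qed.
Lemma cmul_pmul u f P : cmul (vecCP u) (pmul f P) = pmul f (cmul (vecCP u) P).
Proof.
rewrite vecCPE !cmul_pvecl raddf_sum; apply: eq_bigr => j _ /=.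
rewrite !pmulC ext_pmul ctr_pmul -raddfB /=.
by apply/ffunP=> A; rewrite !ffunE scalerAr.
Qed.

Lemma cmul_vec_sq u P : cmul (vecCP u) (cmul (vecCP u) P) = - (nsq u *: P).
Proof.
rewrite !cmul_vecl extv_add ctrv_add extv_sq ctrv_sq ctrv_extv subr0 sub0r.
by rewrite opprB addKr.
Qed.

(** As x u + u x = - 2 <x, u>, the product - u x u equals 2 <x, u> u - |u|^2 x. *)
Lemma conj_xvar u :
  cmul (vecCP (fun j => - u j)) (cmul (xvar R m) (cmul (vecCP u) (cone R m)))
  = pvec (tnth (lintup (reflmx u))).
Proof.
have := pvec_anticomm (fun j => 'X_j) (fun j => (u j)%:MP) (cone R m).
rewrite -vecCPE -xvarE => /(canRL (addrK _)) ->.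
rewrite vecCPN cmulNl -[- (2 *: _) - _]opprD cmulNr opprK cmulDr cmul_vec_sq !cmul1r.
have tE j : tnth (lintup (reflmx u)) j =
    (2 *: \sum_l 'X_l * (u l)%:MP) * (u j)%:MP - nsq u *: 'X_j.
  rewrite tnth_mktuple (eq_bigr (fun l => (2 * u j) *: ('X_l * (u l)%:MP) - nsq u *: ('X_l *+ (j == l)))).
    rewrite big_split sumrN /= -scaler_sumr; congr (_ - _).
      by rewrite [RHS]mulrC mul_mpolyC scalerA [u j * 2]mulrC.
    by rewrite (bigD1 j) //= eqxx big1 ?addr0 // => l /negbTE lj; rewrite eq_sym lj scaler0.
  move=> l _; rewrite /reflmx scalerBl ['X_l * _]mulrC mul_mpolyC scalerA mulrA; congr (_ - _).
  by rewrite -scalerA; case: eqP => _; rewrite ?scale1r ?scale0r.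
have -> : 2 *: pmul (\sum_j 'X_j * (u j)%:MP) (cone R m) =
    pmul (2 *: \sum_j 'X_j * (u j)%:MP) (cone R m).
  by apply/ffunP=> A; rewrite !ffunE scalerAl.
rewrite cmul_pmul cmul1r; apply/ffunP=> A.
move: tE; set S := 2 *: _ => tE; rewrite !ffunE mulr_sumr scaler_sumr -sumrB; apply: eq_bigr => j _.
rewrite tE; case: (_ == _); first by rewrite mul1r !scale1r.
by rewrite mul0r mpolyC0 mulr0 !scale0r scaler0 subrr.
Qed.

Lemma pin_subst1 u : pin_subst R m [:: u] = lintup (reflmx u).
Proof.
apply: eq_from_tnth => i; rewrite tnth_mktuple.
by rewrite pin_inv_cons cmul1l pin_val_cons conj_xvar pvec1.
Qed.

Lemma HactE us P : Hact us P =
  cmul (pin_val R m us) (cmul (csub (pin_subst R m us) P) (pin_inv R m us)).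
Proof. by []. Qed.

(** After [ginv], conjugation by u is - (a_u - b_u)(a_u + b_u) = b_u a_u - a_u b_u = |u|^2 - 2 a_u
    b_u. *)
Lemma Hact1 u P : unit_vec u -> Hact [:: u] P = reft u P.
Proof.
rewrite -nsqE => u1; rewrite HactE pin_subst1 pin_inv_cons pin_val_cons cmul1l cmul1r.
rewrite vecCPN cmulNr cmulNr cmul_vecr cmul_vecl /reft.
set Y := ginv _; rewrite (raddfD (extv u)) (raddfD (ctrv u)) /= extv_sq ctrv_sq ctrv_extv.
by rewrite add0r addr0 /reflv scaler_nat mulr2n !opprB addrAC opprD addrA.
Qed.

(** For r = u r', the vector r^-1 x r arises from r'^-1 x r' by replacing x with u^-1 x u, so the
    reflection in u is substituted last. *)
Lemma pin_subst_cons u us :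
  pin_subst R m (u :: us) = [tuple tnth (pin_subst R m us) i \mPo lintup (reflmx u) | i < m].
Proof.
apply: eq_from_tnth => i; rewrite !tnth_mktuple.
set t := lintup (reflmx u).
have -> : cmul (pin_inv R m us) (cmul (xvar R m) (pin_val R m us)) [set i] \mPo t =
   csub t (cmul (pin_inv R m us) (cmul (xvar R m) (pin_val R m us))) [set i].
  by rewrite [RHS]ffunE.
rewrite !csub_cmul csub_pin_inv csub_pin_val csub_xvar -conj_xvar.
rewrite pin_inv_cons pin_val_cons !cmul1r -!cmulA.
by [].
Qed.

Lemma Hact_cons u us P : Hact (u :: us) P = Hact [:: u] (Hact us P).
Proof.
have e1 : pin_val R m [:: u] = vecCP u by exact: cmul1r.
have e2 : pin_inv R m [:: u] = vecCP (fun j => - u j) by exact: cmul1r.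
have csubA Q t r : csub r (csub t Q) = csub [tuple tnth t i \mPo r | i < m] Q.
  by apply/ffunP=> A; rewrite !ffunE comp_mpolyA.
rewrite (HactE (u :: us)) (HactE [:: u]) (HactE us) e1 e2 pin_subst1 !csub_cmul.
rewrite csub_pin_val csub_pin_inv csubA -pin_subst_cons pin_val_cons pin_inv_cons.
move: (pin_val R m us) (pin_inv R m us) (csub _ P) (vecCP u) (vecCP _) => a b c d e.
by rewrite !cmulA.
Qed.

Lemma Hact_nil P : Hact [::] P = P.
Proof.
rewrite HactE cmul1l cmul1r; apply/ffunP=> A; rewrite ffunE.
have -> : pin_subst R m [::] = [tuple 'X_i | i < m].
  apply: eq_from_tnth => i; rewrite !tnth_mktuple cmul1l cmul1r xvarE pvec1.
  by [].
exact: comp_mpoly_id.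
Qed.

Lemma pin_elt_cons u us : pin_elt R m (u :: us) <-> unit_vec u /\ pin_elt R m us.
Proof.
split=> [H|[Hu H]]; last by case=> // i; apply: H.
by split; [exact: (H 0%N)|move=> i; exact: (H i.+1)].
Qed.

(** [Hact] composes the actions of the letters of a word, so invariance need only be checked on
    single unit vectors. *)
Lemma H_invariant_reft (S : CP -> Prop) :
  (forall u P, unit_vec u -> S P -> S (reft u P)) -> H_invariant R m S.
Proof.
move=> HS us; elim: us => [|u us IH] P; first by rewrite Hact_nil.
move=> /pin_elt_cons[Hu Hus] SP; rewrite Hact_cons Hact1 //.
by apply: HS => //; apply: IH.
Qed.

Lemma reft_invariant (S : CP -> Prop) u P :
  H_invariant R m S -> unit_vec u -> S P -> S (reft u P).
Proof.
move=> HS Hu SP; rewrite -Hact1 //; apply: HS => //.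
by apply/pin_elt_cons; split=> // -[].
Qed.

Lemma ext_ginv j P : ext j (ginv P) = - ginv (ext j P).
Proof.
apply/ffunP=> A; rewrite !ffunE; case: ifP => jA; last by rewrite bneg0 oppr0.
by rewrite !bneg_bneg (cardsD1 j A) jA addnC addn1 /= -bnegN; case: odd; case: lowpar; rewrite /= ?opprK.
Qed.
Lemma ctr_ginv j P : ctr j (ginv P) = - ginv (ctr j P).
Proof.
apply/ffunP=> A; rewrite !ffunE; case: ifP => jA; first by rewrite bneg0 oppr0.
by rewrite !bneg_bneg cardsU1 jA /=; case: odd; case: lowpar; rewrite /= ?opprK.
Qed.
Lemma csub_ext t j P : csub t (ext j P) = ext j (csub t P).
Proof. by rewrite ext_cmap => [|//|p]; rewrite ?comp_mpoly0 ?comp_mpolyN. Qed.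
Lemma csub_ctr t j P : csub t (ctr j P) = ctr j (csub t P).
Proof. by rewrite ctr_cmap => [|//|p]; rewrite ?comp_mpoly0 ?comp_mpolyN. Qed.
Lemma csub_mulx t j P : csub t (mulx j P) = pmul (tnth t j) (csub t P).
Proof. by apply/ffunP=> A; rewrite !ffunE comp_mpolyM comp_mpolyXi. Qed.
Lemma pderiv_csub_lin (M : 'I_m -> 'I_m -> R) j P :
  pderiv j (csub (lintup M) P) = \sum_i M i j *: csub (lintup M) (pderiv i P).
Proof.
apply/ffunP=> A; rewrite !ffunE mderiv_comp_lin sum_ffunE.
by apply: eq_bigr => i _; rewrite !ffunE.
Qed.
Lemma ginv_pmul f P : ginv (pmul f P) = pmul f (ginv P).
Proof. by apply/ffunP=> A; rewrite !ffunE bnegMr. Qed.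
Lemma ginv_pderiv j P : ginv (pderiv j P) = pderiv j (ginv P).
Proof. by apply/ffunP=> A; rewrite !ffunE; case: odd; rewrite //= mderivN. Qed.
Lemma reflv_pmul u f P : reflv u (pmul f P) = pmul f (reflv u P).
Proof.
have c Q : ctrv u (pmul f Q) = pmul f (ctrv u Q).
  by rewrite raddf_sum; apply: eq_bigr => j _; rewrite ctr_pmul /= linearZ.
have e Q : extv u (pmul f Q) = pmul f (extv u Q).
  by rewrite raddf_sum; apply: eq_bigr => j _; rewrite ext_pmul /= linearZ.
by rewrite /reflv c e raddfB /= !pmul_is_scalable.
Qed.
Lemma reflv_pderiv u i P : reflv u (pderiv i P) = pderiv i (reflv u P).
Proof.
have c Q : ctrv u (pderiv i Q) = pderiv i (ctrv u Q).
  by rewrite raddf_sum; apply: eq_bigr => j _; rewrite ctr_pderiv /= linearZ.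
have e Q : extv u (pderiv i Q) = pderiv i (extv u Q).
  by rewrite raddf_sum; apply: eq_bigr => j _; rewrite ext_pderiv /= linearZ.
by rewrite /reflv c e raddfB /= !pderiv_is_scalable.
Qed.

End Reflect.

Lemma sum_delta (R : nzRingType) (V : lmodType R) (I : finType) (c : I -> R) (F : I -> V) l :
  (forall i, c i = (i == l)%:R) -> \sum_i c i *: F i = F l.
Proof.
move=> cE; rewrite (bigD1 l) //= cE eqxx scale1r big1 ?addr0 // => i /negbTE il.
by rewrite cE il scale0r.
Qed.

(** * Equivariance of the Hodge-de Rham operators under reflections *)

Section Equivariance.
Variables (R : realType) (m : nat).
Local Notation CP := (Defs.CP R m).
Local Notation pderiv := (Defs.pderiv R m).
Local Notation Psk := (Defs.Psk R m).
Local Notation Hsk := (Defs.Hsk R m).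
Local Notation MP := {mpoly R[m]}.
Implicit Types (i j l : 'I_m) (A B C : {set 'I_m}) (P Q : CP) (s k : nat) (u v : 'I_m -> R).

Lemma reflmxC u i j : reflmx u i j = reflmx u j i.
Proof. by rewrite /reflmx [u i * _]mulrC eq_sym. Qed.

Lemma reflmx_orth u i j : nsq u = 1 ->
  \sum_l reflmx u i l * reflmx u l j = (i == j)%:R.
Proof.
move=> u1.
rewrite (eq_bigr (fun l => 4 * u i * u j * u l ^+ 2 - (2 * u l * u j) *+ (i == l)
   + ((i == l) && (l == j))%:R - 2 * u i * u l *+ (l == j))).
  rewrite !(sumrB, big_split) /= -mulr_sumr -/(nsq u) u1 mulr1.
  rewrite (bigD1 i) //= eqxx big1 ?addr0; last by move=> l /negbTE li; rewrite eq_sym li.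
  rewrite (bigD1 i) //= eqxx big1 ?addr0; last by move=> l /negbTE li; rewrite eq_sym li.
  rewrite (bigD1 j) //= eqxx big1 ?addr0; last by move=> l /negbTE ->.
  by rewrite !mulr1n; ring.
move=> l _; rewrite /reflmx u1 !mul1r.
by case: (i == l); case: (l == j); rewrite ?mulr0n ?mulr1n /=; ring.
Qed.

Lemma ext_reft j u P : nsq u = 1 ->
  ext j (reft u P) = \sum_l reflmx u j l *: reft u (ext l P).
Proof.
move=> u1; rewrite /reft ext_reflv1 // -sumrN; apply: eq_bigr => l _.
by rewrite ext_ginv raddfN scalerN opprK csub_ext.
Qed.
Lemma ctr_reft j u P : nsq u = 1 ->
  ctr j (reft u P) = \sum_l reflmx u j l *: reft u (ctr l P).
Proof.
move=> u1; rewrite /reft ctr_reflv1 // -sumrN; apply: eq_bigr => l _.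
by rewrite ctr_ginv raddfN scalerN opprK csub_ctr.
Qed.
Lemma reft_mulx j u P :
  reft u (mulx j P) = \sum_l reflmx u j l *: mulx l (reft u P).
Proof.
rewrite /reft csub_mulx ginv_pmul reflv_pmul; apply/ffunP=> A.
rewrite ffunE sum_ffunE tnth_mktuple mulr_suml; apply: eq_bigr => l _.
by rewrite !ffunE scalerAl.
Qed.
Lemma mulx_reft j u P : nsq u = 1 ->
  mulx j (reft u P) = \sum_l reflmx u j l *: reft u (mulx l P).
Proof.
move=> u1; under eq_bigr => l _ do rewrite reft_mulx scaler_sumr.
rewrite exchange_big; symmetry.
under eq_bigr => i _ do under eq_bigr => l _ do rewrite scalerA.
under eq_bigr => i _ do rewrite -scaler_suml.
by apply: sum_delta => i; rewrite reflmx_orth // eq_sym.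
Qed.
Lemma pderiv_reft j u P :
  pderiv j (reft u P) = \sum_l reflmx u j l *: reft u (pderiv l P).
Proof.
rewrite /reft -reflv_pderiv -ginv_pderiv pderiv_csub_lin !raddf_sum.
by apply: eq_bigr => l _; rewrite /= ginv_is_scalable reflv_scal reflmxC.
Qed.

(** Both families transform under [reft u] like the basis vectors, and [reflmx u] is orthogonal, so
    their contraction over j is invariant. *)
Lemma intertwine (S T : 'I_m -> CP -> CP) u :
  nsq u = 1 -> (forall j, scalable (S j)) -> (forall j, zmod_morphism (S j)) ->
  (forall j P, S j (reft u P) = \sum_l reflmx u j l *: reft u (S l P)) ->
  (forall j P, T j (reft u P) = \sum_l reflmx u j l *: reft u (T l P)) ->
  forall P, \sum_j S j (T j (reft u P)) = reft u (\sum_j S j (T j P)).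
Proof.
move=> u1 SZ SB HS HT P.
have SD j I (r : seq I) (F : I -> CP) : S j (\sum_(x <- r) F x) = \sum_(x <- r) S j (F x).
  have S0 : S j 0 = 0 by have := SB j 0 0; rewrite !subrr.
  have SN Q : S j (- Q) = - S j Q by have := SB j 0 Q; rewrite S0 !sub0r.
  apply: (big_morph _ _ S0) => Q1 Q2.
  by have := SB j Q1 (- Q2); rewrite SN !opprK.
under eq_bigr => j _.
  rewrite HT SD; under eq_bigr => l _ do rewrite SZ HS scaler_sumr.
  under eq_bigr => l _ do under eq_bigr => i _ do rewrite scalerA.
  over.
rewrite exchange_big raddf_sum; apply: eq_bigr => l _ /=.
rewrite exchange_big /=; under eq_bigr => i _ do rewrite -scaler_suml.
apply: sum_delta => i; under eq_bigr => j _ do rewrite reflmxC.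
by rewrite reflmx_orth // eq_sym.
Qed.

Section Unit.
Variables (u : 'I_m -> R) (u1 : nsq u = 1).

Lemma reft_extx P : extx (reft u P) = reft u (extx P).
Proof.
apply: (intertwine u1 (S := @mulx R m) (T := @ext m MP)) => [j|j|j Q|j Q].
- exact: pmul_is_scalable.
- exact: pmul_is_additive.
- exact: mulx_reft.
- exact: ext_reft.
Qed.
Lemma reft_ctrx P : ctrx (reft u P) = reft u (ctrx P).
Proof.
apply: (intertwine u1 (S := @mulx R m) (T := @ctr m MP)) => [j|j|j Q|j Q].
- exact: pmul_is_scalable.
- exact: pmul_is_additive.
- exact: mulx_reft.
- exact: ctr_reft.
Qed.
Lemma reft_extd P : extd (reft u P) = reft u (extd P).
Proof.
apply: (intertwine u1 (S := pderiv) (T := @ext m MP)) => [j|j|j Q|j Q].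
- exact: pderiv_is_scalable.
- exact: pderiv_is_additive.
- exact: pderiv_reft.
- exact: ext_reft.
Qed.
Lemma reft_ctrd P : ctrd (reft u P) = reft u (ctrd P).
Proof.
apply: (intertwine u1 (S := pderiv) (T := @ctr m MP)) => [j|j|j Q|j Q].
- exact: pderiv_is_scalable.
- exact: pderiv_is_additive.
- exact: pderiv_reft.
- exact: ctr_reft.
Qed.
End Unit.

Lemma Psk_extv s k u P : Psk s k P -> Psk s.+1 k (extv u P).
Proof. by move=> HP; apply: Psk_sum => j; apply/PskZ/Psk_ext. Qed.
Lemma Psk_ctrv s k u P : Psk s k P -> Psk s.-1 k (ctrv u P).
Proof. by move=> HP; apply: Psk_sum => j; apply/PskZ/Psk_ctr. Qed.
Lemma Psk0_ctrv k u P : Psk 0 k P -> ctrv u P = 0.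
Proof. by move=> HP; apply: big1 => j _; rewrite (Psk_ctr0 j HP) scaler0. Qed.

Lemma Psk_reflv s k u P : Psk s k P -> Psk s k (reflv u P).
Proof.
move=> HP; apply: PskB; first exact: PskZ.
apply: PskZ; case: s HP => [|s] HP; last exact: Psk_extv (Psk_ctrv u HP).
by rewrite (Psk0_ctrv u HP) raddf0; apply: Psk0.
Qed.
Lemma Psk_ginv s k P : Psk s k P -> ginv P = (-1) ^+ s *: P.
Proof.
move=> /PskP[P1 _]; apply/ffunP=> A; rewrite !ffunE.
have [<-|/P1->] := eqVneq #|A| s; last by rewrite bneg0 scaler0.
by rewrite -signr_odd scaler_sign.
Qed.

Lemma comp_lin_homog (M : 'I_m -> 'I_m -> R) k (p : MP) :
  p \is k.-homog -> p \mPo lintup M \is k.-homog.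
Proof.
move=> pk; rewrite comp_mpolyEX big_seq rpred_sum // => mm mmp.
apply: dhomogZ; rewrite -(dhomog_mf pk mmp).
rewrite comp_mpolyX /= mdegE.
apply: (big_ind2 (fun (q : MP) d => q \is d.-homog)) => [|q1 d1 q2 d2 h1 h2|i _].
- exact: dhomog1.
- exact: dhomogM.
rewrite -[X in X.-homog]mul1n; apply: dhomogMn.
rewrite tnth_mktuple rpred_sum // => l _; apply: dhomogZ.
by rewrite dhomogX /= mdeg1.
Qed.

Lemma Psk_csub_lin (M : 'I_m -> 'I_m -> R) s k P : Psk s k P -> Psk s k (csub (lintup M) P).
Proof.
move=> /PskP[P1 P2]; apply/PskP; split=> A; rewrite ffunE.
  by move/P1 ->; rewrite comp_mpoly0.
exact: comp_lin_homog.
Qed.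

Lemma Psk_reft s k u P : Psk s k P -> Psk s k (reft u P).
Proof.
move=> HP; apply: Psk_reflv; have HP' := Psk_csub_lin (reflmx u) HP.
by rewrite (Psk_ginv HP'); apply: PskZ.
Qed.

Lemma Hsk_reft s k u P : nsq u = 1 -> Hsk s k P -> Hsk s k (reft u P).
Proof.
move=> u1 /HskP[HP P1 P2]; apply/HskP; rewrite reft_extd // reft_ctrd // P1 P2.
by rewrite !raddf0; split; [exact: Psk_reft| |].
Qed.

Lemma csub_reflv t v Q : csub t (reflv v Q) = reflv v (csub t Q).
Proof.
have c Z : ctrv v (csub t Z) = csub t (ctrv v Z).
  by rewrite raddf_sum; apply: eq_bigr => j _; rewrite /= linearZ /= csub_ctr.
have e Z : extv v (csub t Z) = csub t (extv v Z).
  by rewrite raddf_sum; apply: eq_bigr => j _; rewrite /= linearZ /= csub_ext.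
by rewrite /reflv c e raddfB /= !csub_scal.
Qed.
Lemma csub_ginv t Q : csub t (ginv Q) = ginv (csub t Q).
Proof. by apply/ffunP=> A; rewrite !ffunE; case: odd; rewrite //= comp_mpolyN. Qed.
Lemma ginv_reflv v Q : ginv (reflv v Q) = reflv v (ginv Q).
Proof.
have c Z : ctrv v (ginv Z) = - ginv (ctrv v Z).
  rewrite raddf_sum -sumrN; apply: eq_bigr => j _.
  by rewrite /= linearZ /= ctr_ginv scalerN.
have e Z : extv v (ginv Z) = - ginv (extv v Z).
  rewrite raddf_sum -sumrN; apply: eq_bigr => j _.
  by rewrite /= linearZ /= ext_ginv scalerN.
by rewrite /reflv c raddfN /= e opprK raddfB /= !ginv_is_scalable.
Qed.

Lemma reftK u P : nsq u = 1 -> reft u (reft u P) = P.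
Proof.
move=> u1; rewrite /reft csub_reflv csub_ginv ginv_reflv ginvK reflvK //.
apply/ffunP=> A; rewrite !ffunE comp_mpolyA -[RHS]comp_mpoly_id; congr (_ \mPo _).
apply: eq_from_tnth => i; rewrite !tnth_mktuple raddf_sum.
under eq_bigr => j _ do rewrite /= comp_mpolyZ comp_mpolyXi tnth_mktuple scaler_sumr.
rewrite exchange_big /=.
under eq_bigr => l _ do under eq_bigr => j _ do rewrite scalerA.
under eq_bigr => l _ do rewrite -scaler_suml.
by apply: sum_delta => l; rewrite reflmx_orth // eq_sym.
Qed.
End Equivariance.

(** * Fischer inner product *)

Section FischerPoly.
Variables (R : realType) (m : nat).
Local Notation MP := {mpoly R[m]}.
Implicit Types (p q f g : MP) (a b : 'X_{1..m}).

Definition mfact a : nat := \prod_(i < m) (a i)`!.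

Lemma mfact_gt0 a : (0 < mfact a)%N.
Proof. by apply: prodn_gt0 => i; apply: fact_gt0. Qed.

Lemma mfactU a j : mfact (a + U_(j)) = (mfact a * (a j).+1)%N.
Proof.
rewrite /mfact (bigD1 j) //= [in RHS](bigD1 j) //= mnmDE mnm1E eqxx addn1 factS.
rewrite (eq_bigr (fun i => (a i)`!)); first by rewrite -mulnA mulnC.
by move=> i ij; rewrite mnmDE mnm1E eq_sym (negbTE ij) addn0.
Qed.

(** The factorial weights make multiplication by x_j adjoint to D_j, as in [fip_mulX]. *)
Definition fip p q : R := \sum_(a <- msupp p) p@_a * q@_a *+ mfact a.

Lemma fipE n p q : (msize p <= n)%N ->
  fip p q = \sum_(a : 'X_{1..m < n}) p@_a * q@_a *+ mfact a.
Proof.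
move=> le_pn; pose I : subFinType _ := 'X_{1..m < n}.
rewrite /fip (big_mksub I) //=; first last.
- by move=> x /msize_mdeg_lt /leq_trans; apply.
- by rewrite msupp_uniq.
by rewrite big_rmcond //= => i; move/memN_msupp_eq0 ->; rewrite mul0r mul0rn.
Qed.

Lemma fipC p q : fip p q = fip q p.
Proof.
rewrite (fipE (n := maxn (msize p) (msize q))) ?leq_maxl //.
rewrite (fipE (n := maxn (msize p) (msize q))) ?leq_maxr //.
by apply: eq_bigr => a _; rewrite mulrC.
Qed.
Lemma fipDr p q f : fip p (q + f) = fip p q + fip p f.
Proof. by rewrite -big_split; apply: eq_bigr => a _; rewrite mcoeffD mulrDr mulrnDl. Qed.
Lemma fipZr c p q : fip p (c *: q) = c * fip p q.
Proof. by rewrite mulr_sumr; apply: eq_bigr => a _; rewrite mcoeffZ mulrCA mulrnAr. Qed.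
Lemma fipDl p q f : fip (p + q) f = fip p f + fip q f.
Proof. by rewrite !(fipC _ f) fipDr. Qed.
Lemma fipZl c p q : fip (c *: p) q = c * fip p q.
Proof. by rewrite !(fipC _ q) fipZr. Qed.
Lemma fip0r p : fip p 0 = 0.
Proof. by rewrite -(scale0r 0) fipZr mul0r. Qed.
Lemma fip0l p : fip 0 p = 0.
Proof. by rewrite fipC fip0r. Qed.
Lemma fipNr p q : fip p (- q) = - fip p q.
Proof. by rewrite -scaleN1r fipZr mulN1r. Qed.
Lemma fipNl p q : fip (- p) q = - fip p q.
Proof. by rewrite -scaleN1r fipZl mulN1r. Qed.
Lemma fip_suml I (r : seq I) (P : pred I) (F : I -> MP) q :
  fip (\sum_(x <- r | P x) F x) q = \sum_(x <- r | P x) fip (F x) q.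
Proof. by apply: (big_morph (fip^~ q)) => [x y|]; rewrite ?fipDl ?fip0l. Qed.
Lemma fip_sumr I (r : seq I) (P : pred I) (F : I -> MP) q :
  fip q (\sum_(x <- r | P x) F x) = \sum_(x <- r | P x) fip q (F x).
Proof. by rewrite fipC fip_suml; apply: eq_bigr => x _; rewrite fipC. Qed.

Lemma fipX a q : fip 'X_[a] q = q@_a *+ mfact a.
Proof. by rewrite /fip msuppX big_seq1 mcoeffX eqxx mul1r. Qed.

Lemma fip_ge0 p : 0 <= fip p p.
Proof. by apply: sumr_ge0 => a _; apply: mulrn_wge0; rewrite -expr2 sqr_ge0. Qed.
Lemma fip_eq0 p : fip p p = 0 -> p = 0.
Proof.
move/eqP; rewrite psumr_eq0 => [/allP H|a _]; last first.
  by apply: mulrn_wge0; rewrite -expr2 sqr_ge0.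
apply/mpolyP=> a; rewrite mcoeff0; have [ap|] := boolP (a \in msupp p).
  move: (H a ap); rewrite mulrn_eq0 eqn0Ngt mfact_gt0 /= -expr2 sqrf_eq0.
  by move/eqP.
exact: memN_msupp_eq0.
Qed.

Lemma fip_mulX j p q : fip ('X_j * p) q = fip p (q^`M(j)).
Proof.
rewrite (mpolyE p) mulr_sumr !fip_suml; apply: eq_bigr => a _.
rewrite -scalerAr !fipZl -mpolyXD !fipX mcoeff_deriv addmC mfactU.
by rewrite mulnC mulrnA.
Qed.

Lemma mcoeff0_comp_lin M p : (p \mPo lintup M)@_0 = p@_0.
Proof.
elim/mpoly_ind_mulX: p => [c|p q Hp Hq|j p _].
- by rewrite comp_mpolyC.
- by rewrite comp_mpolyD !mcoeffD Hp Hq.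
rewrite comp_mpolyM comp_mpolyXi tnth_mktuple mulr_suml raddf_sum /= mcoeff_mulX mnm0E /=.
by apply: big1 => l _; rewrite -scalerAl mcoeffZ mcoeff_mulX mnm0E mulr0.
Qed.

(** The adjoint of a linear substitution is the substitution of the transposed matrix. In the
    induction on q, a factor x_j crosses the product as D_j and the chain rule brings in M. *)
Lemma fip_comp_lin M p q : (forall i j, M i j = M j i) ->
  fip (p \mPo lintup M) q = fip p (q \mPo lintup M).
Proof.
move=> MC; elim/mpoly_ind_mulX: q p => [c|q r Hq Hr|j q Hq] p.
- rewrite comp_mpolyC -[c%:MP]mulr1 mul_mpolyC -mpolyX0 !fipZr.
  by rewrite !(fipC _ 'X_[_]) !fipX mcoeff0_comp_lin.
- by rewrite comp_mpolyD !fipDr Hq Hr.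
rewrite fipC fip_mulX fipC mderiv_comp_lin fip_suml.
rewrite comp_mpolyM comp_mpolyXi tnth_mktuple mulr_suml fip_sumr.
apply: eq_bigr => i _; rewrite fipZl Hq -scalerAl fipZr MC.
by rewrite [in RHS]fipC fip_mulX fipC.
Qed.
End FischerPoly.

(** * Fischer product of Clifford-valued polynomials and orthogonal projection *)

Section Fischer.
Variables (R : realType) (m : nat).
Local Notation CP := (Defs.CP R m).
Local Notation pderiv := (Defs.pderiv R m).
Local Notation Psk := (Defs.Psk R m).
Local Notation subspace := (Defs.subspace R m).
Implicit Types (i j l : 'I_m) (A B C : {set 'I_m}) (P Q : CP) (s k : nat) (u v : 'I_m -> R).

Definition ip P Q : R := \sum_A fip (P A) (Q A).

Lemma ipC P Q : ip P Q = ip Q P.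
Proof. by apply: eq_bigr => A _; rewrite fipC. Qed.
Lemma ipDr P Q S : ip P (Q + S) = ip P Q + ip P S.
Proof. by rewrite -big_split; apply: eq_bigr => A _; rewrite ffunE fipDr. Qed.
Lemma ipZr c P Q : ip P (c *: Q) = c * ip P Q.
Proof. by rewrite mulr_sumr; apply: eq_bigr => A _; rewrite ffunE fipZr. Qed.
Lemma ipDl P Q S : ip (P + Q) S = ip P S + ip Q S.
Proof. by rewrite !(ipC _ S) ipDr. Qed.
Lemma ipZl c P Q : ip (c *: P) Q = c * ip P Q.
Proof. by rewrite !(ipC _ Q) ipZr. Qed.
Lemma ip0r P : ip P 0 = 0.
Proof. by rewrite -(scale0r 0) ipZr mul0r. Qed.
Lemma ip0l P : ip 0 P = 0.
Proof. by rewrite ipC ip0r. Qed.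
Lemma ipNr P Q : ip P (- Q) = - ip P Q.
Proof. by rewrite -scaleN1r ipZr mulN1r. Qed.
Lemma ipNl P Q : ip (- P) Q = - ip P Q.
Proof. by rewrite -scaleN1r ipZl mulN1r. Qed.
Lemma ipBr P Q S : ip P (Q - S) = ip P Q - ip P S.
Proof. by rewrite ipDr ipNr. Qed.
Lemma ipBl P Q S : ip (P - Q) S = ip P S - ip Q S.
Proof. by rewrite ipDl ipNl. Qed.
Lemma ip_suml I (r : seq I) (p : pred I) (F : I -> CP) Q :
  ip (\sum_(x <- r | p x) F x) Q = \sum_(x <- r | p x) ip (F x) Q.
Proof. by apply: (big_morph (ip^~ Q)) => [x y|]; rewrite ?ipDl ?ip0l. Qed.
Lemma ip_sumr I (r : seq I) (p : pred I) (F : I -> CP) Q :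
  ip Q (\sum_(x <- r | p x) F x) = \sum_(x <- r | p x) ip Q (F x).
Proof. by rewrite ipC ip_suml; apply: eq_bigr => x _; rewrite ipC. Qed.

Lemma ip_ge0 P : 0 <= ip P P.
Proof. by apply: sumr_ge0 => A _; apply: fip_ge0. Qed.
Lemma ip_eq0 P : ip P P = 0 -> P = 0.
Proof.
move/eqP; rewrite psumr_eq0 => [/allP H|A _]; last exact: fip_ge0.
apply/ffunP=> A; rewrite ffunE; apply: fip_eq0; apply/eqP.
by apply: H; rewrite mem_index_enum.
Qed.

Lemma ip_mulx j P Q : ip (mulx j P) Q = ip P (pderiv j Q).
Proof. by apply: eq_bigr => A _; rewrite !ffunE fip_mulX. Qed.

Lemma ip_ext j P Q : ip (ext j P) Q = ip P (ctr j Q).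
Proof.
(* Toggling j pairs the blades on which [ext j] and [ctr j] act, with the same sign [lowpar] in both
   directions. *)
pose h A := if j \in A then A :\ j else j |: A.
have hK : involutive h.
  move=> A; rewrite /h; case: (boolP (j \in A)) => jA.
    by rewrite !inE eqxx /= setD1K.
  by rewrite setU11 setU1K.
rewrite /ip (reindex_inj (inv_inj hK)); apply: eq_bigr => A _.
rewrite !ffunE {1 2}/h; case: (boolP (j \in A)) => jA.
  by rewrite !inE eqxx /= fip0l fip0r.
rewrite setU11 /h (negbTE jA) lowparU1 ltnn andbF addbF setU1K //.
by case: lowpar; rewrite /= ?fipNl ?fipNr.
Qed.

Lemma ip_extv u P Q : ip (extv u P) Q = ip P (ctrv u Q).
Proof.
rewrite ip_suml ip_sumr; apply: eq_bigr => j _.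
by rewrite ipZl ipZr ip_ext.
Qed.
Lemma ip_reflv u P Q : ip (reflv u P) Q = ip P (reflv u Q).
Proof. by rewrite ipBl ipBr !ipZl !ipZr ip_extv (ipC P (extv _ _)) ip_extv (ipC (ctrv u Q)). Qed.
Lemma ip_ginv P Q : ip (ginv P) Q = ip P (ginv Q).
Proof. by apply: eq_bigr => A _; rewrite !ffunE; case: odd; rewrite /= ?fipNl ?fipNr. Qed.

(** The three factors of [reft u] are each symmetric, and they commute. *)
Lemma ip_reft u P Q : ip (reft u P) Q = ip P (reft u Q).
Proof.
rewrite {1}/reft ip_reflv ip_ginv /reft -csub_ginv -csub_reflv -ginv_reflv.
apply: eq_bigr => A _; rewrite !(ffunE (fun A => comp_mpoly _ _)).
by rewrite -fip_comp_lin // => i j; exact: reflmxC.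
Qed.

(** Orthogonal projection onto T, by induction on a finite list of coordinates that separates the
    elements of T: the subspace of T where the first coordinate vanishes is separated by the
    others. *)
Lemma orth_decomp (cs : seq ({set 'I_m} * 'X_{1..m})) (T : CP -> Prop) :
  subspace T ->
  (forall P, T P -> (forall c, c \in cs -> (P c.1)@_c.2 = 0) -> P = 0) ->
  forall W, exists2 W1, T W1 & forall P, T P -> ip (W - W1) P = 0.
Proof.
elim: cs T => [|c cs IH] T [T0 [TD TZ]] Tsep W.
  exists 0 => // P TP; rewrite (Tsep P TP) ?ip0r //.
pose T' P := T P /\ (P c.1)@_c.2 = 0.
have T'sub : subspace T'.
  split; first by split; rewrite // ffunE mcoeff0.
  split=> [P Q [TP P0] [TQ Q0]|a P [TP P0]]; split.
  - exact: TD.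
  - by rewrite ffunE mcoeffD P0 Q0 addr0.
  - exact: TZ.
  - by rewrite ffunE mcoeffZ P0 mulr0.
have T'sep P : T' P -> (forall c, c \in cs -> (P c.1)@_c.2 = 0) -> P = 0.
  move=> [TP P0] H; apply: Tsep => // d; rewrite inE => /orP[/eqP->//|].
  exact: H.
have [W1 [TW1 W10] W1P] := IH T' T'sub T'sep W.
have [TT'|/existsNP[B /not_implyP[TB B0]]] := pselect (forall P, T P -> (P c.1)@_c.2 = 0).
  by exists W1 => // P TP; apply: W1P; split=> //; apply: TT'.
have [B1 [TB1 B10] B1P] := IH T' T'sub T'sep B.
have lin (X Y : CP) a : ((X - a *: Y : CP) c.1)@_c.2 = (X c.1)@_c.2 - a * (Y c.1)@_c.2.
  by rewrite !ffunE mcoeffB mcoeffZ.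
(* D is orthogonal to T' and has a nonzero first coordinate, so T is T' plus the line of D: one
   Gram-Schmidt step remains. *)
pose D := B - B1.
have TD' : T D by apply: subspaceB.
have Dc : (D c.1)@_c.2 = (B c.1)@_c.2 by rewrite !ffunE mcoeffB B10 subr0.
have Dnz : ip D D != 0.
  by apply: contra_notN B0 => /eqP/ip_eq0 D0; rewrite -Dc D0 ffunE mcoeff0.
exists (W1 + (ip W D / ip D D) *: D); first exact: TD TW1 (TZ _ _ TD').
move=> P TP.
pose e := (P c.1)@_c.2 / (D c.1)@_c.2; pose P' : CP := P - e *: D.
have PE : P = P' + e *: D by rewrite /P' subrK.
have T'P' : T' P'.
  split; first exact: subspaceB _ TP (TZ _ _ TD').
  apply: (etrans (lin P D e)); rewrite /e divfK ?subrr // Dc; exact/eqP.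
have DP' : ip D P' = 0 := B1P _ T'P'.
have DW1 : ip D W1 = 0 := B1P _ (conj TW1 W10).
rewrite PE ipDr ipZr opprD addrA ipBl ipZl (W1P _ T'P') DP' mulr0 subr0 add0r.
have -> : ip (W - W1 - (ip W D / ip D D) *: D) D = 0; last by rewrite mulr0.
by rewrite ipBl ipZl divfK // ipBl [ip W1 D]ipC DW1 subr0 subrr.
Qed.

Definition coords k : seq ({set 'I_m} * 'X_{1..m}) :=
  [seq (A, val a) | A <- enum {: {set 'I_m}}, a <- enum {: 'X_{1..m < k.+1}}].

Lemma coords_sep s k P : Psk s k P -> (forall c, c \in coords k -> (P c.1)@_c.2 = 0) -> P = 0.
Proof.
move=> /PskP[_ P2] H; apply/ffunP=> A; rewrite ffunE; apply/mpolyP=> a; rewrite mcoeff0.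
have [ak|ak] := boolP (mdeg a == k); last by rewrite (dhomog_nemf_coeff (P2 A) ak).
have ab : (mdeg a < k.+1)%N by rewrite (eqP ak).
apply: (H (A, a)); apply/allpairsP; exists (A, BMultinom ab) => /=.
by rewrite !mem_enum.
Qed.

Lemma orth_decomp_Psk s k (T : CP -> Prop) : subspace T -> (forall P, T P -> Psk s k P) ->
  forall W, exists2 W1, T W1 & forall P, T P -> ip (W - W1) P = 0.
Proof.
move=> HT TP; apply: (@orth_decomp (coords k)) => // P /TP; exact: coords_sep.
Qed.
End Fischer.

(** * Infinitesimal rotations *)

Section Vandermonde.
Variable R : realType.

(** By invertibility of the Vandermonde matrix, these weights extract the linear coefficient of any
    polynomial of degree less than N from its values at 0, ..., N - 1. *)
Lemma derivative_weights (N : nat) : (1 < N)%N -> exists c : 'I_N -> R,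
  forall n, (n < N)%N -> \sum_(i < N) c i * i%:R ^+ n = (n == 1%N)%:R.
Proof.
move=> N1; pose a : 'rV[R]_N := \row_i i%:R.
have Vu : Vandermonde N a \in unitmx.
  rewrite unitmxE unitfE det_Vandermonde; apply/prodf_neq0 => i _.
  apply/prodf_neq0 => j ij; rewrite !mxE subr_eq0 eqr_nat.
  by rewrite neq_ltn ij orbT.
pose d : 'cV[R]_N := \col_i (i == 1%N :> nat)%:R.
exists (fun i => (invmx (Vandermonde N a) *m d) i 0) => n nN.
have /matrixP /(_ (Ordinal nN) 0) := mulKVmx Vu d.
rewrite !mxE /= => <-; apply: eq_bigr => i _.
by rewrite [in RHS]mxE mulrC [X in _ = X ^+ _ * _]mxE.
Qed.
End Vandermonde.

Section PolyFamilies.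
Variables (R : realType) (m : nat).
Local Notation CP := (Defs.CP R m).
Local Notation MP := {mpoly R[m]}.
Implicit Types (F G : R -> MP) (f g : MP).

(* F is polynomial in t, with value f0 and derivative f1 at t = 0. *)
Definition pfam F f0 f1 := exists p : {poly MP},
  [/\ p`_0 = f0, p`_1 = f1 & forall t, F t = p.[t%:MP]].

Lemma pfam_cst f : pfam (fun _ => f) f 0.
Proof. by exists f%:P; split=> [||t]; rewrite ?coefC ?hornerC. Qed.
Lemma pfam_t f : pfam (fun t => t *: f) 0 f.
Proof.
exists (f *: 'X); split=> [||t]; rewrite ?coefZ ?coefX ?mulr0 ?mulr1 //.
by rewrite hornerZ hornerX mulrC mul_mpolyC.
Qed.
Lemma pfamD F G f0 f1 g0 g1 : pfam F f0 f1 -> pfam G g0 g1 ->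
  pfam (fun t => F t + G t) (f0 + g0) (f1 + g1).
Proof.
move=> [p [<- <- pE]] [q [<- <- qE]]; exists (p + q); rewrite !coefD.
by split=> // t; rewrite hornerD pE qE.
Qed.
Lemma pfamM F G f0 f1 g0 g1 : pfam F f0 f1 -> pfam G g0 g1 ->
  pfam (fun t => F t * G t) (f0 * g0) (f0 * g1 + f1 * g0).
Proof.
move=> [p [<- <- pE]] [q [<- <- qE]]; exists (p * q).
rewrite !coefM !big_ord_recl !big_ord0 /= !addr0 /= .
by split=> // t; rewrite hornerM pE qE.
Qed.
Lemma eq_pfam F G f0 f1 : F =1 G -> pfam F f0 f1 -> pfam G f0 f1.
Proof. by move=> FG [p [p0 p1 pE]]; exists p; split=> // t; rewrite -FG. Qed.
Lemma pfamZ (a : R) F f0 f1 : pfam F f0 f1 -> pfam (fun t => a *: F t) (a *: f0) (a *: f1).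
Proof.
move=> /(pfamM (pfam_cst a%:MP)); rewrite mul0r addr0 !mul_mpolyC.
by apply: eq_pfam => t; rewrite mul_mpolyC.
Qed.
Lemma pfamN F f0 f1 : pfam F f0 f1 -> pfam (fun t => - F t) (- f0) (- f1).
Proof.
move=> /(pfamZ (-1)); rewrite !scaleN1r.
by apply: eq_pfam => t; rewrite scaleN1r.
Qed.
Lemma pfam_tM F f0 f1 : pfam F f0 f1 -> pfam (fun t => t *: F t) 0 f0.
Proof.
move=> /(pfamM (pfam_t 1)); rewrite mul0r mul1r mul0r add0r.
by apply: eq_pfam => t; rewrite -scalerAl mul1r.
Qed.

Lemma pfam_comp (s : R -> m.-tuple MP) (s0 s1 : m.-tuple MP) f :
  (forall l, pfam (fun t => tnth (s t) l) (tnth s0 l) (tnth s1 l)) ->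
  pfam (fun t => f \mPo s t) (f \mPo s0)
    (\sum_l tnth s1 l * (mderiv l f \mPo s0)).
Proof.
move=> Hs; elim/mpoly_ind_mulX: f => [c|p q Hp Hq|j p Hp].
- rewrite comp_mpolyC big1 => [|l _]; last by rewrite mderivC comp_mpoly0 mulr0.
  by apply: eq_pfam (pfam_cst c%:MP) => t; rewrite comp_mpolyC.
- rewrite comp_mpolyD (eq_bigr (fun l => tnth s1 l * (mderiv l p \mPo s0) +
    tnth s1 l * (mderiv l q \mPo s0))); last first.
    by move=> l _; rewrite mderivD comp_mpolyD mulrDr.
  rewrite big_split; apply: eq_pfam (pfamD Hp Hq) => t.
  by rewrite comp_mpolyD.
rewrite comp_mpolyM comp_mpolyXi (eq_bigr (fun l => tnth s1 l * (p *+ (l == j) \mPo s0) +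
   tnth s0 j * (tnth s1 l * (mderiv l p \mPo s0)))); last first.
  move=> l _; rewrite mderivX1 comp_mpolyD mulrDr comp_mpolyM comp_mpolyXi.
  by rewrite mulrCA.
rewrite big_split /= -mulr_sumr (bigD1 j) //= eqxx big1 ?addr0; last first.
  by move=> l /negbTE ->; rewrite comp_mpoly0 mulr0.
rewrite addrC; apply: eq_pfam (pfamM (Hs j) Hp) => t.
by rewrite comp_mpolyM comp_mpolyXi.
Qed.

Implicit Types (U V : R -> CP) (P Q : CP).

Definition cfam U P Q := forall A, pfam (fun t => U t A) (P A) (Q A).

Lemma eq_cfam U V P Q : U =1 V -> cfam U P Q -> cfam V P Q.
Proof. by move=> UV HU A; apply: eq_pfam (HU A) => t; rewrite UV. Qed.
Lemma cfamD U V P Q P' Q' : cfam U P Q -> cfam V P' Q' ->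
  cfam (fun t => U t + V t) (P + P') (Q + Q').
Proof.
move=> HU HV A; rewrite !ffunE; apply: eq_pfam (pfamD (HU A) (HV A)) => t.
by rewrite ffunE.
Qed.
Lemma cfamZ a U P Q : cfam U P Q -> cfam (fun t => a *: U t) (a *: P) (a *: Q).
Proof. by move=> HU A; rewrite !ffunE; apply: eq_pfam (pfamZ a (HU A)) => t; rewrite ffunE. Qed.
Lemma cfam_t U P Q : cfam U P Q -> cfam (fun t => t *: U t) 0 P.
Proof. by move=> HU A; rewrite !ffunE; apply: eq_pfam (pfam_tM (HU A)) => t; rewrite ffunE. Qed.
Lemma pfam_bneg b (F : R -> MP) f0 f1 : pfam F f0 f1 ->
  pfam (fun t => bneg b (F t)) (bneg b f0) (bneg b f1).
Proof. by case: b => //; apply: pfamN. Qed.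
Lemma cfam_ext j U P Q : cfam U P Q -> cfam (fun t => ext j (U t)) (ext j P) (ext j Q).
Proof.
move=> HU A; rewrite !ffunE; case: ifP => jA; last first.
  by apply: eq_pfam (pfam_cst 0) => t; rewrite ffunE jA.
by apply: eq_pfam (pfam_bneg _ (HU _)) => t; rewrite ffunE jA.
Qed.
Lemma cfam_ctr j U P Q : cfam U P Q -> cfam (fun t => ctr j (U t)) (ctr j P) (ctr j Q).
Proof.
move=> HU A; rewrite !ffunE; case: ifP => jA.
  by apply: eq_pfam (pfam_cst 0) => t; rewrite ffunE jA.
by apply: eq_pfam (pfam_bneg _ (HU _)) => t; rewrite ffunE jA.
Qed.
Lemma cfam_ginv U P Q : cfam U P Q -> cfam (fun t => ginv (U t)) (ginv P) (ginv Q).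
Proof.
move=> HU A; rewrite !ffunE.
by apply: eq_pfam (pfam_bneg _ (HU _)) => t; rewrite ffunE.
Qed.

(** Any N beyond the degrees of all components works, so the same N and weights can serve two
    families at once. *)
Lemma cfam_weights U P Q : cfam U P Q -> exists N0, forall N (c : 'I_N -> R),
  (N0 <= N)%N ->
  (forall n, (n < N)%N -> \sum_(i < N) c i * i%:R ^+ n = (n == 1%N)%:R) ->
  Q = \sum_(i < N) c i *: U i%:R.
Proof.
move=> HU.
have HA A : exists N0, forall N (c : 'I_N -> R), (N0 <= N)%N ->
  (forall n, (n < N)%N -> \sum_(i < N) c i * i%:R ^+ n = (n == 1%N)%:R) ->
  Q A = \sum_(i < N) c i *: U i%:R A.
  have [p [_ <- pE]] := HU A; exists (maxn 2 (size p)) => N c.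
  rewrite geq_max => /andP[N2 pN] Hc.
  under eq_bigr => i _.
    rewrite pE (horner_coef_wide _ pN) scaler_sumr.
    under eq_bigr => n _ do rewrite -rmorphXn /= mulrC mul_mpolyC scalerA.
    over.
  rewrite exchange_big (bigD1 (Ordinal N2)) //= -scaler_suml Hc //= scale1r.
  rewrite big1 ?addr0 // => n n1; rewrite -scaler_suml Hc //.
  by rewrite -[(_ == 1)%N]/(n == Ordinal N2) (negbTE n1) scale0r.
have [N0 HN0] := choice HA; exists (\max_A N0 A) => N c HN Hc.
apply/ffunP=> A; rewrite sum_ffunE (HN0 A N c) //; last exact: leq_trans (leq_bigmax A) HN.
by apply: eq_bigr => i _; rewrite ffunE.
Qed.
End PolyFamilies.

(** * Differentiating a reflection with respect to its axis *)

Section Rotation.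
Variables (R : realType) (m : nat).
Local Notation CP := (Defs.CP R m).
Local Notation pderiv := (Defs.pderiv R m).
Local Notation MP := {mpoly R[m]}.
Implicit Types (i j l : 'I_m) (A B C : {set 'I_m}) (P Q : CP) (s k : nat) (u v : 'I_m -> R).

(* The infinitesimal H-rotation in the (i, j)-plane. *)
Definition lrot i j P : CP :=
  mulx i (pderiv j P) - mulx j (pderiv i P) + (ext i (ctr j P) - ext j (ctr i P)).

Fact lrot_add i j : zmod_morphism (lrot i j).
Proof.
move=> P Q; rewrite /lrot !raddfB /=.
move: (mulx i (pderiv j P)) (mulx i (pderiv j Q)) (mulx j (pderiv i P)) (mulx j (pderiv i Q)).
move: (ext i (ctr j P)) (ext i (ctr j Q)) (ext j (ctr i P)) (ext j (ctr i Q)).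
by move=> a b c d e f g h; apply/ffunP=> A; rewrite !ffunE; ring.
Qed.
Fact lrot_scal i j : scalable (lrot i j).
Proof.
move=> a P; rewrite /lrot /mulx !pderiv_is_scalable !ctr_is_scalable !ext_is_scalable.
by rewrite !pmul_is_scalable -!scalerBr -scalerDr.
Qed.
HB.instance Definition _ i j := GRing.isZmodMorphism.Build CP CP (lrot i j) (lrot_add i j).
HB.instance Definition _ i j := GRing.isScalable.Build R CP CP *:%R (lrot i j) (lrot_scal i j).

Definition basisv i : 'I_m -> R := fun l => (l == i)%:R.
(** e_i + t e_j, left unnormalised so that the reflections along it stay polynomial in t. *)
Definition tiltv i j (t : R) : 'I_m -> R := fun l => (l == i)%:R + t * (l == j)%:R.

Lemma nsq_basisv i : nsq (basisv i) = 1.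
Proof.
rewrite /nsq (bigD1 i) //= /basisv eqxx expr1n big1 ?addr0 // => l /negbTE ->.
by rewrite expr0n.
Qed.

Lemma extv_basisv i P : extv (basisv i) P = ext i P.
Proof. by apply: (sum_delta (fun l => ext l P)). Qed.
Lemma ctrv_basisv i P : ctrv (basisv i) P = ctr i P.
Proof. by apply: (sum_delta (fun l => ctr l P)). Qed.

Section Tilt.
Variables (i j : 'I_m).
Hypothesis ij : i != j.

Lemma nsq_tiltv t : nsq (tiltv i j t) = 1 + t ^+ 2.
Proof.
rewrite /nsq (bigD1 i) //= (bigD1 j) /= 1?eq_sym // big1 => [|l /andP[li lj]].
  rewrite /tiltv !eqxx (negbTE ij) eq_sym (negbTE ij) /=; ring.
by rewrite /tiltv (negbTE li) (negbTE lj) mulr0 addr0 expr0n.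
Qed.
Lemma extv_tiltv t P : extv (tiltv i j t) P = ext i P + t *: ext j P.
Proof.
rewrite -(extv_basisv i) -(extv_basisv j) scaler_sumr -big_split.
by apply: eq_bigr => l _; rewrite /= scalerA -scalerDl.
Qed.
Lemma ctrv_tiltv t P : ctrv (tiltv i j t) P = ctr i P + t *: ctr j P.
Proof.
rewrite -(ctrv_basisv i) -(ctrv_basisv j) scaler_sumr -big_split.
by apply: eq_bigr => l _; rewrite /= scalerA -scalerDl.
Qed.

Lemma tnth_reflmx u l :
  tnth (lintup (reflmx u)) l = (2 * u l) *: (\sum_b u b *: 'X_b) - nsq u *: 'X_l.
Proof.
rewrite tnth_mktuple (eq_bigr (fun b => (2 * u l) *: (u b *: 'X_b) - nsq u *: ('X_b *+ (b == l)))).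
  rewrite big_split sumrN /= -scaler_sumr; congr (_ - _).
  by rewrite (bigD1 l) //= eqxx big1 ?addr0 // => b /negbTE ->; rewrite scaler0.
move=> b _; rewrite /reflmx scalerBl scalerA mulrA eq_sym; congr (_ - _).
by rewrite -scalerA; case: eqP => _; rewrite ?scale1r ?scale0r.
Qed.

Lemma sum_tiltv t : \sum_b tiltv i j t b *: 'X_b = 'X_i + t *: 'X_j :> MP.
Proof.
rewrite (eq_bigr (fun b => (b == i)%:R *: 'X_b + t *: ((b == j)%:R *: 'X_b))).
  by rewrite big_split /= -scaler_sumr (sum_delta _ (l := i)) // (sum_delta _ (l := j)).
by move=> b _; rewrite scalerDl scalerA.
Qed.

(** The derivative at t = 0 of the coordinate x_l transformed by [reflmx (tiltv i j t)]. *)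
Let b_ l : MP := (2 * (l == i)%:R) *: 'X_j + (2 * (l == j)%:R) *: 'X_i.

Lemma pfam_tilt l : pfam (fun t => tnth (lintup (reflmx (tiltv i j t))) l)
  (tnth (lintup (reflmx (basisv i))) l) (tnth [tuple b_ l | l < m] l).
Proof.
have e0 : tnth (lintup (reflmx (basisv i))) l = (2 * (l == i)%:R) *: 'X_i - 'X_l + 0.
  by rewrite tnth_reflmx nsq_basisv scale1r (sum_delta _ (l := i)) // addr0.
have e1 : tnth [tuple b_ l | l < m] l = 0 + (b_ l + 0) by rewrite tnth_mktuple add0r addr0.
rewrite e0 e1; apply: eq_pfam (pfamD (pfam_cst _) (pfam_tM (pfamD (pfam_cst (b_ l))
  (pfam_t ((2 * (l == j)%:R) *: 'X_j - 'X_l))))) => t.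
rewrite tnth_reflmx sum_tiltv nsq_tiltv /tiltv /b_ -!mul_mpolyC !(mpolyCD, mpolyCM, rmorphXn) /=.
by ring.
Qed.

Let s0 := lintup (reflmx (basisv i)).

Lemma cfam_csub P : cfam (fun t => csub (lintup (reflmx (tiltv i j t))) P)
  (csub s0 P) (2 *: (mulx j (csub s0 (pderiv i P)) + mulx i (csub s0 (pderiv j P)))).
Proof.
move=> A.
have -> : (2 *: (mulx j (csub s0 (pderiv i P)) + mulx i (csub s0 (pderiv j P)))) A
   = \sum_l tnth [tuple b_ l | l < m] l * (mderiv l (P A) \mPo s0).
  rewrite !ffunE (bigD1 i) //= (bigD1 j) /= 1?eq_sym // big1 => [|l /andP[li lj]]; last first.
    by rewrite tnth_mktuple /b_ (negbTE li) (negbTE lj) mulr0 !scale0r addr0 mul0r.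
  rewrite !tnth_mktuple /b_ !eqxx (negbTE ij) eq_sym (negbTE ij) mulr0 mulr1 !scale0r !addr0 add0r.
  by rewrite -!scalerAl scalerDr.
rewrite [csub s0 P A]ffunE.
by apply: eq_pfam (pfam_comp (P A) pfam_tilt) => t; rewrite ffunE.
Qed.

Lemma reft_tiltv t P : let Y := ginv (csub (lintup (reflmx (tiltv i j t))) P) in
  reft (tiltv i j t) P = Y + t *: (t *: Y) + (- 2) *: (ext i (ctr i Y) +
     t *: (ext i (ctr j Y) + ext j (ctr i Y)) + t *: (t *: ext j (ctr j Y))).
Proof.
move=> Y; rewrite /reft -/Y /reflv nsq_tiltv ctrv_tiltv extv_tiltv scaleNr.
rewrite !(raddfD (ext i)) !(raddfD (ext j)) /= !ext_is_scalable scalerDl scale1r !scalerA.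
rewrite -expr2; congr (_ - 2 *: _).
by rewrite [t *: (_ + _)]scalerDr !scalerDr !scalerA -!addrA.
Qed.

(** Up to normalisation, two reflections with axes at a given angle compose to the rotation by twice
    that angle; hence the factor 2. *)
Lemma cfam_reft P :
  cfam (fun t => reft (tiltv i j t) P) (reft (basisv i) P) (2 *: reft (basisv i) (lrot i j P)).
Proof.
pose Y0 := ginv (csub s0 P).
pose Y1 := ginv (2 *: (mulx j (csub s0 (pderiv i P)) + mulx i (csub s0 (pderiv j P)))).
have HY := cfam_ginv (cfam_csub P).
rewrite -/Y0 -/Y1 in HY.
have := cfamD (cfamD HY (cfam_t (cfam_t HY))) (cfamZ (- 2)
  (cfamD (cfamD (cfam_ext i (cfam_ctr i HY)) (cfam_t (cfamD (cfam_ext i (cfam_ctr j HY))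
     (cfam_ext j (cfam_ctr i HY))))) (cfam_t (cfam_t (cfam_ext j (cfam_ctr j HY)))))).
have -> : Y0 + 0 + - 2 *: (ext i (ctr i Y0) + 0 + 0) = reft (basisv i) P.
  by rewrite /reft -/s0 -/Y0 /reflv nsq_basisv scale1r !addr0 extv_basisv ctrv_basisv scaleNr.
have -> : Y1 + 0 + - 2 *: (ext i (ctr i Y1) + (ext i (ctr j Y0) + ext j (ctr i Y0)) + 0)
   = 2 *: reft (basisv i) (lrot i j P).
  rewrite !addr0.
  have c Q l1 l2 : ginv (csub s0 (ext l1 (ctr l2 Q))) = ext l1 (ctr l2 (ginv (csub s0 Q))).
    by rewrite csub_ext csub_ctr ctr_ginv raddfN /= ext_ginv opprK.
  (* [E1] accounts for the variation of the argument x, and [E2] for the variation of the reflection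
     acting on the values. *)
  have E1 : 2 *: reflv (basisv i) (ginv (csub s0 (mulx i (pderiv j P) - mulx j (pderiv i P))))
     = Y1 - 2 *: ext i (ctr i Y1).
    rewrite -(reflv_scal _ 2) -ginv_is_scalable raddfB /= !csub_mulx.
    have -> : pmul (tnth s0 i) (csub s0 (pderiv j P)) = mulx i (csub s0 (pderiv j P)).
      congr (pmul _ _); rewrite tnth_reflmx nsq_basisv (sum_delta _ (l := i)) // /basisv eqxx.
      by rewrite mulr1 scale1r scaler_nat mulr2n addrK.
    have -> : pmul (tnth s0 j) (csub s0 (pderiv i P)) = - mulx j (csub s0 (pderiv i P)).
      have -> : tnth s0 j = - 'X_j.
        rewrite tnth_reflmx nsq_basisv (sum_delta _ (l := i)) // /basisv eq_sym (negbTE ij).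
        by rewrite mulr0 scale0r sub0r scale1r.
      by apply/ffunP=> A; rewrite !ffunE mulNr.
    by rewrite opprK addrC -/Y1 /reflv nsq_basisv scale1r extv_basisv ctrv_basisv.
  have E2 : reflv (basisv i) (ginv (csub s0 (ext i (ctr j P) - ext j (ctr i P)))) =
      - (ext i (ctr j Y0) + ext j (ctr i Y0)).
    have rX : reflv (basisv i) (ext i (ctr j Y0)) = - ext i (ctr j Y0).
      by rewrite -extv_basisv reflv_extv nsq_basisv scale1r.
    have rZ : reflv (basisv i) (ext j (ctr i Y0)) = ext j (ctr i Y0).
      rewrite /reflv nsq_basisv scale1r extv_basisv ctrv_basisv.
      by rewrite ctr_ext_comm (negbTE ij) mulr0n sub0r ctr_sq !(raddf0, oppr0, addr0).
    by rewrite csub_add ginv_is_additive reflv_add !c rX rZ opprD.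
  have RE : reft (basisv i) (lrot i j P) =
      reflv (basisv i) (ginv (csub s0 (mulx i (pderiv j P) - mulx j (pderiv i P)))) +
      reflv (basisv i) (ginv (csub s0 (ext i (ctr j P) - ext j (ctr i P)))).
    rewrite /reft -/s0 /lrot (raddfD (csub s0)) /= (raddfD (@ginv R m)) /=.
    by rewrite (raddfD (reflv (basisv i))).
  rewrite RE E2 (scalerDr 2 (reflv _ _)) E1.
  move: (ext i (ctr i Y1)) (ext i (ctr j Y0) + ext j (ctr i Y0)) => a b.
  by rewrite scaleNr scalerDr opprD addrA scalerN.
by apply: eq_cfam => t; rewrite reft_tiltv.
Qed.
End Tilt.
End Rotation.

(** * Infinitesimal rotations as combinations of group elements *)

Section RotationSpan.
Variables (R : realType) (m : nat).
Local Notation CP := (Defs.CP R m).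
Local Notation Psk := (Defs.Psk R m).
Local Notation Hact := (Defs.Hact R m).
Local Notation subspace := (Defs.subspace R m).
Local Notation H_invariant := (Defs.H_invariant R m).
Local Notation unit_vec := (Defs.unit_vec R m).
Local Notation pin_elt := (Defs.pin_elt R m).
Local Notation MP := {mpoly R[m]}.
Implicit Types (i j l : 'I_m) (A B C : {set 'I_m}) (P Q : CP) (s k : nat) (u v : 'I_m -> R).

Lemma comp_mpoly_scale (a : R) (t : m.-tuple MP) k (p : MP) : p \is k.-homog ->
  p \mPo [tuple a *: tnth t i | i < m] = a ^+ k *: (p \mPo t).
Proof.
move=> pk; rewrite !comp_mpolyEX scaler_sumr !big_seq; apply: eq_bigr => mm mmp.
rewrite !comp_mpolyX scalerA [a ^+ k * _]mulrC -scalerA; congr (_ *: _).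
under eq_bigr => i _ do rewrite tnth_mktuple exprZn.
rewrite scaler_prod; congr (_ *: _).
by rewrite -(dhomog_mf pk mmp) /= mdegE expr_sum.
Qed.

(** One factor c^2 comes from [reflv] and k of them from the substitution in degree k. *)
Lemma reft_scale (c : R) u s k P : Psk s k P ->
  reft (fun l => c * u l) P = (c ^+ 2) ^+ k.+1 *: reft u P.
Proof.
move=> /PskP[_ P2]; rewrite /reft.
have nE : nsq (fun l => c * u l) = c ^+ 2 * nsq u.
  by rewrite /nsq mulr_sumr; apply: eq_bigr => l _; rewrite exprMn.
have -> : csub (lintup (reflmx (fun l => c * u l))) P = (c ^+ 2) ^+ k *: csub (lintup (reflmx u)) P.
  apply/ffunP=> A; rewrite [LHS]ffunE [RHS]ffunE [X in _ *: X]ffunE -(comp_mpoly_scale _ _ (P2 A)); congr (_ \mPo _).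
  apply: eq_from_tnth => i; rewrite !tnth_mktuple scaler_sumr; apply: eq_bigr => l _.
  by rewrite scalerA /reflmx nE; congr (_ *: _); ring.
have rE Y : reflv (fun l => c * u l) Y = c ^+ 2 *: reflv u Y :> CP.
  have e Z : extv (fun l => c * u l) Z = c *: extv u Z :> CP.
    by rewrite scaler_sumr; apply: eq_bigr => l _; rewrite scalerA.
  have e' Z : ctrv (fun l => c * u l) Z = c *: ctrv u Z :> CP.
    by rewrite scaler_sumr; apply: eq_bigr => l _; rewrite scalerA.
  by rewrite /reflv nE e e' extv_scal scalerBr !scalerA [c ^+ 2 * 2]mulrC -[2 * c * c]mulrA -expr2.
by rewrite rE ginv_is_scalable reflv_scal scalerA -exprS.
Qed.

Lemma reft_Hact u s k P : 0 < nsq u -> Psk s k P ->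
  reft u P = nsq u ^+ k.+1 *: Hact [:: fun l => (Num.sqrt (nsq u))^-1 * u l] P.
Proof.
move=> u0 HP; set c := Num.sqrt (nsq u).
have c0 : c != 0 by rewrite gt_eqF // sqrtr_gt0.
have c2 : c ^+ 2 = nsq u by rewrite sqr_sqrtr // ltW.
rewrite Hact1; last first.
  rewrite -nsqE /nsq; under eq_bigr => l _ do rewrite exprMn.
  by rewrite -mulr_sumr -/(nsq u) -c2 exprVn mulVf // expf_neq0.
rewrite (reft_scale _ _ HP) scalerA -exprMn exprVn c2 mulfV ?expr1n ?scale1r //.
by rewrite gt_eqF.
Qed.

Lemma pin_elt_normalized u : 0 < nsq u ->
  unit_vec (fun l => (Num.sqrt (nsq u))^-1 * u l).
Proof.
move=> u0; rewrite -nsqE /nsq; under eq_bigr => l _ do rewrite exprMn.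
rewrite -mulr_sumr -/(nsq u) exprVn sqr_sqrtr ?ltW // mulVf // gt_eqF //.
Qed.

(** 1 + t^2 is 1 to first order, so its powers can be inserted freely to adjust normalisations. *)
Lemma cfam_nsq i j n (U : R -> CP) P Q : i != j -> cfam U P Q ->
  cfam (fun t => nsq (tiltv i j t) ^+ n *: U t) P Q.
Proof.
move=> ij HU; elim: n => [|n IH].
  by apply: eq_cfam HU => t; rewrite expr0 scale1r.
have := cfamD IH (cfam_t (cfam_t IH)); rewrite !addr0.
apply: eq_cfam => t; rewrite exprS; move: (_ ^+ n) => e.
rewrite nsq_tiltv // mulrDl mul1r scalerDl; congr (_ + _).
by rewrite !scalerA expr2.
Qed.

(* The H-action of e_i (e_i + t e_j), renormalised to be polynomial in t, has
   derivative [2 lrot i j] at 0, and the derivative at 0 of a polynomial is a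
   linear combination of its values at 0, 1, 2, ... *)
Lemma lrot_span i j s k s' k' P Q : i != j -> Psk s k P -> Psk s' k' Q ->
  exists N (c : 'I_N -> R) (us : 'I_N -> seq ('I_m -> R)),
  [/\ forall n, pin_elt (us n), lrot i j P = \sum_n c n *: Hact (us n) P &
      lrot i j Q = \sum_n c n *: Hact (us n) Q].
Proof.
(* P and Q must share their coefficients although their degrees differ: the extra powers of [nsq]
   bring both normalising factors to the exponent K + 1. *)
move=> ij HP HQ; pose K := maxn k k'.
have [NP HNP] := cfam_weights (cfam_nsq (K - k) ij (cfam_reft ij P)).
have [NQ HNQ] := cfam_weights (cfam_nsq (K - k') ij (cfam_reft ij Q)).
pose N := maxn 2 (maxn NP NQ).
have [|c Hc] := @derivative_weights R N; first by rewrite leq_max ltnS leqnn.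
have tpos (t : R) : 0 < nsq (tiltv i j t) by rewrite nsq_tiltv // ltr_wpDr // sqr_ge0.
pose w (t : R) : 'I_m -> R := fun l => (Num.sqrt (nsq (tiltv i j t)))^-1 * tiltv i j t l.
exists N, (fun n => 2^-1 * (c n * nsq (tiltv i j n%:R) ^+ K.+1)), (fun n => [:: basisv R i; w n%:R]).
have main r d X : Psk r d X -> (d <= K)%N -> 2 *: reft (basisv R i) (lrot i j X) =
    \sum_(n < N) c n *: (nsq (tiltv i j n%:R) ^+ (K - d) *: reft (tiltv i j n%:R) X) ->
  lrot i j X = \sum_n (2^-1 * (c n * nsq (tiltv i j n%:R) ^+ K.+1)) *: Hact [:: basisv R i; w n%:R] X.
  move=> HX dK E.
  have u1 : nsq (basisv R i) = 1 by exact: nsq_basisv.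
  have -> : lrot i j X = 2^-1 *: reft (basisv R i)
      (\sum_(n < N) c n *: (nsq (tiltv i j n%:R) ^+ (K - d) *: reft (tiltv i j n%:R) X)).
    by rewrite -E reft_scal (reftK _ u1) scalerA mulVf ?scale1r // pnatr_eq0.
  rewrite raddf_sum scaler_sumr; apply: eq_bigr => n _ /=.
  have -> : Hact [:: basisv R i; w n%:R] X = reft (basisv R i) (Hact [:: w n%:R] X).
    by rewrite Hact_cons (Hact1 _ (u1 : unit_vec (basisv R i))).
  have -> : reft (tiltv i j n%:R) X = nsq (tiltv i j n%:R) ^+ d.+1 *: Hact [:: w n%:R] X.
    exact: reft_Hact (tpos _) HX.
  move: (Hact [:: w n%:R] X) => Y.
  by rewrite /= !reft_scal !scalerA !mulrA -mulrA -exprD addnS subnK.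
split.
- move=> n; apply/pin_elt_cons; split; first by rewrite -nsqE nsq_basisv.
  apply/pin_elt_cons; split; first exact: pin_elt_normalized (tpos _).
  by case.
- by apply: (main _ _ _ HP (leq_maxl _ _)); apply: HNP Hc; rewrite !leq_max leqnn orbT.
- by apply: (main _ _ _ HQ (leq_maxr _ _)); apply: HNQ Hc; rewrite !leq_max leqnn !orbT.
Qed.

Lemma lrot_invariant i j s k (T : CP -> Prop) P : i != j -> subspace T -> H_invariant T ->
  Psk s k P -> T P -> T (lrot i j P).
Proof.
move=> ij [T0 [TD TZ]] HT HP TP.
have [N [c [us [Hus -> _]]]] := lrot_span ij HP HP.
apply: (big_ind T) => // n _; apply: TZ; exact: HT.
Qed.

(** One combination of group elements represents [lrot i j] both at P and at [f P], and f commutes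
    with each of these elements. *)
Lemma lrot_equivariant i j s k s' k' (S : CP -> Prop) (f : CP -> CP) P :
  i != j -> subspace S -> H_invariant S ->
  (forall P Q, S P -> S Q -> f (P + Q) = f P + f Q) ->
  (forall a P, S P -> f (a *: P) = a *: f P) ->
  (forall us P, pin_elt us -> S P -> f (Hact us P) = Hact us (f P)) ->
  S P -> Psk s k P -> Psk s' k' (f P) -> f (lrot i j P) = lrot i j (f P).
Proof.
move=> ij [S0 [SD SZ]] HS fD fZ fH SP HP HfP.
have [N [c [us [Hus -> ->]]]] := lrot_span ij HP HfP.
have f0 : f 0 = 0 by rewrite -(scale0r P) fZ // !scale0r.
(* Since f is linear only on S, membership of the partial sums is carried along. *)
suff [] : S (\sum_n c n *: Hact (us n) P) /\
  f (\sum_n c n *: Hact (us n) P) = \sum_n c n *: Hact (us n) (f P) by [].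
apply: (big_rec2 (fun X Y => S X /\ f X = Y)) => // n X Y _ [SY <-].
have Sn : S (Hact (us n) P) by apply: HS.
by split; [apply: SD => //; apply: SZ|rewrite fD ?fZ ?fH //; apply: SZ].
Qed.
End RotationSpan.

(** * Harmonic polynomials on the null cone *)

Section ComplexEval.
Variables (R : realType) (m : nat).
Local Notation MP := {mpoly R[m]}.
Local Notation rc := (real_complex R).
Implicit Types (f g p q : MP) (y : 'I_m -> R) (z : 'I_m -> R[i]) (j l : 'I_m).

Definition ceval z p : R[i] := mmap rc z p.

Lemma cevalD z p q : ceval z (p + q) = ceval z p + ceval z q.
Proof. exact: mmapD. Qed.
Lemma cevalN z p : ceval z (- p) = - ceval z p.
Proof. exact: mmapN. Qed.
Lemma ceval0 z : ceval z 0 = 0.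
Proof. exact: mmap0. Qed.
Lemma cevalM z p q : ceval z (p * q) = ceval z p * ceval z q.
Proof. exact: rmorphM. Qed.
Lemma cevalC z c : ceval z c%:MP = rc c.
Proof. exact: mmapC. Qed.
Lemma cevalZ z c p : ceval z (c *: p) = rc c * ceval z p.
Proof. exact: mmapZ. Qed.
Lemma cevalX z j : ceval z 'X_j = z j.
Proof. by rewrite /ceval mmapX mmap1U. Qed.
Lemma ceval_sum z I (r : seq I) (P : pred I) (F : I -> MP) :
  ceval z (\sum_(x <- r | P x) F x) = \sum_(x <- r | P x) ceval z (F x).
Proof. by apply: big_morph => [p q|]; rewrite ?cevalD ?ceval0. Qed.

Lemma ceval_real y p : ceval (fun j => rc (y j)) p = rc p.@[y].
Proof.
elim/mpoly_ind_mulX: p => [c|p q Hp Hq|j p Hp].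
- by rewrite cevalC mevalC.
- by rewrite cevalD mevalD rmorphD /= Hp Hq.
- by rewrite cevalM mevalM cevalX mevalXU rmorphM /= Hp.
Qed.

Lemma eq_ceval z z' p : z =1 z' -> ceval z p = ceval z' p.
Proof.
move=> E; elim/mpoly_ind_mulX: p => [c|p q Hp Hq|j p Hp].
- by rewrite !cevalC.
- by rewrite !cevalD Hp Hq.
- by rewrite !cevalM !cevalX Hp E.
Qed.

Lemma ceval_comp_lin z M p :
  ceval z (p \mPo lintup M) = ceval (fun l => \sum_j rc (M l j) * z j) p.
Proof.
elim/mpoly_ind_mulX: p => [c|p q Hp Hq|j p Hp].
- by rewrite comp_mpolyC !cevalC.
- by rewrite comp_mpolyD !cevalD Hp Hq.
rewrite comp_mpolyM comp_mpolyXi !cevalM cevalX Hp tnth_mktuple ceval_sum.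
by congr (_ * _); apply: eq_bigr => l _; rewrite cevalZ cevalX.
Qed.

Lemma ceval_homog (c : R[i]) z n p : p \is n.-homog ->
  ceval (fun j => c * z j) p = c ^+ n * ceval z p.
Proof.
move=> pn; rewrite (mpolyE p) !ceval_sum mulr_sumr !big_seq; apply: eq_bigr => a ap.
rewrite !cevalZ mulrCA; congr (_ * _); rewrite /ceval !mmapX /mmap1.
under eq_bigr => i _ do rewrite exprMn.
by rewrite big_split /= -expr_sum -mdegE (dhomog_mf pn ap).
Qed.

(** Restriction to coordinate lines shows that all derivatives vanish everywhere as well, and the
    coefficients of p are read off from derivatives at 0. *)
Lemma meval_eq0 p : (forall y, p.@[y] = 0) -> p = 0.
Proof.
pose van q := forall y, q.@[y] = 0.
have van_deriv j q : van q -> van (q^`M(j)).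
  move=> Hq y.
  have [r [r1 rE]] : exists r : {poly R}, r`_1 = (q^`M(j)).@[y] /\
      forall t, q.@[fun l => y l + t * (l == j)%:R] = r.[t].
    pose Pr q := exists r : {poly R}, [/\ r`_0 = q.@[y], r`_1 = (q^`M(j)).@[y] &
      forall t, q.@[fun l => y l + t * (l == j)%:R] = r.[t]].
    suff [r [_ r1 rE]] : Pr q by exists r.
    elim/mpoly_ind_mulX: (q) => [c|p1 p2 [r1 [a1 b1 c1]] [r2 [a2 b2 c2]]|l p1 [r1 [a1 b1 c1]]].
    - exists c%:P; rewrite !coefC mderivC meval0 mevalC; split=> // t.
      by rewrite mevalC hornerC.
    - exists (r1 + r2); rewrite !coefD mderivD !mevalD a1 a2 b1 b2; split=> // t.
      by rewrite mevalD hornerD c1 c2.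
    exists (((y l)%:P + (l == j)%:R *: 'X) * r1).
    rewrite coefM big_ord_recl big_ord0 coefM !big_ord_recl big_ord0 !coefD !coefC !coefZ !coefX /=.
    rewrite mderivX1 mevalD mevalMn !mevalM !mevalXU a1 b1 !mulr0 !mulr1 !addr0 add0r /=.
    split=> // [|t].
      by rewrite addrC eq_sym; case: (_ == _); rewrite ?mul1r ?mul0r.
    by rewrite mevalM mevalXU c1 hornerM hornerD hornerC hornerZ hornerX [t * _]mulrC.
  (* r vanishes at 0, ..., size r - 1, which is more roots than its degree allows. *)
  have r0 : r = 0.
    apply/eqP; apply: contraT => rnz.
    have := max_poly_roots (rs := [seq i%:R | i <- iota 0 (size r)]) rnz.
    rewrite size_map size_iota ltnn => -> //.
      by apply/allP=> _ /mapP[i _ ->]; rewrite /root -rE Hq.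
    by rewrite map_inj_uniq ?iota_uniq // => i1 i2 /eqP; rewrite eqr_nat => /eqP.
  by rewrite -r1 r0 coef0.
move=> Hp; apply/mpolyP=> a; rewrite mcoeff0.
elim: {a}(mdeg a) {-2}a (erefl (mdeg a)) p Hp => [|n IH] a da p Hp.
  move/eqP: da; rewrite mdeg_eq0 => /eqP ->.
  have := Hp (fun _ => 0); have -> // : p.@[fun _ => 0] = p@_0.
  elim/mpoly_ind_mulX: {Hp} p => [c|p q H1 H2|j p _].
  - by rewrite mevalC mcoeffC eqxx mulr1.
  - by rewrite mevalD mcoeffD H1 H2.
  - by rewrite mevalM mevalXU mul0r mcoeff_mulX mnm0E.
have [j aj] : exists j, (0 < a j)%N.
  apply/existsP; apply: contraTT isT => /existsPn a0.
  move: da; rewrite mdegE big1 // => j _; apply/eqP.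
  by move: (a0 j); rewrite -eqn0Ngt.
have aE : a = ((a - U_(j)) + U_(j))%MM.
  by rewrite submK //; apply/mnm_lepP=> i; rewrite mnm1E; case: eqP => [<-|].
have := IH (a - U_(j))%MM _ (p^`M(j)) (van_deriv j p Hp).
rewrite mcoeff_deriv -aE => /(_ _)/eqP; rewrite mulrn_eq0 /= => H.
by apply/eqP/H; move: da; rewrite {1}aE mdegD mdeg1 addn1 => -[].
Qed.

Definition rad2 : MP := \sum_j 'X_j * 'X_j.

(* Modulo the ideal of |x|^2, p is f + x_b g with f, g free of x_b; the hypothesis
   forces f = g = 0, and |x|^2 q is Fischer-orthogonal to harmonic polynomials. *)
Lemma null_cone_harmonic (b a : 'I_m) n p : a != b -> p \is n.-homog ->
  \sum_j (p^`M(j))^`M(j) = 0 ->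
  (forall y, y b = 0 -> nsq y = 1 ->
     ceval (fun j => rc (y j) + 'i * (j == b)%:R) p = 0) ->
  p = 0.
Proof.
move=> ab pn plap pnull.
(* Absence of x_b is expressed through evaluations, the only way in which it is used. *)
pose Free (f : MP) := forall z z', (forall j, j != b -> z j = z' j) -> ceval z f = ceval z' f.
pose r2 : MP := \sum_(j | j != b) 'X_j * 'X_j.
have FreeD f g : Free f -> Free g -> Free (f + g).
  by move=> Hf Hg z z' E; rewrite !cevalD (Hf z z') ?(Hg z z').
have FreeM f g : Free f -> Free g -> Free (f * g).
  by move=> Hf Hg z z' E; rewrite !cevalM (Hf z z') ?(Hg z z').
have FreeX j : j != b -> Free 'X_j by move=> jb z z' E; rewrite !cevalX E.
have FreeC c : Free c%:MP by move=> z z' E; rewrite !cevalC.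
have FreeN f : Free f -> Free (- f) by move=> Hf z z' E; rewrite !cevalN (Hf z z').
have Free_r2 : Free r2.
  by apply: (big_ind Free) => // [|j jb]; [rewrite -mpolyC0; apply: FreeC|apply: FreeM; apply: FreeX].
have radE : rad2 = 'X_b * 'X_b + r2 by rewrite /rad2 (bigD1 b).
have [q [f [g [Ff Fg pE]]]] : exists q f g, [/\ Free f, Free g & p = rad2 * q + (f + 'X_b * g)].
  elim/mpoly_ind_mulX: {pn plap pnull} p =>
    [c|p1 p2 [q1 [f1 [g1 [F1 G1 ->]]]] [q2 [f2 [g2 [F2 G2 ->]]]]|j p1 [q1 [f1 [g1 [F1 G1 ->]]]]].
  - exists 0, c%:MP, 0; split; rewrite ?mulr0 ?addr0 ?add0r //.
    by rewrite -mpolyC0; apply: FreeC.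
  - exists (q1 + q2), (f1 + f2), (g1 + g2); split; [exact: FreeD|exact: FreeD|ring].
  have [->|jb] := eqVneq j b.
    exists ('X_b * q1 + g1), (- (r2 * g1)), f1; split=> //; first exact/FreeN/FreeM.
    by rewrite radE; ring.
  exists ('X_j * q1), ('X_j * f1), ('X_j * g1); split; [exact/FreeM/F1/FreeX|exact/FreeM/G1/FreeX|ring].
have key y : (r2 * f).@[y] = 0 /\ (r2 * g).@[y] = 0.
  pose y' j := if j == b then 0 else y j.
  have r2y : r2.@[y] = nsq y'.
    rewrite /r2 /nsq [in RHS](bigD1 b) //= {1}/y' eqxx expr0n add0r raddf_sum /=.
    by apply: eq_bigr => j /negbTE jb; rewrite /y' jb mevalM !mevalXU expr2.
  rewrite !mevalM r2y.
  have [->|ny] := eqVneq (nsq y') 0; first by rewrite !mul0r.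
  have ny0 : 0 < nsq y' by rewrite lt_neqAle eq_sym ny sumr_ge0 // => j _; rewrite sqr_ge0.
  pose t := Num.sqrt (nsq y').
  have t0 : t != 0 by rewrite gt_eqF // sqrtr_gt0.
  have t2 : t ^+ 2 = nsq y' by rewrite sqr_sqrtr // ltW.
  (* With t = |y'|, z is t times an allowed test point, and [rad2] vanishes at z. The real and
     imaginary parts of p at z are then f(y) and t g(y). *)
  pose z j := rc (y' j) + 'i * (j == b)%:R * rc t.
  have pz : ceval z p = 0.
    pose yn j := t^-1 * y' j.
    have := pnull yn; rewrite /yn /y' eqxx mulr0 => /(_ erefl).
    have -> : nsq (fun j => t^-1 * y' j) = 1.
      rewrite /nsq; under eq_bigr => j _ do rewrite exprMn.
      by rewrite -mulr_sumr -/(nsq y') -t2 exprVn mulVf // expf_neq0.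
    move=> /(_ erefl) H.
    rewrite (@eq_ceval _ (fun j => rc t * (rc (yn j) + 'i * (j == b)%:R))).
      by rewrite (ceval_homog _ _ pn) H mulr0.
    move=> j; rewrite /z mulrDr -rmorphM /= /yn mulrA mulfV // mul1r.
    by rewrite [rc t * _]mulrC.
  have zb : z b = 'i * rc t by rewrite /z /y' eqxx mulr1 add0r.
  have fz : ceval z f = rc f.@[y].
    rewrite -ceval_real; apply: Ff => j /negbTE jb.
    by rewrite /z /y' jb mulr0 mul0r addr0.
  have gz : ceval z g = rc g.@[y].
    rewrite -ceval_real; apply: Fg => j /negbTE jb.
    by rewrite /z /y' jb mulr0 mul0r addr0.
  have r2z : ceval z r2 = rc (t ^+ 2).
    rewrite t2 -r2y -ceval_real; apply: Free_r2 => j /negbTE jb.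
    by rewrite /z /y' jb mulr0 mul0r addr0.
  move: pz; rewrite pE !cevalD !cevalM radE cevalD cevalM cevalX zb fz gz r2z.
  have -> : 'i * rc t * ('i * rc t) + rc (t ^+ 2) = 0 :> R[i].
    by rewrite mulrACA -expr2 sqr_i -rmorphM /= -expr2 mulN1r addNr.
  rewrite mul0r add0r -mulrA -rmorphM /= => /eqP; rewrite eq_complex /=.
  rewrite !(mul0r, mulr0, mul1r, subr0, addr0, add0r) => /andP[/eqP f0 /eqP g0].
  split; first by rewrite f0 mulr0.
  by move/eqP: g0; rewrite mulf_eq0 (negbTE t0) /= => /eqP ->; rewrite mulr0.
(* A second index a is needed here: the sum of squares over j != b must not be empty. *)
have r2nz : r2 != 0.
  apply/eqP=> r20; have := congr1 (fun q => q.@[fun j => (j == a)%:R]) r20.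
  rewrite /r2 (bigD1 a) //= meval0 mevalD mevalM !mevalXU eqxx mulr1 raddf_sum /=.
  rewrite big1 => [/eqP|j /andP[_ /negbTE ja]]; last by rewrite mevalM mevalXU ja mul0r.
  by rewrite addr0 oner_eq0.
have f0 : f = 0.
  have /eqP : r2 * f = 0 by apply: meval_eq0 => y; case: (key y).
  by rewrite mulf_eq0 (negbTE r2nz) => /eqP.
have g0 : g = 0.
  have /eqP : r2 * g = 0 by apply: meval_eq0 => y; case: (key y).
  by rewrite mulf_eq0 (negbTE r2nz) => /eqP.
apply: fip_eq0; rewrite {1}pE f0 g0 mulr0 !addr0 /rad2 mulr_suml fip_suml.
under eq_bigr => j _ do rewrite -mulrA !fip_mulX.
by rewrite -fip_sumr plap fip0r.
Qed.
End ComplexEval.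

(** * Highest weight vectors *)

Section HighestWeight.
Variables (R : realType) (m : nat) (a b : 'I_m).
Hypothesis ab : a != b.
Local Notation CP := (Defs.CP R m).
Local Notation pderiv := (Defs.pderiv R m).
Local Notation Psk := (Defs.Psk R m).
Local Notation Hsk := (Defs.Hsk R m).
Local Notation MP := {mpoly R[m]}.
Local Notation rc := (real_complex R).
Implicit Types (f g p q : MP) (j l : 'I_m) (A B C : {set 'I_m}) (P Q : CP) (s k n : nat).

(** The real and imaginary parts of (x_a + i x_b)^n. *)
Fixpoint zpow n : MP * MP :=
  if n is n'.+1 then ('X_a * (zpow n').1 - 'X_b * (zpow n').2,
                      'X_a * (zpow n').2 + 'X_b * (zpow n').1) else (1, 0).
Definition zre n := (zpow n).1.
Definition zim n := (zpow n).2.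

Lemma zreS n : zre n.+1 = 'X_a * zre n - 'X_b * zim n. Proof. by []. Qed.
Lemma zimS n : zim n.+1 = 'X_a * zim n + 'X_b * zre n. Proof. by []. Qed.

Lemma zpow_homog n : zre n \is n.-homog /\ zim n \is n.-homog.
Proof.
elim: n => [|n [IH1 IH2]]; first by split; [exact: dhomog1|exact: dhomog0].
rewrite zreS zimS; split; last by apply: dhomogD; apply: mulX_homog.
by rewrite -mulN1r -mpolyC1 -mpolyCN mul_mpolyC; apply: dhomogD; rewrite ?dhomogZ //; apply: mulX_homog.
Qed.

Lemma mderiv_zpow n :
  [/\ (zre n)^`M(a) = n%:R *: zre n.-1, (zim n)^`M(a) = n%:R *: zim n.-1,
      (zre n)^`M(b) = - (n%:R *: zim n.-1) & (zim n)^`M(b) = n%:R *: zre n.-1].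
Proof.
elim: n => [|n [IH1 IH2 IH3 IH4]].
  by rewrite /zre /zim /= -mpolyC1 !mderivC ?mderiv0 !scale0r oppr0; split.
rewrite zreS zimS !(mderivB, mderivD) !mderivX1 IH1 IH2 IH3 IH4 !eqxx ?(eq_sym b a) ?(negbTE ab) /=.
rewrite !mulr0n !mulr1n.
case: n {IH1 IH2 IH3 IH4} => [|n].
  by rewrite !scale0r !scale1r; split; ring.
rewrite /= !zreS !zimS -!mul_mpolyC [n.+2%:R]mulrS !mpolyCD mpolyC1.
by split; ring.
Qed.

Lemma mderiv_zpow_other n j : j != a -> j != b -> (zre n)^`M(j) = 0 /\ (zim n)^`M(j) = 0.
Proof.
move=> ja jb; elim: n => [|n [IH1 IH2]].
  by rewrite /zre /zim /= -mpolyC1 !mderivC ?mderiv0; split.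
rewrite zreS zimS !(mderivB, mderivD) !mderivX1 IH1 IH2 (negbTE ja) (negbTE jb).
by rewrite !mulr0n !mulr0 !addr0 subr0.
Qed.

(** The null vector e_a + i e_b, written in the shape of the test points of [null_cone_harmonic]. *)
Definition zeta j : R[i] := rc (basisv R a j) + 'i * (j == b)%:R.

Lemma zetaE : [/\ zeta a = 1, zeta b = 'i & forall j, j != a -> j != b -> zeta j = 0].
Proof.
rewrite /zeta /basisv !eqxx ?(eq_sym b a) !(negbTE ab) !mulr0 mulr1 addr0 add0r.
by split=> // j /negbTE -> /negbTE ->; rewrite mulr0 addr0.
Qed.

(** Reproducing property of the Fischer product: pairing with the n-th power of a linear form
    evaluates at its coefficient vector, up to n!. The induction uses Euler's identity at [zeta]. *)
Lemma fip_zpow n f : f \is n.-homog ->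
  rc (fip f (zre n)) + 'i * rc (fip f (zim n)) = n`!%:R * ceval zeta f.
Proof.
have [za zb zj] := zetaE.
elim: n f => [|n IH] f fn.
  rewrite /zre /zim /= fip0r rmorph0 mulr0 addr0 fact0 mul1r -mpolyX0 fipC fipX.
  have -> : mfact (0%MM : 'X_{1..m}) = 1%N by rewrite /mfact big1 // => i _; rewrite mnm0E.
  have {2}-> : f = (f@_0)%:MP; last by rewrite cevalC mulr1n.
  apply/mpolyP=> mm; rewrite mcoeffC; have [->|m0] := eqVneq mm 0%MM; first by rewrite mulr1.
  by rewrite mulr0 (dhomog_nemf_coeff fn) // mdeg_eq0.
have eul : n.+1%:R * ceval zeta f = ceval zeta f^`M(a) + 'i * ceval zeta f^`M(b).
  have := congr1 (ceval zeta) (euler_homog fn).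
  rewrite -scaler_nat cevalZ rmorph_nat ceval_sum => <-.
  rewrite (bigD1 a) //= (bigD1 b) 1?eq_sym //= !cevalM !cevalX za zb mul1r big1 ?addr0 //.
  by move=> j /andP[ja jb]; rewrite cevalM cevalX zj ?mul0r.
rewrite factS mulnC natrM -mulrA eul mulrDr mulrCA -!IH; try exact: mderiv_homog fn.
rewrite zreS zimS fipDr fipDr fipNr !(fipC f) !fip_mulX !(fipC _ (f^`M(_))).
rewrite !(rmorphD, rmorphN) /= !mulrDr.
by rewrite [in RHS]mulrA -expr2 sqr_i mulN1r; ring.
Qed.

Definition blade_vec A : CP := [ffun B : {set 'I_m} => (B == A)%:R].

(* Real and imaginary parts of the highest weight vector
   (x_a + i x_b)^k (e_a + i e_b) e_A. *)
Definition wre k A : CP := pmul (zre k) (ext a (blade_vec A)) - pmul (zim k) (ext b (blade_vec A)).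
Definition wim k A : CP := pmul (zim k) (ext a (blade_vec A)) + pmul (zre k) (ext b (blade_vec A)).

Lemma zpow0 : zre 0 = 1 /\ zim 0 = 0. Proof. by []. Qed.
Lemma wreE k A : wre k A =
  pmul (zre k) (ext a (blade_vec A)) - pmul (zim k) (ext b (blade_vec A)).
Proof. by []. Qed.
Lemma wimE k A : wim k A =
  pmul (zim k) (ext a (blade_vec A)) + pmul (zre k) (ext b (blade_vec A)).
Proof. by []. Qed.

Lemma ctr_blade j A : j \notin A -> ctr j (blade_vec A) = 0.
Proof.
move=> jA; apply/ffunP=> C; rewrite !ffunE; case: ifP => // jC.
case: eqP => [E|]; last by rewrite bneg0.
by move: jA; rewrite -E setU11.
Qed.

Lemma pderiv_blade j A : pderiv j (blade_vec A) = 0.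
Proof. by apply/ffunP=> C; rewrite !ffunE; case: (_ == _); rewrite ?mderiv0 // -mpolyC1 mderivC. Qed.

Lemma pderiv_pmul_blade j l f A :
  pderiv j (pmul f (ext l (blade_vec A))) = pmul f^`M(j) (ext l (blade_vec A)).
Proof.
have : pderiv j (ext l (blade_vec A)) = 0 by rewrite -ext_pderiv pderiv_blade raddf0.
move: (ext l _) => E /ffunP E0; apply/ffunP=> C; rewrite !ffunE mderivM.
by have := E0 C; rewrite !ffunE => ->; rewrite mulr0 addr0.
Qed.

Lemma pmulNl f P : pmul (- f) P = - pmul f P.
Proof. by apply/ffunP=> C; rewrite !ffunE mulNr. Qed.
Lemma pmulZl c f P : pmul (c *: f) P = c *: pmul f P.
Proof. by apply/ffunP=> C; rewrite !ffunE scalerAl. Qed.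
Lemma pmul0l P : pmul 0 P = 0.
Proof. by apply/ffunP=> C; rewrite !ffunE mul0r. Qed.

Section Blade.
Variable A : {set 'I_m}.
Hypotheses (aA : a \notin A) (bA : b \notin A).

Lemma Psk_blade : Psk #|A| 0 (blade_vec A).
Proof.
apply/PskP; split=> C; rewrite ffunE; last by case: (_ == _); rewrite ?dhomog0 // dhomog1.
by have [->|] := eqVneq C A; rewrite ?eqxx.
Qed.
Lemma Psk_pmul s k n f P : f \is n.-homog -> Psk s k P -> Psk s (n + k) (pmul f P).
Proof.
move=> fn /PskP[P1 P2]; apply/PskP; split=> C; rewrite ffunE; last exact: dhomogM.
by move/P1 ->; rewrite mulr0.
Qed.

Lemma Psk_w k : Psk #|A|.+1 k (wre k A) /\ Psk #|A|.+1 k (wim k A).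
Proof.
have [h1 h2] := zpow_homog k.
have H f l : f \is k.-homog -> Psk #|A|.+1 k (pmul f (ext l (blade_vec A))).
  by move=> fk; have := Psk_pmul fk (Psk_ext l Psk_blade); rewrite addn0.
by split; [apply: PskB|apply: PskD]; apply: H.
Qed.

Lemma pderiv_w k :
  [/\ pderiv a (wre k A) = k%:R *: wre k.-1 A, pderiv a (wim k A) = k%:R *: wim k.-1 A,
      pderiv b (wre k A) = - (k%:R *: wim k.-1 A) & pderiv b (wim k A) = k%:R *: wre k.-1 A].
Proof.
have [e1 e2 e3 e4] := mderiv_zpow k.
rewrite /wre /wim !(raddfB, raddfD) /= !pderiv_pmul_blade e1 e2 e3 e4.
rewrite !(pmulNl, pmulZl).
by split; rewrite // opprD.
Qed.
Lemma pderiv_w_other k j : j != a -> j != b -> pderiv j (wre k A) = 0 /\ pderiv j (wim k A) = 0.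
Proof.
move=> ja jb; have [e1 e2] := mderiv_zpow_other k ja jb.
by rewrite /wre /wim !(raddfB, raddfD) /= !pderiv_pmul_blade e1 e2 !pmul0l subr0 addr0.
Qed.

Lemma ctr_w k : [/\ ctr a (wre k A) = pmul (zre k) (blade_vec A),
  ctr b (wre k A) = - pmul (zim k) (blade_vec A),
  ctr a (wim k A) = pmul (zim k) (blade_vec A) & ctr b (wim k A) = pmul (zre k) (blade_vec A)].
Proof.
rewrite /wre /wim !(raddfB, raddfD) /= !ctr_pmul !ctr_ext_comm !eqxx ?(eq_sym b a) !(negbTE ab).
by rewrite !ctr_blade //= !(mulr0n, mulr1n, raddf0, addr0, add0r).
Qed.
Lemma ext_w k : ext a (wre k A) = ext b (wim k A) /\ ext b (wre k A) = - ext a (wim k A).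
Proof.
rewrite /wre /wim !(raddfB, raddfD) /= !ext_pmul !ext_sq !(raddf0, addr0, add0r).
by rewrite (extext a b); split; rewrite !raddfN ?opprK.
Qed.

Lemma extd_ab P : (forall j, j != a -> j != b -> pderiv j P = 0) ->
  extd P = ext a (pderiv a P) + ext b (pderiv b P).
Proof.
move=> H; rewrite /extd (bigD1 a) //= (bigD1 b) 1?eq_sym //= big1 ?addr0 ?ext_pderiv //.
by move=> j /andP[ja jb]; rewrite -ext_pderiv H ?raddf0.
Qed.
Lemma ctrd_ab P : (forall j, j != a -> j != b -> pderiv j P = 0) ->
  ctrd P = ctr a (pderiv a P) + ctr b (pderiv b P).
Proof.
move=> H; rewrite /ctrd (bigD1 a) //= (bigD1 b) 1?eq_sym //= big1 ?addr0 ?ctr_pderiv //.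
by move=> j /andP[ja jb]; rewrite -ctr_pderiv H ?raddf0.
Qed.

Lemma Hsk_w k : Hsk #|A|.+1 k (wre k A) /\ Hsk #|A|.+1 k (wim k A).
Proof.
have [H1 H2] := Psk_w k.
have [d1 d2 d3 d4] := pderiv_w k.
have [e1 e2] := ext_w k.-1.
have [c1 c2 c3 c4] := ctr_w k.-1.
have o1 j ja jb := (pderiv_w_other k (j := j) ja jb).1.
have o2 j ja jb := (pderiv_w_other k (j := j) ja jb).2.
split; apply/HskP; split; [exact: H1| | |exact: H2| |].
- by rewrite extd_ab // d1 d3 raddfN /= !ext_is_scalable e1 subrr.
- by rewrite ctrd_ab // d1 d3 raddfN /= !ctr_is_scalable c1 c4 subrr.
- by rewrite extd_ab // d2 d4 /= !ext_is_scalable e2 scalerN subrr.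
- by rewrite ctrd_ab // d2 d4 /= !ctr_is_scalable c2 c3 scalerN subrr.
Qed.

(** The polynomial factor contributes k to the weight and the vector e_a + i e_b contributes 1. *)
Lemma lrot_w k : lrot a b (wre k A) = - (k.+1%:R *: wim k A) /\
  lrot a b (wim k A) = k.+1%:R *: wre k A.
Proof.
have [d1 d2 d3 d4] := pderiv_w k.
have [c1 c2 c3 c4] := ctr_w k.
have mZ j c Q : mulx j (c *: Q) = c *: mulx j Q by exact: pmul_is_scalable.
have o1 : mulx a (pderiv b (wre k A)) - mulx b (pderiv a (wre k A)) = - (k%:R *: wim k A).
  rewrite d1 d3 raddfN /= !mZ -opprD -scalerDr.
  case: k {d1 d2 d3 d4 c1 c2 c3 c4} => [|k]; first by rewrite !scale0r.
  congr (- (_ *: _)); rewrite /wre /wim zimS zreS /=.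
  move: (ext a _) (ext b _) (zre k) (zim k) => ea eb u v.
  by apply/ffunP=> C; rewrite !ffunE; ring.
have o2 : mulx a (pderiv b (wim k A)) - mulx b (pderiv a (wim k A)) = k%:R *: wre k A.
  rewrite d2 d4 !mZ -scalerBr.
  case: k {d1 d2 d3 d4 c1 c2 c3 c4 o1} => [|k]; first by rewrite !scale0r.
  congr (_ *: _); rewrite /wre /wim zimS zreS /=.
  move: (ext a _) (ext b _) (zre k) (zim k) => ea eb u v.
  by apply/ffunP=> C; rewrite !ffunE; ring.
rewrite /lrot o1 o2 c1 c2 c3 c4 raddfN /= !ext_pmul [k.+1%:R]mulrS !scalerDl !scale1r.
rewrite /wre /wim; move: (ext a _) (ext b _) (zre k) (zim k) => ea eb u v.
by split; apply/ffunP=> C; rewrite !ffunE -!mul_mpolyC; ring.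
Qed.

Lemma ip_blade P f : ip P (pmul f (blade_vec A)) = fip (P A) f.
Proof.
rewrite /ip (bigD1 A) //= !ffunE eqxx mulr1 big1 ?addr0 // => C /negbTE CA.
by rewrite !ffunE CA mulr0 fip0r.
Qed.

(** The factor e_a + i e_b moves across as a contraction, and the polynomial factor then evaluates
    the A-coefficient at [zeta]. *)
Lemma pairing_w s k P : Psk s k P ->
  rc (ip P (wre k A)) + 'i * rc (ip P (wim k A)) =
  k`!%:R * (ceval zeta (ctr a P A) + 'i * ceval zeta (ctr b P A)).
Proof.
move=> HP.
have E c f : ip P (pmul f (ext c (blade_vec A))) = fip (ctr c P A) f.
  by rewrite -ext_pmul ipC ip_ext ipC ip_blade.
rewrite /wre /wim ipBr ipDr !E.
have [_ Pa] := Psk_ctr a HP; have [_ Pb] := Psk_ctr b HP.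
rewrite mulrDr mulrCA -!fip_zpow; [|exact: Pb|exact: Pa].
rewrite !(rmorphB, rmorphD) /= !mulrDr.
by rewrite [in RHS]mulrA -expr2 sqr_i mulN1r; ring.
Qed.

Lemma w_neq0 k : wre k A != 0.
Proof.
apply/eqP => w0; have [c1 _ _ _] := ctr_w k.
move: c1; rewrite w0 raddf0 => /ffunP/(_ A); rewrite !ffunE eqxx mulr1 => /esym z0.
have : (zre k).@[basisv R a] = 1 /\ (zim k).@[basisv R a] = 0.
  elim: (k) => [|n [IH1 IH2]]; first by rewrite /zre /zim /= meval1 meval0.
  rewrite zreS zimS mevalB mevalD !mevalM !mevalXU IH1 IH2 /basisv eqxx ?(eq_sym b a) ?(negbTE ab).
  by rewrite !mulr0 !mulr1 !addr0 subr0.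
by rewrite z0 meval0 => -[/eqP]; rewrite eq_sym oner_eq0.
Qed.
End Blade.
End HighestWeight.

(** * The weight bound k + 1 and the vectors that attain it *)

Section WeightSpace.
Variables (R : realType) (m : nat) (a b : 'I_m).
Hypothesis ab : a != b.
Local Notation CP := (Defs.CP R m).
Local Notation pderiv := (Defs.pderiv R m).
Local Notation Psk := (Defs.Psk R m).
Local Notation MP := {mpoly R[m]}.
Local Notation L := (lrot a b).
Local Notation zre := (@zre R m a b).
Local Notation zim := (@zim R m a b).
Local Notation wre := (@wre R m a b).
Local Notation wim := (@wim R m a b).
Implicit Types (f g p q : MP) (j l : 'I_m) (A B C : {set 'I_m}) (P Q : CP) (s k n : nat).

Lemma ip_mulxr j P Q : ip P (mulx j Q) = ip (pderiv j P) Q.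
Proof. by rewrite ipC ip_mulx ipC. Qed.
Lemma ip_extr j P Q : ip P (ext j Q) = ip (ctr j P) Q.
Proof. by rewrite ipC ip_ext ipC. Qed.

Lemma lrot_skew P Q : ip (L P) Q = - ip P (L Q).
Proof.
rewrite /lrot !(ipDl, ipDr, ipNl, ipNr) !ip_mulx !ip_mulxr !ip_ext !ip_extr.
by ring.
Qed.

Lemma sum_pderiv_sq s k P : Psk s k P -> \sum_j ip (pderiv j P) (pderiv j P) = k%:R * ip P P.
Proof.
move=> HP; under eq_bigr => j _ do rewrite -ip_mulxr.
by rewrite -ip_sumr -/(euler P) (euler_Psk HP) -scaler_nat ipZr.
Qed.
Lemma ext_ctr_sq j P : ip (ext j P) (ext j P) + ip (ctr j P) (ctr j P) = ip P P.
Proof. by rewrite ip_ext -ip_extr -ipDr addrC extctr_id. Qed.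

(* For an eigenvector P + iQ of the rotation generator in the (a, b)-plane, with
   eigenvalue of modulus mu, the defect k + 1 - mu is a sum of squares. *)
Lemma weight_identity s k mu P Q : Psk s k P -> Psk s k Q ->
  L P = - (mu *: Q) -> L Q = mu *: P ->
  let n2 X := ip X X in
  n2 (pderiv a P - pderiv b Q) + n2 (pderiv b P + pderiv a Q)
  + \sum_(j | (j != a) && (j != b)) (n2 (pderiv j P) + n2 (pderiv j Q))
  + 2^-1 * (n2 (ext a P - ext b Q) + n2 (ext b P + ext a Q)
          + n2 (ctr a P - ctr b Q) + n2 (ctr b P + ctr a Q))
  = (k%:R + 1 - mu) * (n2 P + n2 Q).
Proof.
move=> HP HQ LP LQ n2.
have n2B X Y : n2 (X - Y) = n2 X + n2 Y - 2 * ip X Y.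
  by rewrite /n2 !(ipDl, ipDr, ipNl, ipNr) (ipC Y X); ring.
have n2D X Y : n2 (X + Y) = n2 X + n2 Y + 2 * ip X Y.
  by rewrite /n2 !(ipDl, ipDr) (ipC Y X); ring.
have eP := sum_pderiv_sq HP; have eQ := sum_pderiv_sq HQ.
rewrite (bigD1 a) //= (bigD1 b) 1?eq_sym //= in eP.
rewrite (bigD1 a) //= (bigD1 b) 1?eq_sym //= in eQ.
have xa := ext_ctr_sq a P; have xb := ext_ctr_sq b P.
have ya := ext_ctr_sq a Q; have yb := ext_ctr_sq b Q.
have skew := lrot_skew P Q; rewrite LP LQ ipNl ipZl ipZr in skew.
have cross : mu * n2 P = ip (pderiv a P) (pderiv b Q) - ip (pderiv b P) (pderiv a Q)
    + (ip (ctr a P) (ctr b Q) - ip (ctr b P) (ctr a Q)).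
  by rewrite -ipZr -LQ /lrot !(ipDr, ipNr) !ip_mulxr !ip_extr.
have c3 : ip (ext a P) (ext b Q) = - ip (ctr b P) (ctr a Q).
  by rewrite ip_ext ctr_ext_comm (negbTE ab) mulr0n sub0r ipNr ip_extr.
have c4 : ip (ext b P) (ext a Q) = - ip (ctr a P) (ctr b Q).
  by rewrite ip_ext ctr_ext_comm eq_sym (negbTE ab) mulr0n sub0r ipNr ip_extr.
rewrite !n2B !n2D big_split /= c3 c4 -/(n2 Q) -/(n2 P) in eP eQ xa xb ya yb skew cross *.
rewrite -!/(n2 _) in eP eQ xa xb ya yb *.
have -> : (k%:R + 1 - mu) * (n2 P + n2 Q) =
    k%:R * n2 P + k%:R * n2 Q + n2 P + n2 Q - mu * n2 P - mu * n2 Q.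
  by ring.
rewrite -eP -eQ.
have -> : mu * n2 Q = mu * n2 P by apply: oppr_inj.
rewrite cross.
by move: xa xb ya yb; lra.
Qed.

Lemma weight_gt s k mu P Q : Psk s k P -> Psk s k Q ->
  L P = - (mu *: Q) -> L Q = mu *: P -> k.+1%:R < mu -> P = 0.
Proof.
move=> HP HQ LP LQ kmu; have := weight_identity HP HQ LP LQ.
move=> /= E; apply: ip_eq0; apply/eqP; rewrite eq_le ip_ge0 andbT.
have lhs0 : 0 <= (k%:R + 1 - mu) * (ip P P + ip Q Q).
  rewrite -E; apply: addr_ge0; first do ?apply: addr_ge0; rewrite ?ip_ge0 //.
    by apply: sumr_ge0 => j _; apply: addr_ge0; apply: ip_ge0.
  by apply: mulr_ge0; rewrite ?invr_ge0 //; do ?apply: addr_ge0; rewrite ?ip_ge0.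
have neg : k%:R + 1 - mu < 0 by rewrite subr_lt0 natr1.
rewrite nmulr_rge0 // in lhs0.
by apply: le_trans lhs0; rewrite lerDl ip_ge0.
Qed.

(** Equality case of [weight_identity]: the sum of squares is 0. The derivative relations are the
    Cauchy-Riemann equations for P + iQ. *)
Lemma weight_eq s k P Q : Psk s k P -> Psk s k Q ->
  L P = - (k.+1%:R *: Q) -> L Q = k.+1%:R *: P ->
  [/\ pderiv a P = pderiv b Q, pderiv b P = - pderiv a Q,
      forall j, j != a -> j != b -> pderiv j P = 0 /\ pderiv j Q = 0,
      ext a P = ext b Q & ctr a P = ctr b Q /\ ctr b P = - ctr a Q].
Proof.
move=> HP HQ LP LQ; have := weight_identity HP HQ LP LQ => /=.
rewrite natr1 subrr mul0r.
set S := \sum_(j | _) _.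
have S0 : 0 <= S by apply: sumr_ge0 => j _; apply: addr_ge0; apply: ip_ge0.
have p1 := ip_ge0 (pderiv a P - pderiv b Q).
have p2 := ip_ge0 (pderiv b P + pderiv a Q).
have p3 := ip_ge0 (ext a P - ext b Q).
have p4 := ip_ge0 (ext b P + ext a Q).
have p5 := ip_ge0 (ctr a P - ctr b Q).
have p6 := ip_ge0 (ctr b P + ctr a Q).
move=> E.
have z1 : ip (pderiv a P - pderiv b Q) (pderiv a P - pderiv b Q) = 0 by lra.
have z2 : ip (pderiv b P + pderiv a Q) (pderiv b P + pderiv a Q) = 0 by lra.
have z3 : ip (ext a P - ext b Q) (ext a P - ext b Q) = 0 by lra.
have z5 : ip (ctr a P - ctr b Q) (ctr a P - ctr b Q) = 0 by lra.
have z6 : ip (ctr b P + ctr a Q) (ctr b P + ctr a Q) = 0 by lra.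
have zS : S = 0 by lra.
move: z1 z2 z3 z5 z6 => /ip_eq0/eqP; rewrite subr_eq0 => /eqP z1.
move=> /ip_eq0/eqP; rewrite addr_eq0 => /eqP z2.
move=> /ip_eq0/eqP; rewrite subr_eq0 => /eqP z3.
move=> /ip_eq0/eqP; rewrite subr_eq0 => /eqP z5.
move=> /ip_eq0/eqP; rewrite addr_eq0 => /eqP z6.
split=> // j ja jb.
move/eqP: zS; rewrite psumr_eq0 => [|l _]; last by apply: addr_ge0; apply: ip_ge0.
move=> /allP/(_ j (mem_index_enum j)); rewrite ja jb /= paddr_eq0 ?ip_ge0 //.
by move=> /andP[/eqP/ip_eq0 -> /eqP/ip_eq0 ->].
Qed.

Lemma homog0_const (f : MP) : f \is 0.-homog -> f = (f@_0)%:MP.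
Proof.
move=> f0; apply/mpolyP=> mm; rewrite mcoeffC.
have [->|m0] := eqVneq mm 0%MM; first by rewrite mulr1.
by rewrite mulr0 (dhomog_nemf_coeff f0) // mdeg_eq0.
Qed.

(** f + i g is holomorphic and homogeneous in x_a + i x_b, hence x + i y times its k-th power. *)
Lemma cauchy_riemann k f g : f \is k.-homog -> g \is k.-homog ->
  f^`M(a) = g^`M(b) -> f^`M(b) = - g^`M(a) ->
  (forall j, j != a -> j != b -> f^`M(j) = 0 /\ g^`M(j) = 0) ->
  exists x y, f = x *: zre k - y *: zim k /\ g = x *: zim k + y *: zre k.
Proof.
elim: k f g => [|k IH] f g fk gk fa fb fj.
  exists (f@_0), (g@_0); have [z0 z1] := zpow0 R a b; rewrite z0 z1 !scaler0 subr0 add0r.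
  by rewrite {1}(homog0_const fk) {1}(homog0_const gk) -!mul_mpolyC !mulr1.
have [||||j ja jb|x [y [ex ey]]] := IH f^`M(a) g^`M(a).
- exact: mderiv_homog fk.
- exact: mderiv_homog gk.
- by rewrite fa mderiv_comm.
- by rewrite mderiv_comm fb mderivN.
- have [f0 g0] := fj j ja jb.
  by rewrite !(mderiv_comm a j) f0 g0 !mderiv0.
have eul (h : MP) : h \is k.+1.-homog -> (forall j, j != a -> j != b -> h^`M(j) = 0) ->
    h = k.+1%:R^-1 *: ('X_a * h^`M(a) + 'X_b * h^`M(b)).
  move=> hk hj; have := euler_homog hk.
  rewrite (bigD1 a) //= (bigD1 b) 1?eq_sym //= big1 ?addr0 => [->|j /andP[ja jb]].
    by rewrite -scaler_nat scalerA mulVf ?scale1r // pnatr_eq0.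
  by rewrite hj ?mulr0.
exists (k.+1%:R^-1 * x), (k.+1%:R^-1 * y).
rewrite {1}(eul f fk) => [|j ja jb]; last by case: (fj j ja jb).
rewrite {1}(eul g gk) => [|j ja jb]; last by case: (fj j ja jb).
rewrite fb -fa ex ey zreS zimS -!scalerA -scalerBr -scalerDr.
by split; congr (_ *: _); rewrite -!mul_mpolyC; ring.
Qed.

(** The substitution fixes x_j and negates every other variable, and f does not involve x_j. *)
Lemma comp_refl_basis j k f : f \is k.-homog -> f^`M(j) = 0 ->
  f \mPo lintup (reflmx (basisv R j)) = (-1) ^+ k *: f.
Proof.
move=> fk fj; rewrite -{2}(comp_mpoly_id f) -(comp_mpoly_scale _ _ fk).
rewrite (comp_mpolyEX f (lintup _)) [RHS]comp_mpolyEX [LHS]big_seq [RHS]big_seq.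
apply: eq_bigr => mm mf; congr (_ *: _).
rewrite !comp_mpolyX; apply: eq_bigr => i _; rewrite !tnth_mktuple.
have [->|ij] := eqVneq i j.
  have -> : mm j = 0%N; last by rewrite !expr0.
  apply/eqP; apply: contraTT mf => mj; rewrite -lt0n in mj.
  have mE : mm = ((mm - U_(j)) + U_(j))%MM.
    by rewrite submK //; apply/mnm_lepP=> l; rewrite mnm1E; case: eqP => [<-|].
  have := congr1 (mcoeff (mm - U_(j))%MM) fj.
  rewrite mcoeff_deriv -mE mcoeff0 => /eqP; rewrite mulrn_eq0 /= => /eqP c0.
  by rewrite mcoeff_msupp c0 eqxx.
congr (_ ^+ _); rewrite (eq_bigr (fun l => - ((i == l)%:R *: 'X_l))); last first.
  move=> l _; rewrite /reflmx nsq_basisv /basisv (negbTE ij) mul0r mulr0 sub0r mul1r.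
  by rewrite scaleNr.
by rewrite sumrN (sum_delta _ (l := i)) ?scaleN1r // => l; rewrite eq_sym.
Qed.

Lemma reft_basisv s k j P : Psk s k P -> pderiv j P = 0 ->
  reft (basisv R j) P = (-1) ^+ (s + k) *: [ffun C : {set 'I_m} => bneg (j \in C) (P C)].
Proof.
move=> HP Pj; rewrite /reft.
have -> : csub (lintup (reflmx (basisv R j))) P = (-1) ^+ k *: P.
  have [_ P2] := (PskP _ _ _).1 HP.
  apply/ffunP=> C; rewrite ffunE (comp_refl_basis (P2 C)) ?ffunE //.
  by move/ffunP: Pj => /(_ C); rewrite !ffunE.
rewrite ginv_is_scalable reflv_scal (Psk_ginv HP) reflv_scal scalerA -exprD addnC.
congr (_ *: _); apply/ffunP=> C.
have -> : reflv (basisv R j) P = P - 2 *: ext j (ctr j P).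
  by rewrite /reflv nsq_basisv scale1r extv_basisv ctrv_basisv.
rewrite [RHS]ffunE -[LHS]/((P - 2 *: ext j (ctr j P)) C).
have -> : (P - 2 *: ext j (ctr j P)) C = P C - 2 *: (ext j (ctr j P) C) by rewrite !ffunE.
rewrite ext_ctrE; case: ifP => _; last by rewrite scaler0 subr0.
by rewrite scaler_nat mulr2n opprD addrA subrr sub0r.
Qed.

Lemma ext_bladeE l A C :
  ext l (blade_vec R A) C = if (l \in C) && (C :\ l == A) then bneg (lowpar l C) 1 else 0.
Proof. by rewrite !ffunE; case: (l \in C); case: eqP; rewrite //= bneg0. Qed.

Section Pattern.
Variable A : {set 'I_m}.
Hypotheses (aA : a \notin A) (bA : b \notin A).

Lemma w_support k C : ~~ [|| C == a |: A | C == b |: A] -> wre k A C = 0 /\ wim k A C = 0.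
Proof.
rewrite negb_or => /andP[Ca Cb].
have E l : l \notin A -> C != l |: A -> ext l (blade_vec R A) C = 0.
  move=> lA Cl; rewrite ext_bladeE; case: (boolP (l \in C)) => //= lC.
  by case: eqP => // EC; case/eqP: Cl; rewrite -EC setD1K.
have Z : ext a (blade_vec R A) C = 0 /\ ext b (blade_vec R A) C = 0 by split; apply: E.
move: Z; rewrite wreE wimE; move: (ext a _) (ext b _) => ea eb [Ea Eb].
by rewrite !ffunE Ea Eb !mulr0 subr0 addr0.
Qed.

Lemma sign_w k j : j != a -> j != b ->
  [ffun C : {set 'I_m} => bneg (j \in C) (wre k A C)] = (-1) ^+ (j \in A) *: wre k A.
Proof.
move=> ja jb; apply/ffunP=> C; rewrite [LHS]ffunE -[RHS]/((_ *: wre k A) C).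
have -> : ((-1) ^+ (j \in A) *: wre k A) C = (-1) ^+ (j \in A) *: (wre k A C) by rewrite ffunE.
rewrite scaler_sign -/(bneg _ _).
have [/orP[]/eqP->|/(w_support k)[-> _]] := boolP [|| C == a |: A | C == b |: A].
- by rewrite !inE (negbTE ja).
- by rewrite !inE (negbTE jb).
- by rewrite !bneg0.
Qed.

(** The sign pattern leaves only blades that agree with A outside {a, b}. Those containing both or
    neither of a and b are excluded by [weight_eq], and [cauchy_riemann] determines the two
    remaining coefficients. *)
Lemma weight_vector_pattern s k P Q : Psk s k P -> Psk s k Q ->
  L P = - (k.+1%:R *: Q) -> L Q = k.+1%:R *: P ->
  (forall C j, j != a -> j != b -> (j \in C) != (j \in A) -> P C = 0) ->
  exists x y, P = x *: wre k A - y *: wim k A /\ Q = x *: wim k A + y *: wre k A.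
Proof.
move=> HP HQ LP LQ pat.
have [Pa Pb Pj exPQ [ctPQ ctPQ']] := weight_eq HP HQ LP LQ.
have [_ UP] := (PskP _ _ _).1 (Psk_ctr a HP).
have [_ UQ] := (PskP _ _ _).1 (Psk_ctr a HQ).
have cd j X : (ctr a X A)^`M(j) = ctr a (pderiv j X) A by rewrite ctr_pderiv [RHS]ffunE.
have [||j ja jb|x [y [eU eV]]] := cauchy_riemann (UP A) (UQ A).
- by rewrite !cd Pa.
- by rewrite !cd Pb raddfN ffunE.
- have [P0 Q0] := Pj j ja jb.
  by rewrite !cd P0 Q0 !raddf0 ffunE.
have PE : P = x *: wre k A - y *: wim k A.
  have -> : x *: wre k A - y *: wim k A =
     pmul (ctr a P A) (ext a (blade_vec R A)) + pmul (ctr b P A) (ext b (blade_vec R A)).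
    have -> : ctr b P A = - ctr a Q A by rewrite ctPQ' ffunE.
    rewrite eU eV wreE wimE; move: (ext a _) (ext b _) (zre k) (zim k) => ea eb u v.
    by apply/ffunP=> C; rewrite !ffunE -!mul_mpolyC; ring.
  apply/ffunP=> C.
  have -> : (pmul (ctr a P A) (ext a (blade_vec R A)) + pmul (ctr b P A) (ext b (blade_vec R A))) C
    = ctr a P A * ext a (blade_vec R A) C + ctr b P A * ext b (blade_vec R A) C.
    by move: (ext a (blade_vec R A)) (ext b (blade_vec R A)) => ea eb; rewrite !ffunE.
  rewrite !ext_bladeE.
  have inB l : l \notin A -> l \in C -> P C = (if C :\ l == A then ctr l P A * bneg (lowpar l C) 1 else 0)
     \/ exists2 j, j != l & (j \in C) != (j \in A).
    move=> lA lC; case: eqP => [EC|NC].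
      left; rewrite ctrE (negbTE lA) -EC setD1K // lowparD1 ltnn andbF addbF.
      by rewrite bnegMl bnegMr mulr1 bneg_bneg addbb.
    right; have /existsP[j] : [exists j, (j \in C :\ l) != (j \in A)].
      apply: contra_notT NC => /existsPn H; apply/setP=> j.
      by apply/eqP; have := H j; rewrite negbK.
    rewrite !inE; have [->|jl] /= := eqVneq j l; first by rewrite (negbTE lA).
    by move=> H; exists j.
  (* Both indices in C: the relation between contractions, read at C without a, kills P C. Neither:
     the relation between exterior products, read at C with a added, does so. *)
  have [aC|aC] := boolP (a \in C); have [bC|bC] := boolP (b \in C).
  - have nE l l' : l != l' -> l' \in C -> l' \notin A -> (C :\ l == A) = false.
      move=> ll' l'C l'A; apply/negbTE; apply: contra l'A => /eqP <-.
      by rewrite !inE l'C eq_sym ll'.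
    rewrite /= (nE a b) // (nE b a) 1?eq_sym // !mulr0 addr0.
    have := congr1 (fun X : CP => X (C :\ a)) ctPQ; rewrite /= !ctrE !inE eqxx bC eq_sym ab /=.
    by rewrite setD1K //; case: lowpar => //= /eqP; rewrite oppr_eq0 => /eqP.
  - rewrite /= mulr0 addr0; case: (inB a aA aC) => [->|[j ja jC]].
      by case: ifP; rewrite ?mulr0.
    have jb : j != b.
      by apply: contraNneq jC => ->; rewrite (negbTE bC) (negbTE bA).
    rewrite (pat C j) //; case: eqP => [EC|]; last by rewrite mulr0.
    by move: jC; rewrite -EC !inE ja eqxx.
  - rewrite /= mulr0 add0r; case: (inB b bA bC) => [->|[j jb jC]].
      by case: ifP; rewrite ?mulr0.
    have ja : j != a.
      by apply: contraNneq jC => ->; rewrite (negbTE aC) (negbTE aA).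
    rewrite (pat C j) //; case: eqP => [EC|]; last by rewrite mulr0.
    by move: jC; rewrite -EC !inE jb eqxx.
  - rewrite /= !mulr0 addr0.
    have := congr1 (fun X : CP => X (a |: C)) exPQ; rewrite /= !extE !inE eqxx /=.
    rewrite [b == a]eq_sym (negbTE ab) (negbTE bC) setU1K //.
    by case: lowpar => //= /eqP; rewrite oppr_eq0 => /eqP.
exists x, y; split=> //.
have [l1 l2] := lrot_w R ab aA bA k.
have k0 : k.+1%:R != 0 :> R by rewrite pnatr_eq0.
(* Q is recovered from P, being -1/(k + 1) times the image of P under the rotation generator. *)
apply: (scalerI k0); apply: oppr_inj; rewrite -LP PE raddfB /= !lrot_scal l1 l2.
move: (wre k A) (wim k A) => u v.
by apply/ffunP=> C; rewrite !ffunE -!mul_mpolyC; ring.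
Qed.
End Pattern.
End WeightSpace.

(** * Irreducibility *)

Section Detection.
Variables (R : realType) (m : nat) (a b : 'I_m).
Hypothesis ab : a != b.
Local Notation CP := (Defs.CP R m).
Local Notation Psk := (Defs.Psk R m).
Local Notation Hsk := (Defs.Hsk R m).
Local Notation subspace := (Defs.subspace R m).
Local Notation H_invariant := (Defs.H_invariant R m).
Local Notation MP := {mpoly R[m]}.
Local Notation rc := (real_complex R).
Local Notation L := (lrot a b).
Local Notation wre := (@wre R m a b).
Local Notation wim := (@wim R m a b).
Local Notation zeta := (@zeta R m a b).
Implicit Types (f g p q : MP) (j l : 'I_m) (A B C : {set 'I_m}) (P Q : CP) (s k n : nat).
Implicit Types (z : 'I_m -> R[i]) (y : 'I_m -> R).

Definition vanish z P := forall C, ceval z (P C) = 0.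

Lemma vanish0 z : vanish z 0.
Proof. by move=> C; rewrite ffunE ceval0. Qed.
Lemma vanishD z P Q : vanish z P -> vanish z Q -> vanish z (P + Q).
Proof. by move=> HP HQ C; rewrite ffunE cevalD HP HQ addr0. Qed.
Lemma vanishZ z c P : vanish z P -> vanish z (c *: P).
Proof. by move=> HP C; rewrite ffunE cevalZ HP mulr0. Qed.
Lemma vanishN z P : vanish z P -> vanish z (- P).
Proof. by move=> HP C; rewrite ffunE cevalN HP oppr0. Qed.
Lemma ceval_bneg z (c : bool) f : ceval z (bneg c f) = bneg c (ceval z f).
Proof. by case: c; rewrite //= cevalN. Qed.
Lemma vanish_ext z j P : vanish z P -> vanish z (ext j P).
Proof. by move=> HP C; rewrite extE; case: ifP => _; rewrite ?ceval0 // ceval_bneg HP bneg0. Qed.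
Lemma vanish_ctr z j P : vanish z P -> vanish z (ctr j P).
Proof. by move=> HP C; rewrite ctrE; case: ifP => _; rewrite ?ceval0 // ceval_bneg HP bneg0. Qed.
Lemma vanish_sum z I (r : seq I) (F : I -> CP) :
  (forall x, vanish z (F x)) -> vanish z (\sum_(x <- r) F x).
Proof. by move=> H; apply: (big_ind (vanish z)); [exact: vanish0|exact: vanishD|]. Qed.
Lemma vanish_reflv z u P : vanish z P -> vanish z (reflv u P).
Proof.
move=> HP; apply: vanishD; first exact: vanishZ.
apply/vanishN/vanishZ/vanish_sum => j; apply/vanishZ/vanish_ext/vanish_sum => l.
exact/vanishZ/vanish_ctr.
Qed.
Lemma vanish_ginv z P : vanish z P -> vanish z (ginv P).
Proof. by move=> HP C; rewrite ffunE ceval_bneg HP bneg0. Qed.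

Lemma ceval_sum_mulx (S : 'I_m -> CP -> CP) P C :
  ceval zeta ((\sum_j mulx j (S j P)) C) =
  ceval zeta (S a P C) + 'i * ceval zeta (S b P C).
Proof.
have [za zb zj] := zetaE R ab.
rewrite sum_ffunE ceval_sum (bigD1 a) //= (bigD1 b) 1?eq_sym //= big1 ?addr0.
  by rewrite !ffunE !cevalM !cevalX za zb mul1r.
by move=> j /andP[ja jb]; rewrite ffunE cevalM cevalX zj ?mul0r.
Qed.

Lemma vanish_extx_ctrx P :
  (forall A, a \notin A -> b \notin A ->
     ceval zeta (ctr a P A) + 'i * ceval zeta (ctr b P A) = 0) ->
  vanish zeta (extx (ctrx P)).
Proof.
move=> H C; rewrite ceval_sum_mulx.
have ctrxE A : ceval zeta (ctrx P A) = ceval zeta (ctr a P A) + 'i * ceval zeta (ctr b P A).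
  exact: ceval_sum_mulx.
have H' A : a \notin A -> b \notin A -> ceval zeta (ctrx P A) = 0.
  by move=> aA bA; rewrite ctrxE H.
have cx l A : l \in A -> ceval zeta (ctr l P A) = 0.
  by move=> lA; rewrite ctrE lA ceval0.
have cy l : l \in C -> ceval zeta (ctr l P (C :\ l)) = bneg (lowpar l C) (ceval zeta (P C)).
  move=> lC; rewrite ctrE !inE eqxx /= setD1K // ceval_bneg lowparD1 ltnn andbF addbF //.
rewrite !extE; have [aC|aC] := boolP (a \in C); have [bC|bC] := boolP (b \in C).
(* When C contains a and b, both terms reduce to the value of P C at [zeta], once with factor 1 and
   once with i^2, and cancel. *)
- rewrite !ceval_bneg !ctrxE !cy // (cx b) ?inE ?bC ?andbT 1?eq_sym //.
  rewrite (cx a) ?inE ?aC ?andbT // mulr0 addr0 add0r.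
  have e c (w : R[i]) : bneg c ('i * w) = 'i * bneg c w by case: c; rewrite //= mulrN.
  by rewrite e !bneg_bneg !addbb /= mulrA -expr2 sqr_i mulN1r subrr.
- by rewrite ceval0 mulr0 addr0 ceval_bneg H' ?bneg0 // !inE ?eqxx ?(negbTE bC) ?andbF.
- by rewrite ceval0 add0r ceval_bneg H' ?bneg0 ?mulr0 // !inE ?eqxx ?(negbTE aC) ?andbF.
- by rewrite ceval0 mulr0 addr0.
Qed.

(** On the null cone the two compositions are thus opposite, so vanishing of one gives vanishing of
    the other. *)
Lemma rad2_ext_ctr P : extx (ctrx P) + ctrx (extx P) = pmul (rad2 R m) P.
Proof.
have e1 : extx (ctrx P) = \sum_i \sum_j mulx i (mulx j (ext i (ctr j P))).
  by apply: eq_bigr => i _; rewrite !raddf_sum; apply: eq_bigr => j _; rewrite /= ext_mulx.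
have e2 : ctrx (extx P) = \sum_i \sum_j mulx i (mulx j (ctr j (ext i P))).
  rewrite exchange_big; apply: eq_bigr => i _; rewrite !raddf_sum; apply: eq_bigr => j _.
  by rewrite /= ctr_mulx mulxC.
rewrite e1 e2 -big_split; under eq_bigr => i _.
  rewrite -big_split (bigD1 i) //= big1 ?addr0 => [|j ji].
    rewrite -!raddfD extctr_id; over.
  by rewrite -!raddfD /= ext_ctr_comm eq_sym (negbTE ji) sub0r addNr !raddf0.
apply/ffunP=> C; rewrite sum_ffunE ffunE /rad2 mulr_suml.
by apply: eq_bigr => i _; rewrite !ffunE mulrA.
Qed.

Lemma ip_grade s k s' k' P Q : Psk s k P -> Psk s' k' Q -> s != s' -> ip P Q = 0.
Proof.
move=> /PskP[P1 _] /PskP[Q1 _] ss; apply: big1 => A _.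
have [As|As] := eqVneq #|A| s; last by rewrite P1 ?fip0l.
by rewrite Q1 ?fip0r // As.
Qed.

Lemma rc_reflmx (u : 'I_m -> R) i j : nsq u = 1 ->
  rc (reflmx u i j) = 2 * rc (u i) * rc (u j) - (j == i)%:R.
Proof.
move=> u1; rewrite /reflmx u1 mul1r rmorphB !rmorphM (eq_sym i).
by rewrite !rmorph_nat mulrA.
Qed.

(** The reflection along y - e_a exchanges e_a and y and fixes e_b, so it carries [zeta] to the
    required point; invariance of T transports the vanishing. *)
Lemma vanish_rotated (T : CP -> Prop) s k : subspace T -> H_invariant T ->
  (forall P, T P -> Psk s k P) ->
  (forall P, T P -> vanish zeta (extx (ctrx P))) ->
  forall P y, T P -> y b = 0 -> nsq y = 1 ->
  vanish (fun j => rc (y j) + 'i * (j == b)%:R) (extx (ctrx P)).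
Proof.
move=> HT HI TP TV P y HP yb y1.
pose r : 'I_m -> R := fun j => y j - basisv R a j.
set zy := fun j => _.
have rdot : \sum_j r j * y j = 1 - y a.
  under eq_bigr => j _ do rewrite mulrBl -expr2.
  by rewrite sumrB -/(nsq y) y1 (sum_delta (V := R^o) y (l := a)).
have Nr : nsq r = 2 * (1 - y a).
  rewrite -rdot; have -> : nsq r = \sum_j (r j * y j) - \sum_j (basisv R a j * r j).
    by rewrite -sumrB; apply: eq_bigr => j _; rewrite /r; ring.
  rewrite rdot (sum_delta (V := R^o) r (l := a)) // /r /basisv eqxx /=; ring.
(* If y = e_a, the point is [zeta] itself and there is no axis to reflect along. *)
have [N0|N0] := eqVneq (nsq r) 0.
  have yE j : y j = basisv R a j.
    apply/eqP; rewrite -subr_eq0 -sqrf_eq0; move/eqP: N0.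
    rewrite psumr_eq0 => [/allP/(_ j (mem_index_enum j))//|l _]; exact: sqr_ge0.
  by move=> C; rewrite -(TV P HP C); apply: eq_ceval => j; rewrite /zy yE.
have Npos : 0 < nsq r by rewrite lt_neqAle eq_sym N0 sumr_ge0 // => j _; rewrite sqr_ge0.
pose c := Num.sqrt (nsq r).
have c2 : c ^+ 2 = nsq r by rewrite sqr_sqrtr // ltW.
pose u : 'I_m -> R := fun j => c^-1 * r j.
have u1 : nsq u = 1 := pin_elt_normalized Npos.
have Hu : T (reft u P) := reft_invariant HI (u1 : unit_vec R m u) HP.
have V0 := TV _ Hu; rewrite (reft_ctrx u1) (reft_extx u1) in V0.
move: V0; set F := extx (ctrx P) => V0.
have HF : Psk s.-1.+1 k.+2 (reft u F) by apply/Psk_reft/Psk_extx/Psk_ctrx/TP.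
rewrite -(reftK F u1) /reft; apply/vanish_reflv/vanish_ginv => C.
rewrite ffunE -/(reft u F) ceval_comp_lin.
have [_ /(_ C) FC] := (PskP _ _ _).1 HF.
(* [reflmx] being minus the reflection, the point reached is minus [zeta]; homogeneity absorbs the
   sign. *)
rewrite (@eq_ceval _ _ _ (fun j => -1 * zeta j)) ?(ceval_homog _ _ FC) ?V0 ?mulr0 //.
move=> l; have rb : r b = 0 by rewrite /r yb /basisv eq_sym (negbTE ab) subr0.
have uz : \sum_j rc (u j) * zy j = rc (c^-1 * (1 - y a)).
  rewrite -rdot mulr_sumr rmorph_sum; apply: eq_bigr => j _.
  rewrite /zy /u mulrDr; have [->|jb] := eqVneq j b.
    by rewrite rb !(mulr0, mul0r, rmorph0, addr0).
  by rewrite !mulr0 addr0 -rmorphM mulrA.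
transitivity (2 * rc (u l) * (\sum_j rc (u j) * zy j) - zy l).
  have E : zy l = \sum_j (j == l)%:R * zy j.
    by rewrite (sum_delta (V := R[i]^o) zy (l := l)).
  rewrite mulr_sumr [X in _ = _ - X]E -sumrB; apply: eq_bigr => j _.
  by rewrite rc_reflmx //; ring.
rewrite uz; have -> : 1 - y a = 2^-1 * c ^+ 2.
  by rewrite c2 Nr mulrA mulVf ?mul1r // pnatr_eq0.
have c0 : c != 0 by rewrite gt_eqF // sqrtr_gt0.
have -> : 2 * rc (u l) * rc (c^-1 * (2^-1 * c ^+ 2)) = rc (r l).
  rewrite -(rmorph_nat rc 2) -!rmorphM; congr (rc _); rewrite /u.
  by field; rewrite c0.
rewrite /zy /zeta mulN1r /r rmorphB /=; ring.
Qed.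

(* Orthogonality to the highest weight vectors says that extx (ctrx P) vanishes at
   zeta = e_a + i e_b, hence by invariance on the null cone; the harmonic combination
   G of extx (ctrx P) and ctrx (extx P) then vanishes there, so G = 0. *)
Lemma detection s k (T : CP -> Prop) : (0 < s)%N -> (s < m)%N ->
  subspace T -> H_invariant T -> (forall P, T P -> Hsk s k P) ->
  (forall P A, T P -> a \notin A -> b \notin A -> #|A|.+1 = s -> ip P (wre k A) = 0) ->
  forall P, T P -> P = 0.
Proof.
move=> s0 sm HT HI TH Tort.
have TP P : T P -> Psk s k P by move=> /TH/Hsk_Psk.
have TL P : T P -> T (L P) by move=> HP; apply: (lrot_invariant ab HT HI (TP P HP) HP).
have Tre P A : T P -> a \notin A -> b \notin A -> ip P (wre k A) = 0.
  move=> HP aA bA; have [sA|sA] := eqVneq #|A|.+1 s; first exact: Tort.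
  by rewrite (ip_grade (TP P HP) (@Psk_w R m a b A k).1) // eq_sym.
(* T is stable under the skew generator L, which maps [wre] to a nonzero multiple of [wim]. *)
have Tim P A : T P -> a \notin A -> b \notin A -> ip P (wim k A) = 0.
  move=> HP aA bA; have [l1 _] := lrot_w R ab aA bA k.
  have := Tre _ _ (TL P HP) aA bA; rewrite lrot_skew l1 ipNr opprK ipZr => /eqP.
  by rewrite mulf_eq0 pnatr_eq0 /= => /eqP.
have TV P : T P -> vanish zeta (extx (ctrx P)).
  move=> HP; apply: vanish_extx_ctrx => A aA bA.
  have := pairing_w ab A (TP P HP).
  rewrite Tre // Tim // rmorph0 mulr0 addr0 => /esym/eqP.
  by rewrite mulf_eq0 pnatr_eq0 eqn0Ngt fact_gt0 /= => /eqP.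
move=> P HP.
have Hh := TH P HP; have HPP := TP P HP.
pose c1 := (k + s)%N; pose c2 := (k + m - s)%N.
have c1nz : c1%:R != 0 :> R by rewrite pnatr_eq0 /c1; lia.
have c2nz : c2%:R != 0 :> R by rewrite pnatr_eq0 /c2; lia.
have sle := ltnW sm.
have E1 : ctrd (extx (ctrx P)) = (c2 + 2)%:R *: ctrx P := ctrd_extx_ctrx_H Hh s0 sle.
have E2 : ctrd (ctrx (extx P)) = (- c2%:R) *: ctrx P := ctrd_ctrx_extx_H Hh sle.
have E3 : extd (extx (ctrx P)) = (- c1%:R) *: extx P := extd_extx_ctrx_H Hh.
have E4 : extd (ctrx (extx P)) = (c1 + 2)%:R *: extx P := extd_ctrx_extx_H Hh s0 sle.
have E5 : extd (ctrx P) = c1%:R *: P by rewrite (extd_ctrx_H Hh) addnC.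
have E6 : ctrd (extx P) = c2%:R *: P.
  by rewrite (ctrd_extx_H Hh); congr (_%:R *: _); rewrite /c2; lia.
(* With these coefficients [extd (ctrd G)] and [ctrd (extd G)] are opposite multiples of P, so G is
   harmonic. *)
pose G := c2%:R *: extx (ctrx P) - c1%:R *: ctrx (extx P).
have lapG : lap R m G = 0.
  rewrite lap_extd_ctrd /G !(ctrd_add, extd_add) !(extd_scal, ctrd_scal) E1 E2 E3 E4.
  rewrite !(extd_scal, ctrd_scal) E5 E6 !scalerA -!scalerBl -scalerDl.
  by rewrite -[RHS](scale0r P) !natrD; congr (_ *: _); ring.
have HG : Psk s k.+2 G.
  apply: PskB; apply: PskZ; last exact: Psk_ctrx (Psk_extx HPP).
  by have := Psk_extx (Psk_ctrx HPP); rewrite prednK.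
have G0 : G = 0.
  apply/ffunP=> C; rewrite [RHS]ffunE.
  have [_ /(_ C) GC] := (PskP _ _ _).1 HG.
  apply: (null_cone_harmonic ab GC).
    have := congr1 (fun X : CP => X C) lapG; rewrite /lap sum_ffunE [RHS]ffunE => E.
    by rewrite -[RHS]E; apply: eq_bigr => j _; rewrite !ffunE.
  move=> y yb y1; have V := vanish_rotated HT HI TP TV HP yb y1.
  have V2 : vanish (fun j => rc (y j) + 'i * (j == b)%:R) (ctrx (extx P)).
    have -> : ctrx (extx P) = pmul (rad2 R m) P - extx (ctrx P).
      by rewrite -rad2_ext_ctr addrC addKr.
    apply: vanishD; last exact: vanishN.
    move=> D; rewrite ffunE cevalM /rad2 ceval_sum.
    have -> : \sum_j ceval (fun j => rc (y j) + 'i * (j == b)%:R) ('X_j * 'X_j) = 0.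
      have sq j : ceval (fun j => rc (y j) + 'i * (j == b)%:R) ('X_j * 'X_j) =
          rc (y j ^+ 2) - (j == b)%:R.
        rewrite cevalM !cevalX -expr2 sqrrD exprMn sqr_i mulN1r rmorphXn /=.
        have [->|_] := eqVneq j b; first by rewrite yb rmorph0 mul0r mul0rn expr1n addr0.
        by rewrite mulr0 mulr0 mul0rn expr0n oppr0 addr0.
      under eq_bigr => j _ do rewrite sq.
      rewrite sumrB -rmorph_sum -/(nsq y) y1 rmorph1.
      rewrite (bigD1 b) //= eqxx big1 ?addr0 ?subrr // => j /negbTE -> //.
    by rewrite mul0r.
  have := vanishD (vanishZ c2%:R V) (vanishN (vanishZ c1%:R V2)); exact.
(* One of these two opposite multiples has coefficient - c1 c2 (c1 + c2 + 2), nonzero because 0 < s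
   < m, so G = 0 forces P = 0. *)
have := congr1 (fun X => ctrd (extd X)) G0.
rewrite /G extd_add !extd_scal E3 E4 ctrd_add !ctrd_scal E6.
rewrite !raddf0 !scalerA -scalerBl => /eqP; rewrite scaler_eq0 => /orP[|/eqP//].
have -> : c2%:R * - c1%:R * c2%:R - c1%:R * (c1 + 2)%:R * c2%:R =
   - (c1%:R * c2%:R * (c1 + c2 + 2)%:R) :> R by rewrite !natrD; ring.
rewrite oppr_eq0 !mulf_eq0 (negbTE c1nz) (negbTE c2nz) /= pnatr_eq0; lia.
Qed.
End Detection.

(** * Submodules and their highest weight vectors *)

Section Irreducible.
Variables (R : realType) (m : nat) (a b : 'I_m).
Hypothesis ab : a != b.
Local Notation CP := (Defs.CP R m).
Local Notation pderiv := (Defs.pderiv R m).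
Local Notation Psk := (Defs.Psk R m).
Local Notation Hsk := (Defs.Hsk R m).
Local Notation subspace := (Defs.subspace R m).
Local Notation H_invariant := (Defs.H_invariant R m).
Local Notation MP := {mpoly R[m]}.
Local Notation L := (lrot a b).
Local Notation wre := (@wre R m a b).
Local Notation wim := (@wim R m a b).
Implicit Types (f g p q : MP) (j l : 'I_m) (A B C : {set 'I_m}) (P Q : CP) (s k n : nat).

Lemma bneg_eq_sign (u v : bool) (p : MP) : bneg u p = bneg v p -> u != v -> p = 0.
Proof.
have dbl (q : MP) : q = - q -> q = 0.
  move=> E; have : 2 *: q = 0 by rewrite scaler_nat mulr2n {2}E subrr.
  by move/eqP; rewrite scaler_eq0 pnatr_eq0 /= => /eqP.
by case: u; case: v => //= E _; apply: dbl.
Qed.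

(* The joint eigenvalues of the reflections in the coordinate directions other
   than a and b record the blade of a highest weight vector. *)
Lemma pattern_of_signs s k A P : Psk s k P ->
  (forall j, j != a -> j != b -> pderiv j P = 0 /\
     reft (basisv R j) P = (-1) ^+ (s + k) *: ((-1) ^+ (j \in A) *: P)) ->
  forall C j, j != a -> j != b -> (j \in C) != (j \in A) -> P C = 0.
Proof.
move=> HP H C j ja jb jC; have [Pj] := H j ja jb.
rewrite (reft_basisv HP Pj) => E.
have sg0 : (-1) ^+ (s + k) != 0 :> R by rewrite signr_eq0.
have /ffunP/(_ C) := scalerI sg0 E; rewrite !ffunE scaler_sign -/(bneg _ _).
by move=> E'; apply: bneg_eq_sign E' jC.
Qed.

Lemma reft_w A s k j : a \notin A -> b \notin A -> #|A|.+1 = s -> j != a -> j != b ->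
  reft (basisv R j) (wre k A) = (-1) ^+ (s + k) *: ((-1) ^+ (j \in A) *: wre k A).
Proof.
move=> aA bA <- ja jb.
have [H1 _] := Psk_w R a b A k.
have [d1 _] := pderiv_w_other R A k ja jb.
by rewrite (reft_basisv H1 d1) (sign_w R aA bA).
Qed.

Section Submodule.
Variables (s k : nat) (T : CP -> Prop).
Hypotheses (HT : subspace T) (HI : H_invariant T) (TP : forall P, T P -> Psk s k P).

Lemma lrot_closed i j P : i != j -> T P -> T (lrot i j P).
Proof. by move=> ij HP; apply: (lrot_invariant ij HT HI (TP HP) HP). Qed.

(* The orthogonal projection t of the highest weight vector on T has the same weight
   and the same signs, so it is a complex multiple of the highest weight vector. *)
Lemma highest_weight_mem A P : a \notin A -> b \notin A -> #|A|.+1 = s ->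
  T P -> ip P (wre k A) <> 0 -> T (wre k A) /\ T (wim k A).
Proof.
move=> aA bA sA HP ipP.
have [T0 [TD TZ]] := HT.
have [t Tt tP] := orth_decomp_Psk HT TP (wre k A).
have tE X : T X -> ip t X = ip (wre k A) X.
  by move=> TX; apply/esym/eqP; rewrite -subr_eq0 -ipBl tP.
have Tuniq X : T X -> (forall Y, T Y -> ip X Y = 0) -> X = 0.
  by move=> TX H; apply/ip_eq0/H.
pose K : R := k.+1%:R.
have K0 : K != 0 by rewrite pnatr_eq0.
have [l1 l2] := lrot_w R ab aA bA k.
(* The imaginary partner of t, defined so that the first weight equation holds. *)
pose t2 := - K^-1 *: L t.
have TLt : T (L t) by exact: lrot_closed.
have Tt2 : T t2 by exact: TZ.
have Lt : L t = - (K *: t2) by rewrite /t2 scalerA mulrN mulfV // scaleN1r opprK.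
(* T is stable under L, and L^2 is symmetric, so projection onto T commutes with L^2 and t inherits
   the eigenvalue of [wre]. *)
have LLt : L (L t) = - (K ^+ 2) *: t.
  apply/eqP; rewrite -subr_eq0; apply/eqP; apply: Tuniq.
    by apply: (subspaceB HT); [exact: lrot_closed|exact: TZ].
  move=> Y TY; have TLY : T (L Y) by exact: lrot_closed.
  have TLLY : T (L (L Y)) by exact: lrot_closed.
  have skew2 X Z : ip (L (L X)) Z = ip X (L (L Z)) by rewrite !lrot_skew opprK.
  have LLw : L (L (wre k A)) = - (K ^+ 2) *: wre k A.
    by rewrite l1 raddfN /= lrot_scal l2 scalerA -expr2 scaleNr.
  by rewrite ipBl ipZl skew2 (tE _ TLLY) -skew2 LLw ipZl (tE _ TY) subrr.
have Lt2 : L t2 = K *: t.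
  by rewrite /t2 lrot_scal LLt scalerA mulrNN expr2 mulrA mulVf // mul1r.
have [_ _ tj _ _] := weight_eq ab (TP Tt) (TP Tt2) Lt Lt2.
have pat := pattern_of_signs (TP Tt) (A := A).
have [||C j ja jb jC|x [y [et et2]]] := weight_vector_pattern ab aA bA (TP Tt) (TP Tt2).
- exact: Lt.
- exact: Lt2.
- apply: (pat _ C j ja jb jC) => {C j ja jb jC} j ja jb; split; first by case: (tj j ja jb).
  apply/eqP; rewrite -subr_eq0; apply/eqP; apply: Tuniq.
    apply: (subspaceB HT); first exact: reft_invariant HI (nsq_basisv R j) Tt.
    exact/TZ/TZ.
  move=> Y TY; have TrY : T (reft (basisv R j) Y) := reft_invariant HI (nsq_basisv R j) TY.
  rewrite ipBl ip_reft (tE _ TrY) -ip_reft (reft_w k aA bA sA ja jb).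
  by rewrite !ipZl (tE _ TY) subrr.
have tn0 : t <> 0.
  by move=> t0; apply: ipP; rewrite ipC -(tE _ HP) t0 ip0l.
have D0 : x ^+ 2 + y ^+ 2 != 0.
  apply/eqP => /eqP; rewrite paddr_eq0 ?sqr_ge0 // !sqrf_eq0 => /andP[/eqP x0 /eqP y0].
  by apply: tn0; rewrite et x0 y0 !scale0r subr0.
(* Division of t + i t2 by x + i y, which is nonzero because t is. *)
have E1 : wre k A = (x ^+ 2 + y ^+ 2)^-1 *: (x *: t + y *: t2).
  rewrite et et2; move: (wre k A) (wim k A) => u v.
  apply/(scalerI D0); rewrite scalerA mulfV // scale1r.
  by apply/ffunP=> C; rewrite !ffunE -!mul_mpolyC; ring.
have E2 : wim k A = (x ^+ 2 + y ^+ 2)^-1 *: (x *: t2 - y *: t).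
  rewrite et et2; move: (wre k A) (wim k A) => u v.
  apply/(scalerI D0); rewrite scalerA mulfV // scale1r.
  by apply/ffunP=> C; rewrite !ffunE -!mul_mpolyC; ring.
split; [rewrite E1|rewrite E2]; apply: (TZ).
  by apply: TD; apply: (TZ).
by apply: (subspaceB HT); apply: (TZ).
Qed.

Lemma ext_ctr_blade j l A : j \notin A -> l \in A ->
  exists c : bool, ext j (ctr l (blade_vec R A)) = (-1) ^+ c *: blade_vec R (j |: A :\ l).
Proof.
move=> jA lA.
have jl : j != l by apply: contraNneq jA => ->.
have jAl : j \notin A :\ l by rewrite !inE (negbTE jA) andbF.
exists (lowpar j (A :\ l) (+) lowpar l (A :\ l)); apply/ffunP=> C.
rewrite extE [RHS]ffunE [blade_vec _ _ C]ffunE scaler_sign -/(bneg _ _).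
have [->|CA] := eqVneq C (j |: A :\ l).
  rewrite setU11 setU1K // lowparU1 ltnn andbF addbF ctrE !inE eqxx /= setD1K // ffunE eqxx.
  by rewrite bneg_bneg.
rewrite bneg0; case: (boolP (j \in C)) => // jC; rewrite ctrE; case: (boolP (l \in _)) => lC.
  by rewrite bneg0.
rewrite ffunE; case: eqP => [E|]; last by rewrite !bneg0.
by case/eqP: CA; rewrite -E setU1K // setD1K.
Qed.

(** The weight vector does not involve x_j or x_l, so only the exterior part of [lrot j l] acts, and
    it replaces l by j in the blade. *)
Lemma lrot_move j l A k' : j \notin A -> l \in A -> a \notin A -> b \notin A ->
  j != a -> j != b ->
  exists c : bool, lrot j l (wre k' A) = (-1) ^+ c *: wre k' (j |: A :\ l).
Proof.
move=> jA lA aA bA ja jb.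
have la : l != a by apply: contraNneq aA => <-.
have lb : l != b by apply: contraNneq bA => <-.
have [c Ec] := ext_ctr_blade jA lA; exists c.
have [d1 _] := pderiv_w_other R A k' ja jb.
have [d2 _] := pderiv_w_other R A k' la lb.
rewrite /lrot d1 d2 !raddf0 !add0r.
have even i i' d (X : CP) : d != i -> d != i' ->
    ext i (ctr i' (ext d X)) = ext d (ext i (ctr i' X)).
  move=> di di'; rewrite ctr_ext_comm eq_sym (negbTE di') mulr0n sub0r raddfN /=.
  by rewrite extext opprK.
have Ew i i' : i != a -> i != b -> i' != a -> i' != b ->
   ext i (ctr i' (wre k' A)) = pmul (zre R a b k') (ext a (ext i (ctr i' (blade_vec R A))))
     - pmul (zim R a b k') (ext b (ext i (ctr i' (blade_vec R A)))).
  move=> ia ib ia' ib'; rewrite wreE !raddfB /= !ctr_pmul !ext_pmul.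
  by rewrite !even // eq_sym.
rewrite !Ew // (ctr_blade R jA) !raddf0 !addr0 Ec wreE !ext_is_scalable !pmul_is_scalable.
by rewrite oppr0 addr0 scalerBr.
Qed.

(* The rotation generators [lrot j l] exchange the indices of the blade one by one. *)
Lemma highest_weight_all A B : a \notin A -> b \notin A -> a \notin B -> b \notin B ->
  #|A| = #|B| -> T (wre k A) -> T (wre k B).
Proof.
move=> aA bA aB bB; have [n] := ubnP #|B :\: A|.
elim: n A aA bA => [|n IH] A aA bA; first by rewrite ltn0 => F; discriminate F.
rewrite ltnS => BAn cAB HA.
have [BA0|[j]] := set_0Vmem (B :\: A).
  have BA : B \subset A by rewrite -setD_eq0 BA0.
  suff -> : B = A by [].
  by apply/eqP; rewrite eqEcard BA cAB leqnn.
rewrite inE => /andP[jA jB].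
have [l] : exists l, l \in A :\: B.
  apply/set0Pn; rewrite setD_eq0; apply: contraNN jA => AB.
  suff -> : A = B by [].
  by apply/eqP; rewrite eqEcard AB cAB leqnn.
rewrite inE => /andP[lB lA].
have ja : j != a by apply: contraNneq aB => <-.
have jb : j != b by apply: contraNneq bB => <-.
have jl : j != l by apply: contraNneq lB => <-.
have [c Ec] := lrot_move k jA lA aA bA ja jb.
have TA' : T (wre k (j |: A :\ l)).
  have : T (lrot j l (wre k A)) by apply: lrot_closed.
  rewrite Ec => /(HT.2.2 ((-1) ^+ c)).
  by rewrite scalerA -expr2 sqrr_sign scale1r.
apply: (IH (j |: A :\ l)); last exact: TA'.
- by rewrite !inE negb_or eq_sym ja (negbTE aA) andbF.
- by rewrite !inE negb_or eq_sym jb (negbTE bA) andbF.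
- apply: leq_trans BAn; apply: proper_card; apply/properP; split.
    apply/subsetP=> x; rewrite !inE negb_or negb_and negbK => /andP[/andP[_ /orP[/eqP->|->//]]].
    by rewrite (negbTE lB).
  by exists j; rewrite !inE ?eqxx ?jA.
- by rewrite cardsU1 !inE (negbTE jA) andbF /= -cAB (cardsD1 l A) lA.
Qed.
End Submodule.

Lemma orthogonal_complement_submodule s k (T : CP -> Prop) :
  subspace T -> H_invariant T ->
  let T' := fun P => Hsk s k P /\ forall Q, T Q -> ip P Q = 0 in
  subspace T' /\ H_invariant T'.
Proof.
move=> HT HI T'; have [H0 [HD HZ]] := subspace_Hsk R m s k.
split.
  split; first by split=> [|Q _]; [exact: H0|rewrite ip0l].
  split=> [P Q [P1 P2] [Q1 Q2]|c P [P1 P2]].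
    by split; [exact: HD|move=> X TX; rewrite ipDl P2 ?Q2 ?addr0].
  by split; [exact: HZ|move=> X TX; rewrite ipZl P2 ?mulr0].
apply: H_invariant_reft => u P u1 [P1 P2]; split; first exact: Hsk_reft.
by move=> Q TQ; rewrite ip_reft P2 //; apply: reft_invariant.
Qed.

Lemma blade_avoiding s : (0 < s)%N -> (s < m)%N ->
  exists A : {set 'I_m}, [/\ a \notin A, b \notin A & #|A|.+1 = s].
Proof.
move=> s0 sm; have : (s.-1 <= #|~: [set a; b]|)%N.
  by rewrite cardsCs setCK card_ord cards2 ab; lia.
case/card_geqP=> As [uA sA subA]; exists [set x in As]; split.
- by apply/negP; rewrite inE => /subA; rewrite !inE eqxx.
- by apply/negP; rewrite inE => /subA; rewrite !inE eqxx orbT.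
- by rewrite cardsE (card_uniqP uA) sA prednK.
Qed.

Lemma Hsk_irreducible_generic s k : (0 < s)%N -> (s < m)%N -> Defs.H_irreducible R m (Hsk s k).
Proof.
move=> s0 sm; have HV := subspace_Hsk R m s k.
have HVI : H_invariant (Hsk s k).
  by apply: H_invariant_reft => u P u1; apply: Hsk_reft.
have VP P : Hsk s k P -> Psk s k P by apply: Hsk_Psk.
have detect (T : CP -> Prop) : subspace T -> H_invariant T -> (forall P, T P -> Hsk s k P) ->
    (exists2 P, T P & P <> 0) ->
    exists A, [/\ a \notin A, b \notin A, #|A|.+1 = s & T (wre k A)].
  move=> HT HI TH [P TPP Pn0]; apply: contrapT => noA; apply: Pn0.
  apply: (detection ab s0 sm HT HI TH _ TPP) => Q A TQ aA bA sA; apply: contrapT => ipn.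
  apply: noA; exists A; split=> //.
  by case: (highest_weight_mem HT HI (fun X TX => VP X (TH X TX)) aA bA sA TQ ipn).
split=> //; split=> //; split.
  have [A [aA bA cA]] := blade_avoiding s0 sm.
  exists (wre k A); split; last by apply/eqP; exact: w_neq0.
  by have [] := Hsk_w R ab aA bA k; rewrite cA.
move=> T HT HI TH; have [[P TPP Pn0]|T0] := pselect (exists2 P, T P & P <> 0); last first.
  by left=> P TPP; apply: contrapT => Pn0; apply: T0; exists P.
right; have TPsk P' : T P' -> Psk s k P' by move=> /TH/VP.
have [A [aA bA sA TA]] := detect T HT HI TH (ex_intro2 _ _ P TPP Pn0).
pose T' := fun P => Hsk s k P /\ forall Q, T Q -> ip P Q = 0.
have [HT' HI'] : subspace T' /\ H_invariant T' by apply: orthogonal_complement_submodule.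
have T'0 Q : T' Q -> Q = 0.
  move=> T'Q; apply: contrapT => Qn0.
  have [B [aB bB sB T'B]] := detect T' HT' HI' (fun X TX => TX.1) (ex_intro2 _ _ Q T'Q Qn0).
  have cAB : #|A| = #|B| by apply: succn_inj; rewrite sA sB.
  have TB := highest_weight_all HT HI TPsk aA bA aB bB cAB TA.
  (* [wre k B] lies in T and in its complement, hence is orthogonal to itself. *)
  by case/eqP: (w_neq0 R ab aB bB k); apply: ip_eq0; exact: T'B.2 _ TB.
move=> Q HQ; have [Q1 TQ1 Q1P] := orth_decomp_Psk HT TPsk Q.
suff E : Q - Q1 = 0 by rewrite -(subrK Q1 Q) E add0r.
apply: T'0; split; first exact: subspaceB HV HQ (TH _ TQ1).
exact: Q1P.
Qed.
End Irreducible.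

(** * Equivalence of representations *)

Local Opaque Defs.Hact Defs.pin_elt Defs.unit_vec.

Section Equivalence.
Variables (R : realType) (m : nat).
Local Notation CP := (Defs.CP R m).
Local Notation Hact := (Defs.Hact R m).
Local Notation unit_vec := (Defs.unit_vec R m).
Local Notation pin_elt := (Defs.pin_elt R m).
Local Notation subspace := (Defs.subspace R m).
Local Notation H_invariant := (Defs.H_invariant R m).
Local Notation H_irreducible := (Defs.H_irreducible R m).
Local Notation H_equivalent := (Defs.H_equivalent R m).
Implicit Types (P Q : CP) (S T : CP -> Prop) (f : CP -> CP).

Lemma commute_Hact f : (forall u P, unit_vec u -> f (reft u P) = reft u (f P)) ->
  forall us P, pin_elt us -> f (Hact us P) = Hact us (f P).
Proof.
move=> Hf; elim=> [|u us IH] P Hus; first by rewrite (Hact_nil P) (Hact_nil (f P)).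
have [u1 Hus'] := (pin_elt_cons u us).1 Hus.
have E X : Hact (u :: us) X = reft u (Hact us X) := etrans (Hact_cons u us X) (Hact1 _ u1).
by move: (E P) (E (f P)) => -> ->; rewrite (Hf u _ u1) (IH P Hus').
Qed.

Lemma H_equivalent_img f S T : zmod_morphism f -> scalable f ->
  (forall u P, unit_vec u -> f (reft u P) = reft u (f P)) ->
  (forall P Q, S P -> S Q -> f P = f Q -> P = Q) ->
  (forall Q, T Q <-> exists2 P, S P & Q = f P) -> H_equivalent S T.
Proof.
move=> fB fZ fu inj HT; exists f.
have f0 : f 0 = 0 by rewrite -{1}(subrr 0) fB subrr.
have fN Q : f (- Q) = - f Q by rewrite -[- Q]sub0r fB f0 sub0r.
split; first by move=> P Q _ _; rewrite -[Q]opprK fB fN !opprK.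
split; first by move=> a P _; apply: fZ.
split; first by move=> P HP; apply/HT; exists P.
split; first exact: inj.
split; last by move=> us P Hus _; apply: commute_Hact.
by move=> Q /HT[P HP ->]; exists P.
Qed.

Lemma H_equivalent_trans S1 S2 S3 : H_equivalent S1 S2 -> H_equivalent S2 S3 -> H_equivalent S1 S3.
Proof.
move=> [f [fD [fZ [fT [fI [fS fH]]]]]] [g [gD [gZ [gT [gI [gS gH]]]]]].
exists (g \o f); split; first by move=> P Q HP HQ; rewrite /= fD ?gD //; apply: fT.
split; first by move=> a P HP; rewrite /= fZ ?gZ //; apply: fT.
split; first by move=> P HP; apply/gT/fT.
split; first by move=> P Q HP HQ /gI E; apply: fI => //; apply: E; apply: fT.
split; last by move=> us P Hus HP; rewrite /= fH ?gH //; apply: fT.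
by move=> Q /gS[X [/fS[P [HP <-]] <-]]; exists P.
Qed.

Lemma H_equivalent_sym S T : subspace S -> H_invariant S -> H_equivalent S T -> H_equivalent T S.
Proof.
move=> [_ [SD SZ]] HS [f [fD [fZ [fT [fI [fS fH]]]]]].
have inv Q : exists P, T Q -> S P /\ f P = Q.
  have [/fS[P HP]|nTQ] := pselect (T Q); first by exists P.
  by exists 0.
pose g Q := sval (cid (inv Q)).
have gP Q : T Q -> S (g Q) /\ f (g Q) = Q by rewrite /g; case: cid.
have gE P Q : S P -> f P = Q -> g Q = P.
  move=> HP E; have [|Sg Eg] := gP Q; first by rewrite -E; apply: fT.
  by apply: fI => //; rewrite Eg.
exists g; split.
  move=> P Q /gP[P1 P2] /gP[Q1 Q2]; apply: gE; first exact: SD.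
  by rewrite fD // P2 Q2.
split; first by move=> a P /gP[P1 P2]; apply: gE; [apply: SZ|rewrite fZ // P2].
split; first by move=> P /gP[].
split; first by move=> P Q /gP[_ {2}<-] /gP[_ {2}<-] ->.
split; first by move=> P HP; exists (f P); split; [apply: fT|apply: gE].
move=> us P Hus /gP[P1 P2]; apply: gE; first exact: HS.
by rewrite (fH us _ Hus P1) P2.
Qed.

Lemma H_invariant_equiv S T : H_invariant S -> H_equivalent S T -> H_invariant T.
Proof.
move=> HS [f [_ [_ [fT [_ [fS fH]]]]]] us Q Hus /fS[X [SX <-]].
by rewrite -(fH us X Hus SX); exact/fT/HS.
Qed.

Lemma H_irreducible_equiv S T : subspace T -> H_irreducible S -> H_equivalent S T ->
  H_irreducible T.
Proof.
move=> HT [HS [HSI [[P [HP Pn0]] irr]]] ST; have HTI := H_invariant_equiv HSI ST.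
have [f [fD [fZ [fT [fI [fS fH]]]]]] := ST.
have [S0 [SD SZ]] := HS.
have f0 : f 0 = 0 by rewrite -{1}(scale0r (0 : CP)) fZ // scale0r.
split=> //; split=> //; split.
  exists (f P); split; first exact: fT.
  by move=> E; apply: Pn0; apply: fI; rewrite ?f0.
move=> U [U0 [UD UZ]] HUI HU.
pose V X := S X /\ U (f X).
have [V0|SV] : (forall X, V X -> X = 0) \/ (forall X, S X -> V X).
  apply: irr.
  - split; first by split; rewrite ?f0.
    split=> [X Y [X1 X2] [Y1 Y2]|a X [X1 X2]].
      by split; [apply: SD|rewrite fD //; apply: UD].
    by split; [apply: SZ|rewrite fZ //; apply: UZ].
  - move=> us X Hus [X1 X2]; split; first exact: HSI.
    by rewrite (fH us X Hus X1); exact: HUI.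
  - by move=> X [].
- left=> Q UQ; have [X [SX EX]] := fS Q (HU Q UQ).
  by rewrite -EX (V0 X) //; split; rewrite ?EX.
- by right=> Q /fS[X [/SV[_ UX] <-]].
Qed.
End Equivalence.

(** * Scalars and pseudoscalars *)

Section Extremal.
Variables (R : realType) (m : nat).
Local Notation CP := (Defs.CP R m).
Local Notation Psk := (Defs.Psk R m).
Local Notation Hsk := (Defs.Hsk R m).
Local Notation H_invariant := (Defs.H_invariant R m).
Local Notation H_irreducible := (Defs.H_irreducible R m).
Implicit Types (P Q : CP) (s k : nat).

Lemma H_invariant_Hsk s k : H_invariant (Hsk s k).
Proof. by apply: H_invariant_reft => u P u1; apply: Hsk_reft. Qed.

(** For s = 0, [ctrx P] is 0 although [extd (ctrx P)] is k P; for s = m the same happens with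
    [extx P] and [ctrd]. *)
Lemma Hsk_range s k P : Hsk s k P -> P <> 0 ->
  (0 < s < m)%N \/ k = 0%N /\ (s = 0%N \/ s = m).
Proof.
move=> HP Pn0; have HP' := Hsk_Psk HP.
have sm : (s <= m)%N by rewrite leqNgt; apply/negP => ms; apply: Pn0; exact: Psk_gt ms HP'.
have scal0 c : (c%:R : R) *: P = 0 -> c = 0%N.
  by move/eqP; rewrite scaler_eq0 pnatr_eq0 => /orP[/eqP|/eqP/Pn0].
have [s0|s0] := posnP s.
  right; split; last by left.
  apply: scal0; have := extd_ctrx_H HP; rewrite s0 add0n => <-.
  by rewrite s0 in HP'; rewrite (Psk0_ctrx HP') raddf0.
have [sm'|ms] := ltnP s m; first by left.
have em : s = m by apply/eqP; rewrite eqn_leq sm.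
right; split; last by right.
apply: scal0; have := ctrd_extx_H HP; rewrite em subnn add0n => <-.
by rewrite (Psk_gt _ (Psk_extx HP')) ?raddf0 // em.
Qed.

Lemma extremal_blade s : s = 0%N \/ s = m ->
  exists A0 : {set 'I_m}, forall A : {set 'I_m}, #|A| = s -> A = A0.
Proof.
case=> ->; first by exists set0 => A /cards0_eq.
exists setT => A cA; apply/eqP; rewrite eqEcard subsetT cardsT card_ord cA leqnn //.
Qed.

Lemma extremal_line s P Q : s = 0%N \/ s = m -> Psk s 0 P -> Psk s 0 Q -> P <> 0 ->
  exists c : R, Q = c *: P.
Proof.
move=> /extremal_blade[A0 HA] /PskP[P1 P2] /PskP[Q1 Q2] Pn0.
have supp X : (forall A : {set 'I_m}, #|A| != s -> X A = 0) ->
    forall A, A != A0 -> X A = 0 :> {mpoly R[m]}.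
  by move=> HX A /eqP AA; apply: HX; apply/negP => /eqP /HA.
have p0 : (P A0)@_0 != 0.
  apply/eqP=> p0; apply: Pn0; apply/ffunP=> A; rewrite ffunE.
  have [->|/(supp P P1)//] := eqVneq A A0.
  by rewrite (homog0_const (P2 A0)) p0.
exists ((Q A0)@_0 / (P A0)@_0); apply/ffunP=> A; rewrite ffunE.
have [->|AA] := eqVneq A A0; last by rewrite (supp P P1 _ AA) (supp Q Q1 _ AA) scaler0.
by rewrite {1}(homog0_const (Q2 A0)) {2}(homog0_const (P2 A0)) -mul_mpolyC -mpolyCM divfK.
Qed.

Lemma Hsk_irreducible s k : Defs.nonzero_space R m (Hsk s k) -> H_irreducible (Hsk s k).
Proof.
move=> HN; have [P0 [HP0 P0n]] := HN.
have [/andP[s0 sm]|[k0 ext_s]] := Hsk_range HP0 P0n.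
  have m1 : (1 < m)%N by apply: leq_ltn_trans sm.
  have ab : Ordinal (ltnW m1) != Ordinal m1 by [].
  exact: Hsk_irreducible_generic ab _ _ s0 sm.
split; first exact: subspace_Hsk.
split; first exact: H_invariant_Hsk.
split; first exact: HN.
move=> T HT HI TH; have [[P TP Pn0]|T0] := pselect (exists2 P, T P & P <> 0); last first.
  by left=> P TP; apply: contrapT => Pn0; apply: T0; exists P.
right=> Q HQ; have HP := Hsk_Psk (TH P TP); have HQ' := Hsk_Psk HQ.
rewrite k0 in HP HQ'; have [c ->] := extremal_line ext_s HP HQ' Pn0.
exact: HT.2.2.
Qed.

(** Rotations fix constant scalars, and constant pseudoscalars because their determinant is 1. *)
Lemma lrot_extremal s P i j : i != j -> s = 0%N \/ s = m -> Psk s 0 P -> lrot i j P = 0.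
Proof.
move=> ij es HP.
have d l : pderiv R m l P = 0.
  move/PskP: HP => [_ P2]; apply/ffunP=> A; rewrite !ffunE.
  by rewrite (homog0_const (P2 A)) mderivC.
rewrite /lrot !d !raddf0 !add0r.
case: es => es; rewrite es in HP.
  by rewrite !(Psk_ctr0 _ HP) !raddf0 addr0.
have e l : ext l P = 0 by apply: Psk_gt (Psk_ext l HP).
have c l l' : l != l' -> ext l (ctr l' P) = 0.
  move=> ll'; have := ctr_ext_comm l' l P.
  by rewrite e raddf0 eq_sym (negbTE ll') mulr0n sub0r => /esym/eqP; rewrite oppr_eq0 => /eqP.
by rewrite !c ?subr0 // eq_sym.
Qed.
End Extremal.

(** * Weights and reflection signs as invariants *)

Section Inequivalence.
Variables (R : realType) (m : nat).
Local Notation CP := (Defs.CP R m).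
Local Notation Psk := (Defs.Psk R m).
Local Notation Hsk := (Defs.Hsk R m).
Local Notation H_equivalent := (Defs.H_equivalent R m).
Implicit Types (P Q : CP) (s k : nat).

Section Generic.
Variables (s k s' k' : nat) (f : CP -> CP).
Hypothesis s_mid : (0 < s < m)%N.
Hypothesis fD : forall P Q, Hsk s k P -> Hsk s k Q -> f (P + Q) = f P + f Q.
Hypothesis fZ : forall (c : R) P, Hsk s k P -> f (c *: P) = c *: f P.
Hypothesis fT : forall P, Hsk s k P -> Hsk s' k' (f P).
Hypothesis fI : forall P Q, Hsk s k P -> Hsk s k Q -> f P = f Q -> P = Q.
Hypothesis fH : forall us P, Defs.pin_elt R m us -> Hsk s k P ->
  f (Defs.Hact R m us P) = Defs.Hact R m us (f P).

Lemma intertwiner_reft u P : Defs.unit_vec R m u -> Hsk s k P -> f (reft u P) = reft u (f P).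
Proof.
move=> u1 HP; have uu : Defs.pin_elt R m [:: u].
  by apply/pin_elt_cons; split=> // -[].
by have := fH uu HP; rewrite !(Hact1 _ u1).
Qed.

(** An intertwiner carries the weight k + 1 and the reflection signs into the target, where the
    constraints for (s', k') apply to them. *)
Lemma highest_weight_transfer : exists a b (A : {set 'I_m}) P Q,
  [/\ [/\ a != b, a \notin A, b \notin A & #|A|.+1 = s], P <> 0, Hsk s' k' P /\ Hsk s' k' Q,
      lrot a b P = - (k.+1%:R *: Q) /\ lrot a b Q = k.+1%:R *: P &
      forall j, j != a -> j != b ->
        reft (basisv R j) P = (-1) ^+ (s + k) *: ((-1) ^+ (j \in A) *: P)].
Proof.
have /andP[s0 sm] := s_mid.
have m1 : (1 < m)%N by apply: leq_ltn_trans sm.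
pose a := Ordinal (ltnW m1); pose b := Ordinal m1.
have ab : a != b by [].
have [A [aA bA cA]] := blade_avoiding ab s0 sm.
have [H1 H2] := Hsk_w R ab aA bA k; rewrite cA in H1 H2.
have [l1 l2] := lrot_w R ab aA bA k.
exists a, b, A, (f (wre R a b k A)), (f (wim R a b k A)).
have f0 : f 0 = 0.
  by rewrite -{1}(scale0r (wre R a b k A)) (fZ _ H1) scale0r.
have fN c P : Hsk s k P -> f (- (c *: P)) = - (c *: f P).
  by move=> HP; rewrite -!scaleNr (fZ _ HP).
have fL P : Hsk s k P -> f (lrot a b P) = lrot a b (f P).
  move=> HP; exact: (lrot_equivariant ab (subspace_Hsk R m s k) (@H_invariant_Hsk R m s k)
    fD fZ fH HP (Hsk_Psk HP) (Hsk_Psk (fT HP))).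
split.
- by [].
- move=> E; case/eqP: (w_neq0 R ab aA bA k); apply: (fI H1); last by rewrite f0.
  exact: (subspace_Hsk R m s k).1.
- by split; apply: fT.
- by rewrite -(fL _ H1) -(fL _ H2) l1 l2 (fN _ _ H2) (fZ _ H1).
- move=> j ja jb; have u1 : Defs.unit_vec R m (basisv R j) by rewrite -nsqE nsq_basisv.
  apply: etrans (esym (intertwiner_reft u1 H1)) _.
  have HZ c P : Hsk s k P -> Hsk s k (c *: P) := (subspace_Hsk R m s k).2.2 c P.
  apply: etrans (congr1 f (reft_w R k aA bA cA ja jb)) _.
  by rewrite (fZ _ (HZ _ _ H1)) (fZ _ H1).
Qed.
End Generic.

(** The weight k + 1 cannot exceed the bound k' + 1 of the target, and an extremal target is
    excluded because rotations act trivially on it. *)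
Lemma generic_bound s k s' k' : (0 < s < m)%N -> H_equivalent (Hsk s k) (Hsk s' k') ->
  (k <= k')%N /\ (0 < s' < m)%N.
Proof.
move=> sm [f [fD [fZ [fT [fI [_ fH]]]]]].
have [a [b [A [P [Q [[ab _ _ _] Pn0 [HP HQ] [LP LQ] _]]]]]] :=
  highest_weight_transfer sm fD fZ fT fI fH.
split.
  rewrite leqNgt; apply/negP=> kk; apply: Pn0.
  by apply: (weight_gt ab (Hsk_Psk HP) (Hsk_Psk HQ) LP LQ); rewrite ltr_nat.
have [//|[k0 es]] := Hsk_range HP Pn0.
have := Hsk_Psk HQ; rewrite k0 => HQ'.
move: LQ; rewrite (lrot_extremal ab es HQ') => /esym/eqP.
by rewrite scaler_eq0 pnatr_eq0 => /eqP/Pn0.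
Qed.

(* The signs determine the blade outside {a, b}, leaving only s' - 1, s' and s' + 1
   for s. *)
Lemma generic_inequivalent s k s' k' : (0 < s < m)%N -> k = k' ->
  ~~ odd (s + s') -> H_equivalent (Hsk s k) (Hsk s' k') -> s = s'.
Proof.
move=> sm ek ev [f [fD [fZ [fT [fI [_ fH]]]]]].
have [a [b [A [P [Q [[ab aA bA cA] Pn0 [HP HQ] [LP LQ] sgn]]]]]] :=
  highest_weight_transfer sm fD fZ fT fI fH.
subst k'; have [_ _ Pj _ _] := weight_eq ab (Hsk_Psk HP) (Hsk_Psk HQ) LP LQ.
have sg : (-1) ^+ (s + k) = (-1) ^+ (s' + k) :> R.
  rewrite -signr_odd -[RHS]signr_odd; congr (_ ^+ _).
  by move: ev; rewrite !oddD negb_add => /eqP->.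
have [C PC] : exists C, P C != 0.
  apply: contrapT => H; apply: Pn0; apply/ffunP=> C; rewrite ffunE; apply/eqP.
  by apply/negPn/negP=> PC; apply: H; exists C.
have mem j : j != a -> j != b -> (j \in C) = (j \in A).
  move=> ja jb; apply/eqP; apply: contraNT PC => jC; apply/eqP.
  apply: (pattern_of_signs (A := A) (Hsk_Psk HP) _ ja jb jC) => l la lb.
  by split; [have [] := Pj l la lb|rewrite (sgn l la lb) sg].
have cC : #|C| = s'.
  have [P1 _] := (PskP _ _ _).1 (Hsk_Psk HP).
  by apply/eqP; apply: contraNT PC => /P1 ->.
have eC : (#|C| = (a \in C) + (b \in C) + #|A|)%N.
  rewrite (cardsD1 a C) (cardsD1 b (C :\ a)) !inE eq_sym ab /= addnA; congr (_ + _)%N.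
  apply: eq_card => j; rewrite !inE.
  have [->|jb] := eqVneq j b; first by rewrite (negbTE bA).
  have [->|ja] := eqVneq j a; first by rewrite (negbTE aA).
  by rewrite mem.
(* s - s' is 1, 0 or -1 as C contains none, one or both of a and b; parity leaves 0. *)
move: ev; rewrite -cA -cC eC; case: (a \in C); case: (b \in C); rewrite /= ?addn0 ?add0n ?add1n //.
all: rewrite ?addSn ?addnS /= addnn odd_double //.
Qed.

(** A reflection acts by 1 on scalars and by (-1)^(m + 1) on pseudoscalars; if s and s' differed,
    the parity condition would make m even and these signs distinct. *)
Lemma extremal_inequivalent s s' : (0 < m)%N -> s = 0%N \/ s = m -> s' = 0%N \/ s' = m ->
  ~~ odd (s + s') -> Defs.nonzero_space R m (Hsk s 0) ->
  H_equivalent (Hsk s 0) (Hsk s' 0) -> s = s'.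
Proof.
move=> m0 es es' ev [P [HP Pn0]] [f [fD [fZ [fT [fI [_ fH]]]]]].
have j : 'I_m := Ordinal m0.
have rE r X : r = 0%N \/ r = m -> Psk r 0 X -> reft (basisv R j) X = (-1) ^+ (r + (0 < r)) *: X.
  move=> er HX; have [X1 X2] := (PskP _ _ _).1 HX.
  have d : Defs.pderiv R m j X = 0.
    by apply/ffunP=> A; rewrite !ffunE (homog0_const (X2 A)) mderivC.
  rewrite (reft_basisv HX d) addn0 exprD -scalerA; congr (_ *: _); apply/ffunP=> A.
  rewrite ffunE [RHS]ffunE scaler_sign -/(bneg _ _).
  have [cA|/X1->] := eqVneq #|A| r; last by rewrite !bneg0.
  congr (bneg _ _).
  case: er => er; rewrite er in cA *.
    by move/cards0_eq: cA => ->; rewrite inE.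
  suff -> : A = setT by rewrite inE m0.
  by apply/eqP; rewrite eqEcard subsetT cardsT card_ord cA leqnn.
have E : (-1) ^+ (s + (0 < s)) *: f P = (-1) ^+ (s' + (0 < s')) *: f P.
  have u1 : Defs.unit_vec R m (basisv R j) by rewrite -nsqE nsq_basisv.
  apply: etrans (rE _ _ es' (Hsk_Psk (fT _ HP))); rewrite -(fZ _ _ HP).
  apply: etrans (intertwiner_reft fH u1 HP); apply: congr1; apply: esym.
  exact: rE es (Hsk_Psk HP).
have fP : f P <> 0.
  have f0 : f 0 = 0 by rewrite -{1}(scale0r P) (fZ _ _ HP) scale0r.
  by move=> fP; apply: Pn0; apply: (fI _ _ HP); [exact: (subspace_Hsk R m s 0).1|rewrite f0].
have {E} : (-1) ^+ (s + (0 < s)) = (-1) ^+ (s' + (0 < s')) :> R.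
  apply/eqP; rewrite -subr_eq0; apply/eqP; apply: contrapT => /eqP c0; apply: fP.
  by apply: (scalerI c0); rewrite scaler0 scalerBl E subrr.
move/eqP; rewrite -signr_odd -[eqbRHS]signr_odd.
have -> : odd (s' + (0 < s')) = odd s (+) (0 < s')%N.
  by rewrite oddD oddb; move: ev; rewrite oddD negb_add => /eqP->.
rewrite oddD oddb (inj_eq (@signr_inj _)) => /eqP/addbI.
by case: es => ->; case: es' => ->; rewrite ?m0 ?ltnn.
Qed.

Lemma Hsk_inequivalent s k s' k' : (0 < m)%N -> Defs.nonzero_space R m (Hsk s k) ->
  ~~ odd (s + k + (s' + k')) -> H_equivalent (Hsk s k) (Hsk s' k') -> s = s' /\ k = k'.
Proof.
move=> m0 HN ev E; have E' := H_equivalent_sym (subspace_Hsk R m s k) (@H_invariant_Hsk R m s k) E.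
have [P [HP Pn0]] := HN.
have HN' : Defs.nonzero_space R m (Hsk s' k').
  have [f [fD [fZ [fT [fI _]]]]] := E; exists (f P); split; first exact: fT.
  have f0 : f 0 = 0 by rewrite -{1}(scale0r P) (fZ _ _ HP) scale0r.
  by move=> fP; apply: Pn0; apply: (fI _ _ HP); [exact: (subspace_Hsk R m s k).1|rewrite f0].
have [P' [HP' P'n0]] := HN'.
have [sm|[k0 es]] := Hsk_range HP Pn0.
  have [kk sm'] := generic_bound sm E; have [kk' _] := generic_bound sm' E'.
  have ek : k = k' by apply/eqP; rewrite eqn_leq kk kk'.
  split=> //; apply: (generic_inequivalent sm ek _ E).
  by move: ev; rewrite ek !oddD; case: (odd s); case: (odd s'); case: (odd k').
have [sm'|[k0' es']] := Hsk_range HP' P'n0.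
  by have [_] := generic_bound sm' E'; case: es => ->; rewrite ?ltnn ?andbF.
subst k k'; split=> //; apply: (extremal_inequivalent m0 es es' _ HN E).
by rewrite !addn0 in ev.
Qed.
End Inequivalence.

(** * The four pieces as images of spaces of Hodge-de Rham solutions *)

Section Pieces.
Variables (R : realType) (m s k : nat).
Hypothesis s_le : (s <= m)%N.
Local Notation CP := (Defs.CP R m).
Local Notation Hsk := (Defs.Hsk R m).
Local Notation zero_space := (Defs.zero_space R m).
Local Notation H_invariant := (Defs.H_invariant R m).
Local Notation H_equivalent := (Defs.H_equivalent R m).
Implicit Types (P Q : CP) (i j : nat).

Definition pieces := [:: Defs.piece1 R m s k; Defs.piece2 R m s k; Defs.piece3 R m s k;
  Defs.Wtilde R m s k].

(** The indices of the space whose image is the i-th piece; the truncated subtractions are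
    meaningful only under [piece_range]. *)
Definition piece_model i : nat * nat :=
  nth (0, 0)%N [:: (s, k); (s.-1, k.-1); (s.+1, k.-1); (s, k - 2)%N] i.

Definition piece_range i : bool := nth false
  [:: true; (0 < s) && (0 < k); 0 < k; [&& 1 <= s, s <= m.-1 & 2 <= k]]%N i.

Lemma reft_wop c1 c2 u P : nsq u = 1 -> wop c1 c2 (reft u P) = reft u (wop c1 c2 P).
Proof.
move=> u1; rewrite /wop (raddfD (reft u)) /= !reft_scal.
congr (_ *: _ + _ *: _).
  exact: etrans (congr1 _ (reft_ctrx u1 P)) (reft_extx u1 (ctrx P)).
exact: etrans (congr1 _ (reft_extx u1 P)) (reft_ctrx u1 (extx P)).
Qed.

(** The maps are injective because [ctrd], [extd] and [ctrd] after [extd] invert the last three up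
    to the nonzero scalars found for the decomposition. *)
Lemma piece_equivalent i : (i < 4)%N -> piece_range i ->
  H_equivalent (Hsk (piece_model i).1 (piece_model i).2) (nth zero_space pieces i).
Proof.
have cancel_nat (c : nat) P Q : c != 0%N -> (c%:R : R) *: P = c%:R *: Q -> P = Q.
  by move=> c0; apply: scalerI; rewrite pnatr_eq0.
case: i => [|[|[|[|//]]]] _ ok; rewrite /piece_range /= in ok; rewrite /piece_model /pieces /=.
- apply: (H_equivalent_img (f := id)).
  + by move=> P Q.
  + by move=> c P.
  + by move=> u P _.
  + by move=> P Q _ _.
  + move=> Q; split=> [/piece1P HQ|[P HP ->]]; first by exists Q.
    exact/piece1P.
- have /andP[s0 k0] := ok; apply: (H_equivalent_img (f := @extx R m)).
  + exact: raddfB.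
  + by move=> c P; rewrite linearZ.
  + by move=> u P; rewrite -nsqE => u1; rewrite (reft_extx u1).
  + move=> P Q HP HQ /(congr1 (@ctrd R m)); rewrite (ctrd_extx_H HP) (ctrd_extx_H HQ).
    by apply: cancel_nat; lia.
  + by move=> Q; have := piece2P s k Q; rewrite ok.
- apply: (H_equivalent_img (f := fun P => - ctrx P)).
  + by move=> P Q; rewrite raddfB opprB addrC opprK.
  + by move=> c P; rewrite linearZ scalerN.
  + move=> u P; rewrite -nsqE => u1; by rewrite (reft_ctrx u1) raddfN.
  + move=> P Q HP HQ /oppr_inj/(congr1 (@extd R m)); rewrite (extd_ctrx_H HP) (extd_ctrx_H HQ).
    by apply: cancel_nat; lia.
  + by move=> Q; have := piece3P s k Q; rewrite ok.
- have /and3P[s0 _ k2] := ok.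
  apply: (H_equivalent_img (f := fun P => - wop (k - 2 + s) (k - 2 + m - s) P)).
  + by move=> P Q; rewrite raddfB opprB addrC opprK.
  + by move=> c P; rewrite linearZ /= scalerN.
  + by move=> u P; rewrite -nsqE => u1; rewrite (reft_wop _ _ _ u1) raddfN.
  + move=> P Q HP HQ /oppr_inj E; apply: (scalerI (wop_coef_neq0 R ok)).
    apply: etrans (esym (ctrd_extd_wop HP s0 s_le)) _.
    exact: etrans (congr1 (fun X => ctrd (extd X)) E) (ctrd_extd_wop HQ s0 s_le).
  + by move=> Q; have := WtildeP s k Q; rewrite ok.
Qed.

Lemma piece_degenerate i P : ~~ piece_range i -> nth zero_space pieces i P -> P = 0.
Proof.
case: i => [|[|[|[|i]]]] //=; rewrite /piece_range /= => ok.
- by move/piece2P; rewrite (negbTE ok) => -[h -> ->]; rewrite raddf0.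
- by move/piece3P; rewrite (negbTE ok) => -[h -> ->]; rewrite raddf0 oppr0.
- by move/WtildeP; rewrite (negbTE ok).
- by rewrite nth_nil.
Qed.

Lemma nonzero_piece i : (i < 4)%N -> Defs.nonzero_space R m (nth zero_space pieces i) ->
  Defs.nonzero_space R m (Hsk (piece_model i).1 (piece_model i).2) /\
  H_equivalent (Hsk (piece_model i).1 (piece_model i).2) (nth zero_space pieces i).
Proof.
move=> i4 [P [HP Pn0]].
have [ok|/piece_degenerate/(_ HP)/Pn0//] := boolP (piece_range i).
have E := piece_equivalent i4 ok; split; last exact: E.
have [f [_ [fZ [_ [_ [fS _]]]]]] := E; have [Q [HQ EQ]] := fS P HP.
exists Q; split=> // Q0; apply: Pn0; rewrite -EQ Q0.
by rewrite Q0 in HQ; rewrite -{1}(scale0r (0 : CP)) (fZ _ _ HQ) scale0r.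
Qed.

Lemma subspace_pieces i : Defs.subspace R m (nth zero_space pieces i).
Proof.
case: i => [|[|[|[|i]]]] /=; rewrite ?nth_nil.
- exact: subspace_piece1.
- exact: subspace_piece2.
- exact: subspace_piece3.
- exact: subspace_Wtilde.
- exact: subspace_zero.
Qed.

Lemma H_invariant_pieces i : (i < 4)%N -> H_invariant (nth zero_space pieces i).
Proof.
move=> i4; have [ok|deg] := boolP (piece_range i).
  exact: H_invariant_equiv (@H_invariant_Hsk R m _ _) (piece_equivalent i4 ok).
apply: H_invariant_reft => u P _ /(piece_degenerate deg) ->.
by rewrite raddf0; have [] := subspace_pieces i.
Qed.

Lemma piece_model_inj i j : (i < 4)%N -> (j < 4)%N -> piece_range i -> piece_range j ->
  piece_model i = piece_model j -> i = j.
Proof.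
by case: i => [|[|[|[|//]]]] _; case: j => [|[|[|[|//]]]] _; rewrite /piece_range /piece_model /=;
  move=> ok_i ok_j E; move: (congr1 fst E) (congr1 snd E) ok_i ok_j => /=; lia.
Qed.

Lemma piece_model_parity i : (i < 4)%N -> piece_range i ->
  odd ((piece_model i).1 + (piece_model i).2) = odd (s + k).
Proof.
by case: i => [|[|[|[|//]]]] _; rewrite /piece_range /piece_model /=; lia.
Qed.

Lemma pieces_inequivalent i j : (0 < m)%N -> (i < 4)%N -> (j < 4)%N -> i <> j ->
  Defs.nonzero_space R m (nth zero_space pieces i) ->
  Defs.nonzero_space R m (nth zero_space pieces j) ->
  ~ H_equivalent (nth zero_space pieces i) (nth zero_space pieces j).
Proof.
move=> m0 i4 j4 ij Ni Nj E.
have ok l : Defs.nonzero_space R m (nth zero_space pieces l) -> piece_range l.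
  by move=> [P [HP Pn0]]; apply: contraT => /piece_degenerate/(_ HP)/Pn0.
have [Mi Ei] := nonzero_piece i4 Ni; have [_ Ej] := nonzero_piece j4 Nj.
have Ej' := H_equivalent_sym (subspace_Hsk R m _ _) (@H_invariant_Hsk R m _ _) Ej.
have [|e1 e2] := Hsk_inequivalent m0 Mi _ (H_equivalent_trans (H_equivalent_trans Ei E) Ej').
  by rewrite oddD (piece_model_parity i4 (ok i Ni)) (piece_model_parity j4 (ok j Nj)) addbb.
apply: ij; apply: piece_model_inj i4 j4 (ok i Ni) (ok j Nj) _.
by rewrite [LHS]surjective_pairing e1 e2 -surjective_pairing.
Qed.
End Pieces.

Theorem theorem4 (R : realType) (m s k : nat) :
  (1 <= m)%N -> (s <= m)%N ->
  let pieces := [:: piece1 R m s k; piece2 R m s k; piece3 R m s k;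
                    Wtilde R m s k] in
  (* (i) *)
  (dsum R m (KerMLap R m s k) pieces /\
   (forall i, (i < 4)%N -> H_invariant R m (nth (zero_space R m) pieces i)) /\
   (forall i, (i < 4)%N -> nonzero_space R m (nth (zero_space R m) pieces i) ->
       H_irreducible R m (nth (zero_space R m) pieces i)) /\
   (forall i j, (i < 4)%N -> (j < 4)%N -> i <> j ->
       nonzero_space R m (nth (zero_space R m) pieces i) ->
       nonzero_space R m (nth (zero_space R m) pieces j) ->
       ~ H_equivalent R m (nth (zero_space R m) pieces i)
                      (nth (zero_space R m) pieces j))) /\
  (* (ii) *)
  dsum R m (fun P => KerLap R m s k P /\ KerMLap R m s k P)
       [:: piece1 R m s k; piece2 R m s k; piece3 R m s k].
Proof.
move=> m0 sm /=; split; last exact: dsum_KerLap_KerMLap.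
split; first exact: dsum_KerMLap.
split; first by move=> i i4; exact (@H_invariant_pieces R m s k sm i i4).
split=> [i i4 Ni|i j i4 j4 ij Ni Nj]; last exact: (pieces_inequivalent sm m0 i4 j4 ij Ni Nj).
have [Mi Ei] := nonzero_piece sm i4 Ni.
exact: H_irreducible_equiv (subspace_pieces R m s k i) (Hsk_irreducible Mi) Ei.
Qed.
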